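(* Let $0<\alpha<1$ and let $g$ be the density of the Darling--Mandelbrot distribution of parameter $\alpha$. Then $g$ is the unique continuous function on $(0,\infty)$ satisfying, at all non-integer $x>0$, the differential equation $$x\,g'(x)+(1-\alpha)g(x)=-\alpha\,(g*g)(x-1),$$ together with the initial condition $g(x)=C_0x^{\alpha-1}+O(1)$ as $x\to 0^+$, where $C_0=\frac{\sin(\alpha\pi)}{\pi}$.
   Context: For $0<\alpha<1$, the Darling--Mandelbrot distribution of parameter $\alpha$ is the probability distribution on $\mathbb{R}_+$ with characteristic function $\phi_\alpha(s)=\frac{(-is)^{-\alpha}}{-\alpha\,\gamma(-\alpha,-is)}=\bigl(1-\sum_{n\ge1}\frac{\alpha}{n-\alpha}\frac{(is)^n}{n!}\bigr)^{-1}$, where $\gamma(y,z)=\int_0^z x^{y-1}e^{-x}dx$ is the lower incomplete gamma function (extended by analytic continuation); it has a density $g$ supported on $\mathbb{R}_+$. Functions are extended by $0$ on $(-\infty,0]$, and $(g*g)(y)=\int_0^y g(u)g(y-u)\,du$ for $y>0$, $(g*g)(y)=0$ for $y\le 0$. The differential equation is only required outside integer points (where $g$ may be singular). *)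

(* Defs.v *)
From HB Require Import structures.
From mathcomp Require Import all_boot all_order all_algebra.
From mathcomp Require Import complex.
From mathcomp Require Import all_classical all_reals all_analysis.

Set Implicit Arguments.
Unset Strict Implicit.
Unset Printing Implicit Defensive.

Import Order.TTheory GRing.Theory Num.Theory.
Import numFieldNormedType.Exports.

Local Open Scope classical_set_scope.
Local Open Scope ring_scope.
Local Open Scope complex_scope.

(* E[exp(isX)] for X of law P, with exp(isx) = cos(sx) + i sin(sx)
   integrated componentwise. *)
Definition charfun (R : realType) (P : probability (measurableTypeR R) R)
    (s : R) : R[i] :=
  (\int[P]_x cos (s * x)) +i* (\int[P]_x sin (s * x)).

(* phi_alpha(s) = (1 - sum_(n >= 1) alpha / (n - alpha) * (is)^n / n!)^-1.
   By the expansion of the lower incomplete gamma function,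
   gamma(-alpha, z) = z^(-alpha) sum_(n >= 0) (-z)^n / (n! (n - alpha)),
   this equals (-is)^(-alpha) / (- alpha * gamma(-alpha, -is)) for s <> 0;
   the series also covers s = 0. *)
Definition dm_charfun (R : realType) (alpha : R) (s : R) : R[i] :=
  let term (n : nat) : (R[i])^o :=
    alpha%:C / (n%:R - alpha%:C) * (('i%C * s%:C) ^+ n / n`!%:R) in
  (1 - limn (fun N => \sum_(1 <= n < N) term n))^-1.

Definition darling_mandelbrot (R : realType) (alpha : R)
    (P : probability (measurableTypeR R) R) : Prop :=
  P [set x : R | 0 <= x] = 1%E /\ forall s : R, charfun P s = dm_charfun alpha s.

(* As usual, a density is only determined up to Lebesgue-null sets. *)
Definition is_density (R : realType) (P : probability (measurableTypeR R) R)
    (g : R -> R) : Prop :=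
  [/\ measurable_fun setT g,
      forall x, 0 <= g x &
      forall A : set (measurableTypeR R), measurable A ->
        P A = (\int[lebesgue_measure]_(x in A) (g x)%:E)%E].

Definition convolution (R : realType) (g h : R -> R) (y : R) : R :=
  if 0 < y then
    \int[lebesgue_measure]_(u in `]0, y[%classic) (g u * h (y - u))
  else 0.

(* A function on (0, +oo) is represented by its extension by 0 to R. *)
Definition dm_solution (R : realType) (alpha : R) (g : R -> R) : Prop :=
  [/\ forall x : R, x <= 0 -> g x = 0,
      forall x : R, 0 < x -> {for x, continuous g},
      forall x : R, 0 < x -> x \isn't a Num.int ->
        derivable g x 1 /\
        x * g^`()%classic x + (1 - alpha) * g x
          = - alpha * convolution g g (x - 1) &
      (fun x => g x - sin (alpha * pi) / pi * x `^ (alpha - 1))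
        =O_ (0^'+) (fun _ => 1 : R)].

(* Main.v *)
(* Put phi = phi_alpha and let H be the indicator of x > 0. Since phi(s)^-1 =
   e^(is) - is * int_0^1 t^(-alpha) e^(ist) dt, dividing by -is shows that g satisfies
   the renewal equation g * r = H, where r is t^(-alpha) on (0,1] plus H(x - 1).
   Multiplying it by x and convolving with g gives the size-bias identity
   x g(x) = alpha (int_0^x g - int_0^(x-1) g*g) almost everywhere. Its right-hand side
   is continuous, which yields the version f of g; differentiating gives the equation.
   On (0,1) the delayed term vanishes, so f = C x^(alpha-1) there, and the renewal
   equation on (0,1) reads C * int_0^1 u^(alpha-1) (1-u)^(-alpha) du = 1, that is
   C = sin(alpha pi) / pi by the partial fraction expansion of the cosecant.
   Uniqueness goes by steps of length 1: on (n, n+1) two solutions that agree up to n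
   differ by c x^(alpha-1), and c = 0 by continuity at n, or by boundedness if n = 0. *)
Require Import Defs.
From HB Require Import structures.
From mathcomp Require Import all_boot all_order all_algebra.
From mathcomp Require Import all_classical all_reals all_analysis.
From mathcomp Require Import complex measurable_realfun zify ring lra.

Set Implicit Arguments.
Unset Strict Implicit.
Unset Printing Implicit Defensive.

Import Order.TTheory GRing.Theory Num.Theory.
Import numFieldNormedType.Exports.

Local Open Scope classical_set_scope.
Local Open Scope ring_scope.

(** The convolution identities are stated for measurable functions with values in [0, +oo], where
    convolution is commutative and associative by Tonelli alone; nothing is subtracted there, so
    every identity is arranged as an equality of sums. The delicate point of the division by -is is
    that neither H nor r is integrable: Fourier uniqueness is applied to a modification of the
    renewal equation with integrable sides. The size-bias identity rests on a first-order relation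
    for the kernel, x r = H * ((1 - alpha) r + alpha H(x - 1)): inserted in x (g * r) = x H = H * H
    and convolved with g, it lets every r be absorbed by g * r = H, after which the common factor H
    is cancelled. Differentiating the delayed term requires g * g to be continuous away from 0,
    although g is unbounded at 0; this follows from x (g * g) = 2 g * (x g), where x g is bounded
    and has a continuous version. As the renewal equation holds only almost everywhere, the constant
    is read off after one more convolution with H, at the point 1, where r enters through t^(-alpha)
    only. *)

(** * Affine substitutions in Lebesgue integrals of nonnegative functions *)

Section affine_change_of_variables.
Context {R : realType}.
Notation mu := (@lebesgue_measure R).
Local Open Scope ereal_scope.

Lemma measurable_affine (a c : R) : measurable_fun [set: R] (fun y => a + c * y)%R.
Proof. by apply: measurable_funD => //; exact: measurable_funM. Qed.

(** Both sides are measures in A, so they need only be compared on half-open intervals, whose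
    preimages are again half-open intervals because c > 0. *)
Lemma pushforward_affine (a c : R) (A : set R) : (0 < c)%R -> measurable A ->
  c%:E * pushforward mu ((fun y : R => (a + c * y)%R) : R -> measurableTypeR R) A = mu A.
Proof.
move=> c0 mA.
have c0' : (0 <= c)%R by exact: ltW.
pose mphi := @isMeasurableFun.Build _ _ (measurableTypeR R) (measurableTypeR R)
  (fun y : R => (a + c * y)%R) (measurable_affine a c).
pose phi : {mfun (measurableTypeR R) >-> (measurableTypeR R)} :=
  HB.pack (fun y : R => (a + c * y)%R) mphi.
apply/esym.
have := @lebesgue_measure_unique R (mscale (NngNum c0') (pushforward mu phi)).
apply => // _ [[p q]] _ <- /=.
rewrite /mscale /= /pushforward.
have -> : (fun y : R => (a + c * y)%R) @^-1` `]p, q]%classic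
   = `]((p - a) / c)%R, ((q - a) / c)%R]%classic.
  apply/seteqP; split => x /=; rewrite !in_itv /= ltr_pdivrMr // ler_pdivlMr //;
  by move=> /andP[h1 h2]; apply/andP; split; lra.
rewrite !lebesgue_measure_itv /= !lte_fin.
rewrite ltr_pM2r ?invr_gt0 // ltrD2r.
case: ifP => // _; last by rewrite mule0.
by rewrite -EFinD -EFinD -EFinM; congr (_%:E); field; lra.
Qed.

Lemma ge0_integral_affine (a c : R) (f : R -> \bar R) : (0 < c)%R ->
  measurable_fun [set: R] f -> (forall x, 0 <= f x) ->
  \int[mu]_x f x = c%:E * \int[mu]_y f (a + c * y)%R.
Proof.
move=> c0 mf f0.
have c0' : (0 <= c)%R by exact: ltW.
pose mphi := @isMeasurableFun.Build _ _ (measurableTypeR R) (measurableTypeR R)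
  (fun y : R => (a + c * y)%R) (measurable_affine a c).
pose phi : {mfun (measurableTypeR R) >-> (measurableTypeR R)} :=
  HB.pack (fun y : R => (a + c * y)%R) mphi.
have := @ge0_integral_pushforward _ _ (measurableTypeR R) (measurableTypeR R) R
  phi (measurable_affine a c) mu setT f measurableT mf (fun y _ => f0 y).
rewrite preimage_setT => <-.
rewrite -(@ge0_integral_mscale _ _ _ _ _ _ (NngNum c0')) //.
apply: (@eq_measure_integral _ (measurableTypeR R) R setT) => A mA _ /=.
by rewrite /mscale /= pushforward_affine.
Qed.

Lemma ge0_integral_opp (f : R -> \bar R) :
  measurable_fun [set: R] f -> (forall x, 0 <= f x) ->
  \int[mu]_y f (- y)%R = \int[mu]_x f x.
Proof.
move=> mf f0.
have mN : measurable_fun [set: R] (-%R : R -> measurableTypeR R) by exact: oppr_measurable.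
have := @ge0_integral_pushforward _ _ (measurableTypeR R) (measurableTypeR R) R
  (-%R : R -> R) mN mu setT f measurableT mf (fun y _ => f0 y).
rewrite preimage_setT => <-.
by apply: (@eq_measure_integral _ (measurableTypeR R) R setT) => A mA _;
  exact: lebesgue_measureN.
Qed.

Lemma ge0_integral_reflect (a : R) (f : R -> \bar R) :
  measurable_fun [set: R] f -> (forall x, 0 <= f x) ->
  \int[mu]_y f (a - y)%R = \int[mu]_x f x.
Proof.
move=> mf f0.
rewrite (@ge0_integral_affine a 1 f) // mul1e.
rewrite -(@ge0_integral_opp (fun y => f (a + 1 * y)%R)) //.
  by apply: eq_integral => y _; rewrite mul1r.
by apply: measurableT_comp mf (measurable_affine _ _).
Qed.

Lemma ge0_integral_translate (a : R) (f : R -> \bar R) :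
  measurable_fun [set: R] f -> (forall x, 0 <= f x) ->
  \int[mu]_y f (y - a)%R = \int[mu]_x f x.
Proof.
move=> mf f0.
rewrite (@ge0_integral_affine (- a) 1 f) // mul1e.
by apply: eq_integral => y _; rewrite mul1r addrC.
Qed.

End affine_change_of_variables.

(** * The convolution algebra of nonnegative measurable functions *)

Section nonnegative_convolution.
Context {R : realType}.
Notation mu := (@lebesgue_measure R).
Local Open Scope ereal_scope.
Implicit Types f g h : R -> \bar R.

Lemma measurable_fubiniR (F : R * R -> \bar R) : measurable_fun [set: R * R] F ->
  (forall z, 0 <= F z) -> measurable_fun [set: R] (fun x => \int[mu]_y F (x, y)).
Proof.
exact: (@measurable_fun_fubini_tonelli_F _ _ (measurableTypeR R) (measurableTypeR R) R mu).
Qed.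

Lemma tonelliR (F : R * R -> \bar R) : measurable_fun [set: R * R] F ->
  (forall z, 0 <= F z) ->
  \int[mu]_x \int[mu]_y F (x, y) = \int[mu]_y \int[mu]_x F (x, y).
Proof.
exact: (@fubini_tonelli _ _ (measurableTypeR R) (measurableTypeR R) R mu mu).
Qed.

(** The class on which Tonelli's theorem applies without any finiteness condition; it is closed
    under sums, products and convolution. *)
Definition nnmeas f := measurable_fun [set: R] f /\ forall x, 0 <= f x.

Definition econv f g (x : R) : \bar R := \int[mu]_y (f y * g (x - y)%R).

Lemma measurable_fst_sub : measurable_fun [set: R * R] (fun z : R * R => (z.1 - z.2)%R).
Proof. by apply: measurable_funB. Qed.

Lemma measurable_econv_integrand f g : nnmeas f -> nnmeas g ->
  measurable_fun [set: R * R] (fun z : R * R => f z.2 * g (z.1 - z.2)%R).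
Proof.
move=> [mf _] [mg _]; apply: emeasurable_funM.
  by apply: measurableT_comp mf _.
by apply: measurableT_comp mg measurable_fst_sub.
Qed.

Lemma nnmeas_econv f g : nnmeas f -> nnmeas g -> nnmeas (econv f g).
Proof.
move=> nf ng; split; last first.
  by move=> x; apply: integral_ge0 => y _; rewrite mule_ge0 ?nf.2 ?ng.2.
apply: (measurable_fubiniR (measurable_econv_integrand nf ng)).
by move=> z; rewrite mule_ge0 ?nf.2 ?ng.2.
Qed.

Lemma nnmeas_reflect f (a : R) : nnmeas f -> nnmeas (fun y => f (a - y)%R).
Proof.
move=> [mf f0]; split=> //.
by apply: measurableT_comp mf _; exact: measurable_funB.
Qed.

Lemma nnmeas_translate f (a : R) : nnmeas f -> nnmeas (fun y => f (y - a)%R).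
Proof.
move=> [mf f0]; split=> //.
by apply: measurableT_comp mf _; exact: measurable_funB.
Qed.

Lemma nnmeasM f g : nnmeas f -> nnmeas g -> nnmeas (fun y => f y * g y).
Proof.
move=> [mf f0] [mg g0]; split; first exact: emeasurable_funM.
by move=> x; rewrite mule_ge0.
Qed.

Lemma nnmeasD f g : nnmeas f -> nnmeas g -> nnmeas (fun y => f y + g y).
Proof.
move=> [mf f0] [mg g0]; split; first exact: emeasurable_funD.
by move=> x; rewrite adde_ge0.
Qed.

Lemma econvC f g : nnmeas f -> nnmeas g -> econv f g = econv g f.
Proof.
move=> nf ng; apply/funext => x.
have [m p] := nnmeasM nf (nnmeas_reflect x ng).
rewrite /econv -(ge0_integral_reflect x m p).
by apply: eq_integral => y _; rewrite muleC; congr (g _ * _); rewrite opprB addrC subrK.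
Qed.

(** After a translation of the inner variable by y, both sides are the double integral of f(y) g(z -
    y) h(x - z), taken in the two orders. *)
Lemma econvA f g h : nnmeas f -> nnmeas g -> nnmeas h ->
  econv f (econv g h) = econv (econv f g) h.
Proof.
move=> nf ng nh; apply/funext => x.
have [mf f0] := nf; have [mg g0] := ng; have [mh h0] := nh.
transitivity (\int[mu]_y \int[mu]_z (f y * g (z - y)%R * h (x - z)%R)).
  apply: eq_integral => y _; rewrite /econv.
  have [m p] := nnmeasM ng (nnmeas_reflect (x - y) nh).
  rewrite -(ge0_integral_translate y m p) -ge0_integralZl //; last first.
    by case: (nnmeas_translate y (conj m p)).
  apply: eq_integral => z _; rewrite -muleA; congr (_ * (_ * h _)).
  by rewrite opprB addrA subrK.
have F : measurable_fun [set: R * R]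
    (fun z : R * R => f z.1 * g (z.2 - z.1)%R * h (x - z.2)%R).
  apply: emeasurable_funM; first apply: emeasurable_funM.
  - by apply: measurableT_comp mf _.
  - by apply: measurableT_comp mg _; exact: measurable_funB.
  - by apply: measurableT_comp mh _; exact: measurable_funB.
rewrite (tonelliR F); last first.
  by move=> z; rewrite !mule_ge0.
apply: eq_integral => z _ /=.
rewrite /econv -ge0_integralZr //.
- by apply: emeasurable_funM => //; case: (nnmeas_reflect z ng).
- by move=> y _; rewrite mule_ge0.
Qed.

Lemma econvDl f g h : nnmeas f -> nnmeas g -> nnmeas h ->
  econv (fun y => f y + g y) h = (fun x => econv f h x + econv g h x).
Proof.
move=> nf ng nh; apply/funext => x; rewrite /econv -ge0_integralD //.
- by apply: eq_integral => y _; rewrite ge0_muleDl ?nf.2 ?ng.2.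
- by move=> y _; rewrite mule_ge0 ?nf.2 ?nh.2.
- by case: (nnmeasM nf (nnmeas_reflect x nh)).
- by move=> y _; rewrite mule_ge0 ?ng.2 ?nh.2.
- by case: (nnmeasM ng (nnmeas_reflect x nh)).
Qed.

Lemma econvDr f g h : nnmeas f -> nnmeas g -> nnmeas h ->
  econv h (fun y => f y + g y) = (fun x => econv h f x + econv h g x).
Proof.
move=> nf ng nh; rewrite econvC //; last exact: nnmeasD.
by rewrite econvDl // (econvC nf nh) (econvC ng nh).
Qed.

Lemma nnmeasZ f (c : R) : (0 <= c)%R -> nnmeas f -> nnmeas (fun y => c%:E * f y).
Proof. by move=> c0 nf; apply: nnmeasM => //; split => // x; rewrite lee_fin. Qed.

Lemma econvZr f g (c : R) : (0 <= c)%R -> nnmeas f -> nnmeas g ->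
  econv f (fun y => c%:E * g y) = (fun x => c%:E * econv f g x).
Proof.
move=> c0 nf ng; apply/funext => x; rewrite /econv -ge0_integralZl_EFin //.
- by apply: eq_integral => y _; rewrite muleCA.
- by move=> y _; rewrite mule_ge0 ?nf.2 ?ng.2.
- by case: (nnmeasM nf (nnmeas_reflect x ng)).
Qed.

Lemma eq_econv_ael f g h : nnmeas f -> nnmeas g -> nnmeas h ->
  ae_eq mu setT f g -> econv f h = econv g h.
Proof.
move=> nf ng nh fg; apply/funext => x; apply: ge0_ae_eq_integral => //.
- by case: (nnmeasM nf (nnmeas_reflect x nh)).
- by case: (nnmeasM ng (nnmeas_reflect x nh)).
- by move=> y _; rewrite mule_ge0 ?nf.2 ?nh.2.
- by move=> y _; rewrite mule_ge0 ?ng.2 ?nh.2.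
- by apply: filterS fg => y /= + _ => ->.
Qed.

Lemma eq_econv_aer f g h : nnmeas f -> nnmeas g -> nnmeas h ->
  ae_eq mu setT f g -> econv h f = econv h g.
Proof.
move=> nf ng nh fg.
by rewrite econvC // (eq_econv_ael nf ng nh fg) econvC.
Qed.

Lemma integral_econv f g : nnmeas f -> nnmeas g ->
  \int[mu]_x econv f g x = (\int[mu]_x f x) * (\int[mu]_x g x).
Proof.
move=> nf ng; rewrite /econv.
rewrite (tonelliR (measurable_econv_integrand nf ng)) /=; last first.
  by move=> z; rewrite mule_ge0 ?nf.2 ?ng.2.
have g0 : 0 <= \int[mu]_x g x by apply: integral_ge0 => x _; exact: ng.2.
rewrite -ge0_integralZr //; [|exact: nf.1|by move=> x _; exact: nf.2].
apply: eq_integral => y _.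
rewrite ge0_integralZl //.
- by rewrite ge0_integral_translate //; [exact: ng.1|exact: ng.2].
- by case: (nnmeas_translate y ng).
- by move=> x _; exact: ng.2.
- exact: nf.2.
Qed.

Lemma econvCA f g h : nnmeas f -> nnmeas g -> nnmeas h ->
  econv f (econv g h) = econv g (econv f h).
Proof. by move=> nf ng nh; rewrite econvA // (econvC nf ng) -econvA. Qed.

Lemma econv_le f g (c : R) (x : R) : nnmeas f -> nnmeas g ->
  (forall y, g y <= c%:E) -> econv f g x <= c%:E * \int[mu]_y f y.
Proof.
move=> nf ng gc; have c0 : 0 <= c%:E := le_trans (ng.2 0%R) (gc 0%R).
rewrite -ge0_integralZl //; [|exact: nf.1|by move=> y _; exact: nf.2].
apply: ge0_le_integral => //.
- by move=> y _; rewrite mule_ge0 ?nf.2 ?ng.2.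
- by case: (nnmeasM nf (nnmeas_reflect x ng)).
- by apply: emeasurable_funM => //; exact: nf.1.
- by move=> y _; rewrite muleC lee_wpmul2r // nf.2.
Qed.

Definition causal f := forall x : R, (x <= 0)%R -> f x = 0.

Lemma causal_econv f g : causal f -> causal g -> causal (econv f g).
Proof.
move=> cf cg x x0; apply: integral0_eq => y _.
have [y0|y0] := leP y 0%R; first by rewrite cf // mul0e.
by rewrite cg ?mule0 // subr_le0 ltW // (le_lt_trans x0).
Qed.

(* Truncating at 0 keeps [xmul f] nonnegative; it loses nothing on causal functions. *)
Definition xmul f (x : R) : \bar R := (Num.max x 0)%:E * f x.

Lemma nnmeas_xmul f : nnmeas f -> nnmeas (xmul f).
Proof.
move=> nf; apply: nnmeasM => //; split => [|x]; last by rewrite lee_fin le_max lexx orbT.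
by apply/measurable_EFinP; apply: measurable_maxr.
Qed.

Lemma causal_xmul f : causal f -> causal (xmul f).
Proof. by move=> cf x x0; rewrite /xmul cf // mule0. Qed.

(* Convolution version of x = u + (x - u): multiplication by x is a derivation. *)
Lemma xmul_econv f g : nnmeas f -> nnmeas g -> causal f -> causal g ->
  xmul (econv f g) = (fun x => econv (xmul f) g x + econv f (xmul g) x).
Proof.
move=> nf ng cf cg; apply/funext => x.
rewrite /econv -ge0_integralD //; first last.
- by case: (nnmeasM nf (nnmeas_reflect x (nnmeas_xmul ng))).
- by move=> y _; rewrite mule_ge0 ?nf.2 // (nnmeas_xmul ng).2.
- by case: (nnmeasM (nnmeas_xmul nf) (nnmeas_reflect x ng)).
- by move=> y _; rewrite mule_ge0 ?ng.2 // (nnmeas_xmul nf).2.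
rewrite /xmul /econv -ge0_integralZl //; first last.
- by rewrite lee_fin le_max lexx orbT.
- by move=> y _; rewrite mule_ge0 ?nf.2 ?ng.2.
- by case: (nnmeasM nf (nnmeas_reflect x ng)).
apply: eq_integral => y _.
have [y0|y0] := leP y 0%R; first by rewrite cf // !(mule0,mul0e) add0e.
have [xy|xy] := leP (x - y)%R 0%R; first by rewrite cg // !(mule0,mul0e) add0e.
have [xx|xx] := leP x 0%R.
  by move: xy; rewrite subr_gt0 => /(lt_trans y0); rewrite ltNge xx.
rewrite [X in _ = _ + X]muleCA -muleA -ge0_muleDl ?lee_fin ?ltW //.
by rewrite -EFinD (addrC y) subrK.
Qed.

End nonnegative_convolution.

(** * Primitives, and cancellation of the Heaviside function in convolutions *)

Section primitives.
Context {R : realType}.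
Notation mu := (@lebesgue_measure R).
Local Open Scope ereal_scope.
Implicit Types f g h : R -> \bar R.

Lemma aeS (P Q : R -> Prop) : (forall x, P x -> Q x) ->
  {ae mu, forall x, P x} -> {ae mu, forall x, Q x}.
Proof. exact: (@filterS _ _ (ae_filter_ringOfSetsType mu)). Qed.

Lemma aeI (P Q : R -> Prop) : {ae mu, forall x, P x} ->
  {ae mu, forall x, Q x} -> {ae mu, forall x, P x /\ Q x}.
Proof. exact: (@filterI _ _ (ae_filter_ringOfSetsType mu)). Qed.

(** Passage from extended to real values, as Lebesgue differentiation requires; finite primitives
    force f to be finite almost everywhere. *)
Lemma locally_integrable_of_primitive f : nnmeas f ->
  (forall x, \int[mu]_(y in `]-oo, x]) f y < +oo) ->
  [/\ forall x, mu.-integrable `]-oo, x] (EFin \o (fine \o f)),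
      locally_integrable [set: R] (fine \o f) &
      ae_eq mu setT (EFin \o (fine \o f)) f].
Proof.
move=> [mf f0] flty.
have intf x : mu.-integrable `]-oo, x] f.
  apply/integrableP; split; first exact: measurable_funTS.
  by under eq_integral => y _ do rewrite gee0_abs //.
have mff : measurable_fun [set: R] (fine \o f).
  exact: measurableT_comp (fine_measurable measurableT) mf.
have le_fine x : `| (fine (f x))%:E | <= `|f x|.
  by have := f0 x; case: (f x) => //= _; rewrite normr0 leey.
have intff x : mu.-integrable `]-oo, x] (EFin \o (fine \o f)).
  apply: (le_integrable _ _ _ (intf x)) => //.
  - by apply/measurable_EFinP; exact: measurable_funTS.
  - by move=> y _; exact: le_fine.
split => //.
- split => //; first exact: openT.
  move=> K _ cK.
  have [M [_ KM]] := compact_bounded cK.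
  have {}KM : K `<=` `]-oo, (M + 1)%R].
    move=> x /(KM (M + 1)%R); rewrite ltrDl => /(_ ltr01) /= xM.
    by rewrite in_itv /=; apply: le_trans (ler_norm _) xM.
  have /integrableP[_] := intff (M + 1)%R.
  apply: le_lt_trans; apply: ge0_subset_integral => //.
  + exact: compact_measurable.
  + by apply/measurable_funTS; do 2 apply: measurableT_comp => //.
(* The exceptional set is null on each of the countably many half-lines that cover R. *)
- have : forall n, {ae mu, forall x, `]-oo, n%:R]%classic x -> f x \is a fin_num}.
    by move=> n; exact: integrable_ae (intf _).
  move=> /ae_foralln; apply: filterS => x /= h _.
  rewrite fineK //; apply: (h (Num.truncn `|x|).+1).
  by rewrite /= in_itv /= (le_trans (ler_norm x)) // ltW // truncnS_gt.
Qed.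

(** By Lebesgue's differentiation theorem, f and g are almost everywhere the derivative of their
    common primitive. *)
Lemma ae_eq_of_primitives f g : nnmeas f -> nnmeas g ->
  (forall x, \int[mu]_(y in `]-oo, x]) f y < +oo) ->
  (forall x, \int[mu]_(y in `]-oo, x]) f y = \int[mu]_(y in `]-oo, x]) g y) ->
  ae_eq mu setT f g.
Proof.
move=> nf ng flty fg.
have glty x : \int[mu]_(y in `]-oo, x]) g y < +oo by rewrite -fg.
have [If Lf Ef] := locally_integrable_of_primitive nf flty.
have [Ig Lg Eg] := locally_integrable_of_primitive ng glty.
have := FTC1Ny Ig Lg; have := FTC1Ny If Lf.
have P k : nnmeas k -> ae_eq mu setT (EFin \o (fine \o k)) k ->
    (fun x => \int[mu]_(t in [set` `]-oo, x]]) (fine \o k) t)%R =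
    (fun x => fine (\int[mu]_(t in [set` `]-oo, x]]) k t)).
  move=> nk Ek; apply/funext => x; congr fine.
  apply: ae_eq_integral => //.
  - apply/measurable_EFinP/measurable_funTS.
    exact: measurableT_comp (fine_measurable measurableT) nk.1.
  - exact: measurable_funTS nk.1.
  - by apply: filterS Ek => y h _; exact: h.
rewrite (P f) // (P g) //.
under [in X in _ -> X -> _]eq_fun => x do rewrite -fg.
move=> Hf Hg; have := aeI (aeI Hf Hg) (aeI Ef Eg).
apply: aeS => x /= [[[_ {}Hf] [_ {}Hg]] [{}Ef {}Eg]] _.
by rewrite -Ef // -Eg //= -[in LHS]Hf -[in RHS]Hg.
Qed.

(** The value 0 at the origin makes it [causal]. Convolution with it is integration from -oo. *)
Definition heav (x : R) : \bar R := (0 < x)%R%:R%:E.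

Lemma nnmeas_heav : nnmeas heav.
Proof.
split => [|x]; last by rewrite lee_fin.
apply/measurable_EFinP.
have -> : (fun x : R => (0 < x)%R%:R) = (\1_(`]0%R, +oo[%classic) : R -> R).
  by apply/funext => x; rewrite indicE mem_setE in_itv /= andbT.
exact: measurable_indic.
Qed.

Lemma causal_heav : causal heav.
Proof. by move=> x x0; rewrite /heav ltNge x0. Qed.

Lemma econv_heav f x : nnmeas f ->
  econv heav f x = \int[mu]_(y in `]-oo, x]) f y.
Proof.
move=> nf; rewrite (econvC nnmeas_heav nf) /econv.
rewrite -integral_itv_bndo_bndc; last exact: measurable_funTS nf.1.
rewrite [RHS]integral_mkcond; apply: eq_integral => y _.
rewrite patchE mem_setE in_itv /= /heav subr_gt0.
by case: ifP => _; rewrite ?mule1 ?mule0.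
Qed.

Lemma econv_heav_inj f g : nnmeas f -> nnmeas g ->
  (forall x, econv heav f x < +oo) -> econv heav f = econv heav g ->
  ae_eq mu setT f g.
Proof.
move=> nf ng fy fg; apply: ae_eq_of_primitives => // x.
  by rewrite -econv_heav.
by rewrite -!econv_heav // fg.
Qed.

End primitives.

(** * The Laplace integral of a shifted cosine *)

Section damped_cosine.
Context {R : realType}.
Notation mu := (@lebesgue_measure R).

Lemma is_derive_continuous (f : R -> R) (x d : R) : is_derive x 1 f d ->
  {for x, continuous f}.
Proof. by move=> [df _]; apply/differentiable_continuous/derivable1_diffP. Qed.

Lemma is_derive_affine (s t x : R) : is_derive x 1 (fun x : R => s * x - t) s.
Proof.
have h : is_derive x 1 ((cst s * id) - cst t : R -> R) s.
  by apply: is_derive_eq; rewrite /GRing.scale /=; ring.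
exact: h.
Qed.

Lemma is_derive_sin_affine (s t x : R) :
  is_derive x 1 (fun x : R => sin (s * x - t)) (s * cos (s * x - t)).
Proof.
rewrite mulrC; apply: (@is_derive1_comp _ sin (fun x : R => s * x - t)).
exact: is_derive_affine.
Qed.

Lemma is_derive_cos_affine (s t x : R) :
  is_derive x 1 (fun x : R => cos (s * x - t)) (- s * sin (s * x - t)).
Proof.
rewrite mulrC mulrN -mulNr; apply: (@is_derive1_comp _ cos (fun x : R => s * x - t)).
exact: is_derive_affine.
Qed.

Lemma is_derive_expR_scale (e x : R) :
  is_derive x 1 (fun x : R => expR (- e * x)) (- e * expR (- e * x)).
Proof.
rewrite mulrC; apply: (@is_derive1_comp _ expR (fun x : R => - e * x)).
have := @is_derive_affine (- e) 0 x.
by under [in X in X -> _]eq_fun do rewrite subr0.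
Qed.

Lemma cvg_expR_scale (e : R) : 0 < e -> expR (- e * x) @[x --> +oo] --> (0 : R).
Proof.
move=> e0; under eq_fun do rewrite mulNr.
apply: (@cvg_comp _ _ _ (fun x : R => e * x) (fun y => expR (- y)) _ (+oo%R)).
  exact: gt0_cvgMry.
exact: cvgr_expR.
Qed.

(** Serves twice: with t = 0 and s a difference x - y it produces the Poisson kernel, and with e = 1
    the Fourier transform of the exponential density. *)
Lemma integral_damped_cos (e s t : R) : 0 < e ->
  (\int[mu]_(x in `[0%R, +oo[) (expR (- e * x) * (1 + cos (s * x - t)))%:E =
  (e^-1 + (s * sin t + e * cos t) / (e ^+ 2 + s ^+ 2))%:E)%E.
Proof.
move=> e0.
have es0 : 0 < e ^+ 2 + s ^+ 2 by rewrite ltr_pwDl ?exprn_gt0 ?sqr_ge0.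
pose D := (e ^+ 2 + s ^+ 2)^-1.
(* The antiderivative that vanishes at +oo, so that the integral is - F 0. *)
pose F (x : R) := expR (- e * x) *
  (- e^-1 + (s * sin (s * x - t) - e * cos (s * x - t)) * D).
have dF (x : R) : is_derive x 1 F (expR (- e * x) * (1 + cos (s * x - t))).
  have h : is_derive x 1 ((fun x => expR (- e * x)) *
    (cst (- e^-1) + (cst s * (fun x => sin (s * x - t)) -
       cst e * (fun x => cos (s * x - t))) * cst D) : R -> R)
    (expR (- e * x) * (1 + cos (s * x - t))).
    have hs := is_derive_sin_affine s t x; have hc := is_derive_cos_affine s t x.
    have he := is_derive_expR_scale e x.
    apply: is_derive_eq.
    rewrite /GRing.scale /= !fctE /D.
    by field; rewrite (gt_eqF e0) (gt_eqF es0).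
  exact: h.
have cvg0 : F x @[x --> +oo] --> (0 : R).
  pose M := e^-1 + (`|s| + e) * D.
  have D0 : 0 <= D by rewrite invr_ge0 ltW.
  have e1 : 0 <= e^-1 by rewrite invr_ge0 ltW.
  have bd (x : R) : `| - e^-1 + (s * sin (s * x - t) - e * cos (s * x - t)) * D| <= M.
    rewrite (le_trans (ler_normD _ _)) // normrN (ger0_norm e1) lerD2l normrM.
    rewrite (ger0_norm D0) ler_wpM2r // (le_trans (ler_normB _ _)) //.
    rewrite !normrM (gtr0_norm e0) lerD //.
      by apply: ler_piMr => //; exact: sin_max.
    by apply: ler_piMr; [exact: ltW|exact: cos_max].
  have cM : (M * expR (- e * x)) @[x --> +oo] --> (0 : R).
    by rewrite -(mulr0 M); apply: cvgMr; exact: cvg_expR_scale.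
  have cN : (- (M * expR (- e * x))) @[x --> +oo] --> (0 : R).
    by rewrite -oppr0; apply: cvgN.
  apply: (squeeze_cvgr _ cN cM); apply: nearW => x; rewrite -ler_norml /F normrM.
  by rewrite mulrC (ger0_norm (expR_ge0 _)) ler_wpM2r // expR_ge0.
have f0 (x : R) : 0 <= expR (- e * x) * (1 + cos (s * x - t)).
  by rewrite mulr_ge0 ?expR_ge0 //; have := cos_geN1 (s * x - t); lra.
have cf : continuous (fun x : R => expR (- e * x) * (1 + cos (s * x - t))).
  move=> x; apply: cvgM.
    exact: is_derive_continuous (is_derive_expR_scale _ _).
  apply: cvgD; first exact: cvg_cst.
  exact: is_derive_continuous (is_derive_cos_affine _ _ _).
rewrite (@ge0_continuous_FTC2y R _ F 0 0 (fun x _ => f0 x)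
  (continuous_subspaceT cf) cvg0 (fun x _ => @ex_derive _ _ _ _ _ _ _ (dF x))
  (cvg_at_right_filter (is_derive_continuous (dF 0)))).
- rewrite -EFinB /F !mulr0 expR0 !sub0r sinN cosN; congr EFin.
  by rewrite /D; ring.
- by move=> x _; rewrite derive1E; case: (dF x) => _ ->.
Qed.

End damped_cosine.

(** * Uniqueness for Fourier transforms by Poisson smoothing *)

Section fourier_uniqueness.
Context {R : realType}.
Notation mu := (@lebesgue_measure R).
Local Open Scope ereal_scope.
Implicit Types F : R -> \bar R.

Lemma adde_cancel (c x y : \bar R) : c \is a fin_num -> c + x = c + y -> x = y.
Proof. by move=> fc h; rewrite -(addeK x fc) addeC -(addeC c) h (addeC c) addeC addeK. Qed.

Lemma tonelli_kernel F (k : R * R -> R) : nnmeas F ->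
  measurable_fun [set: R * R] k -> (forall z, 0 <= k z)%R ->
  \int[mu]_x (F x * \int[mu]_s (k (x, s))%:E) =
  \int[mu]_s \int[mu]_x (F x * (k (x, s))%:E).
Proof.
move=> [mF F0] mk k0.
rewrite -(@tonelliR R (fun z => F z.1 * (k z)%:E)) /=; first last.
- by move=> z; rewrite mule_ge0 ?lee_fin.
- apply: emeasurable_funM; first by apply: measurableT_comp mF _.
  exact/measurable_EFinP.
apply: eq_integral => x _; rewrite ge0_integralZl //.
- apply/measurable_EFinP; apply: measurableT_comp mk _.
  exact: measurable_pair1.
- by move=> s _; rewrite lee_fin.
Qed.

(** The Poisson kernel of the half-plane without its factor 1/pi. *)
Definition poisson_kernel (e z : R) : R := (e / (e ^+ 2 + z ^+ 2))%R.

Lemma poisson_kernel_ge0 e z : (0 < e)%R -> (0 <= poisson_kernel e z)%R.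
Proof. by move=> e0; rewrite divr_ge0 ?ltW // ltr_pwDl ?exprn_gt0 ?sqr_ge0. Qed.

Lemma continuous_poisson_kernel e : (0 < e)%R -> continuous (poisson_kernel e).
Proof.
move=> e0 z; apply: cvgM; first exact: cvg_cst.
apply: cvgV; first by rewrite gt_eqF // ltr_pwDl ?exprn_gt0 ?sqr_ge0.
by apply: cvgD; [exact: cvg_cst|apply: (@exprn_continuous R 2)].
Qed.

Lemma integral_poisson_kernel (e x a b : R) : (0 < e)%R -> (a < b)%R ->
  \int[mu]_(y in `[a, b]) (poisson_kernel e (x - y)%R)%:E =
  (atan ((b - x) / e) - atan ((a - x) / e))%R%:E.
Proof.
move=> e0 ab.
have dF (y : R) : is_derive y (1%R : R) (fun y => atan ((y - x) / e)%R) (poisson_kernel e (x - y)%R).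
  have h := @is_derive_affine R (e^-1)%R (e^-1 * x)%R y.
  have -> : (fun y => atan ((y - x) / e)%R) = (atan \o (fun y : R => e^-1 * y - e^-1 * x))%R.
    by apply/funext => z /=; congr atan; ring.
  have -> : poisson_kernel e (x - y)%R =
      ((1 + (e^-1 * y - e^-1 * x) ^+ 2)^-1 * e^-1)%R.
    rewrite /poisson_kernel; have h1 : (e ^+ 2 + (x - y) ^+ 2 != 0)%R.
      by rewrite gt_eqF // ltr_pwDl ?exprn_gt0 ?sqr_ge0.
    have -> : (1 + (e^-1 * y - e^-1 * x) ^+ 2 = (e ^+ 2 + (x - y) ^+ 2) / e ^+ 2)%R.
      by field; rewrite gt_eqF.
    by field; rewrite h1 gt_eqF.
  exact: is_derive1_comp.
have cF : continuous (fun y => atan ((y - x) / e)%R).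
  by move=> y; exact: is_derive_continuous (dF y).
rewrite (@continuous_FTC2 R (fun y => poisson_kernel e (x - y)%R) (fun y => atan ((y - x) / e)%R) a b) //.
- apply: continuous_subspaceT => y; apply: (@continuous_comp _ _ _ (fun y => (x - y)%R)).
    by apply: cvgB; [exact: cvg_cst|exact: cvg_id].
  exact: continuous_poisson_kernel.
- split.
  + by move=> y _; case: (dF y).
  + exact: cvg_at_right_filter (cF a).
  + exact: cvg_at_left_filter (cF b).
- by move=> y _; rewrite derive1E; case: (dF y) => _ ->.
Qed.

(** Averaging the trigonometric tests of F over the frequency s with weight e^(-es) gives the
    Poisson smoothing of F at y. The summand with e^-1 comes from the constant in 1 + cos. *)
Lemma poisson_kernel_smoothing F (e y : R) : nnmeas F -> (0 < e)%R ->
  (e^-1)%R%:E * (\int[mu]_x F x) + \int[mu]_x (F x * (poisson_kernel e (x - y)%R)%:E) =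
  \int[mu]_(s in `[0%R, +oo[)
    ((expR (- e * s)%R)%:E * \int[mu]_x (F x * (1 + cos (s * x - s * y))%R%:E)).
Proof.
move=> nF e0; have [mF F0] := nF.
pose k (z : R * R) : R := (\1_(`[0%R, +oo[%classic) z.2 *
   (expR (- e * z.2) * (1 + cos (z.2 * z.1 - z.2 * y))))%R.
have cosge (u : R) : (0 <= 1 + cos u)%R by have := cos_geN1 u; lra.
have mk : measurable_fun [set: R * R] k.
  apply: measurable_funM; first by apply: measurableT_comp => //; exact: measurable_indic.
  apply: measurable_funM.
    apply: measurableT_comp => //; apply: measurable_funM => //.
  apply: measurable_funD => //.
  apply: (measurableT_comp (continuous_measurable_fun (@continuous_cos R))).
  by apply: measurable_funB; apply: measurable_funM.
have k0 z : (0 <= k z)%R by rewrite /k !mulr_ge0 ?expR_ge0 //.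
transitivity (\int[mu]_x (F x * \int[mu]_s (k (x, s))%:E)); last first.
  rewrite (tonelli_kernel nF mk k0) [RHS]integral_mkcond; apply: eq_integral => s _.
  rewrite patchE mem_setE in_itv /= andbT.
  have k1 x : k (x, s) = ((0 <= s)%R%:R * (expR (- e * s) * (1 + cos (s * x - s * y))))%R.
    by rewrite /k indicE mem_setE in_itv /= andbT.
  under eq_integral => x _ do rewrite k1.
  case: ifP => _.
    rewrite -ge0_integralZl //.
    - by apply: eq_integral => x _; rewrite mul1r muleCA EFinM.
    - apply: emeasurable_funM => //; apply/measurable_EFinP; apply: measurable_funD => //.
      apply: (measurableT_comp (continuous_measurable_fun (@continuous_cos R))).
      by apply: measurable_funB => //; apply: measurable_funM.
    - by move=> x _; rewrite mule_ge0 ?lee_fin.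
  by apply: integral0_eq => x _; rewrite mul0r mule0.
have mW : measurable_fun [set: R] (fun x => poisson_kernel e (x - y)%R).
  apply: (measurableT_comp (continuous_measurable_fun (continuous_poisson_kernel e0))).
  exact: measurable_funB.
have W0 x : (0 <= poisson_kernel e (x - y))%R by exact: poisson_kernel_ge0.
rewrite -ge0_integralZl ?lee_fin ?invr_ge0 ?ltW // -ge0_integralD //; first last.
- by apply: emeasurable_funM => //; exact/measurable_EFinP.
- by move=> x _; rewrite mule_ge0 ?lee_fin.
- exact: emeasurable_funM.
- by move=> x _; rewrite mule_ge0 ?lee_fin // invr_ge0 ltW.
apply: eq_integral => x _.
have -> : \int[mu]_s (k (x, s))%:E = (e^-1 + poisson_kernel e (x - y))%:E.
  have := @integral_damped_cos R e (x - y)%R 0%R e0.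
  rewrite sin0 cos0 mulr0 mulr1 add0r => <-.
  rewrite [RHS]integral_mkcond; apply: eq_integral => s _.
  rewrite patchE mem_setE /k indicE /= mem_setE in_itv /= andbT.
  case: ifP => _; last by rewrite mul0r.
  by rewrite mul1r; congr (_ * (1 + cos _))%R%:E; ring.
rewrite EFinD ge0_muleDr ?lee_fin ?W0 ?invr_ge0 ?(ltW e0) //.
by congr (_ + _); exact: muleC.
Qed.

(** The integral of y |-> [poisson_kernel e (x - y)] over [a, b]; as e tends to 0 it tends to pi
    inside the interval and to 0 outside. *)
Definition atan_bump (e a b x : R) : R := (atan ((b - x) / e) - atan ((a - x) / e))%R.

Lemma atan_bump_ge0 e a b x : (0 < e)%R -> (a < b)%R -> (0 <= atan_bump e a b x)%R.
Proof.
move=> e0 ab; rewrite subr_ge0; apply: le_atan.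
by rewrite ler_pM2r ?invr_gt0 // lerD2r ltW.
Qed.

Lemma atan_bump_le e a b x : (atan_bump e a b x <= pi)%R.
Proof.
rewrite /atan_bump; have := atan_ltpi2 ((b - x) / e); have := atan_gtNpi2 ((a - x) / e).
by lra.
Qed.

Lemma measurable_atan_bump e a b : measurable_fun [set: R] (atan_bump e a b).
Proof.
by apply: measurable_funB; apply: (measurableT_comp (continuous_measurable_fun (@continuous_atan R)));
  apply: measurable_funM => //; apply: measurable_funB.
Qed.

Lemma integral_atan_bump F (e a b : R) : nnmeas F -> (0 < e)%R -> (a < b)%R ->
  \int[mu]_x (F x * (atan_bump e a b x)%:E) =
  \int[mu]_(y in `[a, b]) \int[mu]_x (F x * (poisson_kernel e (x - y)%R)%:E).
Proof.
move=> nF e0 ab; have [mF F0] := nF.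
pose k (z : R * R) : R := (\1_(`[a, b]%classic) z.2 * poisson_kernel e (z.1 - z.2))%R.
have mk : measurable_fun [set: R * R] k.
  apply: measurable_funM; first by apply: measurableT_comp => //; exact: measurable_indic.
  apply: (measurableT_comp (continuous_measurable_fun (continuous_poisson_kernel e0))).
  exact: measurable_funB.
have k0 z : (0 <= k z)%R by rewrite /k mulr_ge0 // poisson_kernel_ge0.
transitivity (\int[mu]_x (F x * \int[mu]_s (k (x, s))%:E)).
  apply: eq_integral => x _; congr (_ * _).
  rewrite -integral_poisson_kernel // integral_mkcond; apply: eq_integral => s _.
  by rewrite patchE mem_setE /k indicE mem_setE /=; case: ifP => _; rewrite ?mul1r ?mul0r.
rewrite (tonelli_kernel nF mk k0) [RHS]integral_mkcond; apply: eq_integral => s _.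
have k1 x : k (x, s) = ((s \in `[a, b])%:R * poisson_kernel e (x - s))%R.
  by rewrite /k indicE mem_setE.
under eq_integral => x _ do rewrite k1.
rewrite patchE mem_setE; case: ifP => _.
  by apply: eq_integral => x _; rewrite mul1r.
by apply: integral0_eq => x _; rewrite mul0r mule0.
Qed.

Lemma cvg_atan_scale (c : R) :
  (atan (c * n.+1%:R) @[n --> \oo] --> Num.sg c * (pi / 2))%R.
Proof.
have pos (d : R) : (0 < d)%R -> (atan (d * n.+1%:R) @[n --> \oo] --> (pi / 2))%R.
  move=> d0; apply: (@cvg_comp _ _ _ (fun n : nat => n.+1%:R : R) (fun y => atan (d * y)) _ (+oo%R)).
    by rewrite (cvg_shiftS (fun n => n%:R : R)); exact: cvgr_idn.
  apply: (@cvg_comp _ _ _ (fun y : R => d * y)%R atan _ (+oo%R)); last exact: cvgy_atan.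
  exact: (@gt0_cvgMry _ _ _ _ id).
have [c0|c0|->] := ltrgtP c 0%R; last first.
- rewrite sgr0 mul0r; under eq_fun do rewrite mul0r atan0; exact: cvg_cst.
- by rewrite gtr0_sg // mul1r; exact: pos.
- rewrite ltr0_sg // mulN1r; under eq_fun do rewrite -(opprK (c * _)%R) -mulNr atanN.
  by apply: cvgN; apply: pos; rewrite oppr_gt0.
Qed.

Lemma ae_neq (a : R) : {ae mu, forall x, x != a}.
Proof.
exists [set a]; split; [exact: measurable_set1|exact: lebesgue_measure_set1|].
by move=> x /= /negP; rewrite negbK => /eqP.
Qed.

(** The tests determine all Poisson smoothings. Integrating these over y in [a, b] replaces the
    kernel by [atan_bump], and dominated convergence as e tends to 0 leaves pi times the integral
    over ]a, b[. *)
Lemma fourier_unique F1 F2 : nnmeas F1 -> nnmeas F2 -> \int[mu]_x F1 x < +oo ->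
  (forall s t, \int[mu]_x (F1 x * (1 + cos (s * x - t))%R%:E) =
     \int[mu]_x (F2 x * (1 + cos (s * x - t))%R%:E)) ->
  forall a b, (a < b)%R ->
  \int[mu]_(x in `]a, b[) F1 x = \int[mu]_(x in `]a, b[) F2 x.
Proof.
move=> nF1 nF2 F1y H a b ab.
have [mF1 F10] := nF1; have [mF2 F20] := nF2.
have mass : \int[mu]_x F1 x = \int[mu]_x F2 x.
  (* At s = t = 0 the test function is the constant 2, so the total masses agree. Being finite, the
     mass term of the smoothing identity can then be cancelled. *)
  have h0 F : nnmeas F -> \int[mu]_x (F x * (1 + cos (0 * x - 0))%R%:E) =
      (\int[mu]_x F x) * (1 + 1)%R%:E.
    move=> [mF F0]; rewrite -ge0_integralZr ?lee_fin //.
    by apply: eq_integral => x _; rewrite mul0r subr0 cos0.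
  have := H 0%R 0%R; rewrite !h0 //.
  have two0 : (1 + 1 != 0 :> R)%R by rewrite gt_eqF.
  move=> /(congr1 (fun z => z * (1 + 1)^-1%R%:E)).
  by rewrite -!muleA -EFinM divff // !mule1.
have HW e y : (0 < e)%R ->
    \int[mu]_x (F1 x * (poisson_kernel e (x - y)%R)%:E) =
    \int[mu]_x (F2 x * (poisson_kernel e (x - y)%R)%:E).
  move=> e0; have := poisson_kernel_smoothing y nF1 e0.
  have -> : \int[mu]_(s in `[0%R, +oo[)
      ((expR (- e * s)%R)%:E * \int[mu]_x (F1 x * (1 + cos (s * x - s * y))%R%:E)) =
    \int[mu]_(s in `[0%R, +oo[)
      ((expR (- e * s)%R)%:E * \int[mu]_x (F2 x * (1 + cos (s * x - s * y))%R%:E)).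
    by apply: eq_integral => s _; rewrite H.
  rewrite -(poisson_kernel_smoothing y nF2 e0) -mass; apply: adde_cancel.
  by rewrite fin_numM // ge0_fin_numE ?integral_ge0.
have HA n : \int[mu]_x (F1 x * (atan_bump n.+1%:R^-1 a b x)%:E) =
            \int[mu]_x (F2 x * (atan_bump n.+1%:R^-1 a b x)%:E).
  by rewrite !integral_atan_bump ?invr_gt0 //; apply: eq_integral => y _; rewrite HW ?invr_gt0.
(* The pointwise limit of the bumps: pi inside, 0 outside, and pi/2 at the two endpoints, which form
   a null set. *)
pose J (x : R) : R := ((Num.sg (b - x) - Num.sg (a - x)) * (pi / 2))%R.
have cvgJ x : (atan_bump n.+1%:R^-1 a b x @[n --> \oo] --> J x)%R.
  rewrite /J mulrBl; apply: cvgB.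
    by under eq_fun do rewrite invrK; exact: cvg_atan_scale.
  by under eq_fun do rewrite invrK; exact: cvg_atan_scale.
have J0 x : (0 <= J x)%R.
  rewrite -(cvg_lim (@Rhausdorff R) (cvgJ x)); apply: limr_ge.
    by apply/cvg_ex; exists (J x); exact: cvgJ.
  by apply: nearW => n; rewrite atan_bump_ge0 ?invr_gt0.
have mJ : measurable_fun [set: R] J.
  apply: (@measurable_fun_cvg _ _ _ setT (fun n : nat => atan_bump n.+1%:R^-1 a b)).
    by move=> n; exact: measurable_atan_bump.
  by move=> x _; exact: cvgJ.
have L F : nnmeas F -> \int[mu]_x F x < +oo ->
   \int[mu]_x (F x * (atan_bump n.+1%:R^-1 a b x)%:E) @[n --> \oo] -->
   \int[mu]_x (F x * (J x)%:E).
  move=> [mF F0] Fy.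
  have iF : mu.-integrable setT F.
    apply/integrableP; split => //.
    by under eq_integral => x _ do rewrite gee0_abs //.
  have pi0 : (0 <= pi :> R)%R by exact: pi_ge0.
  have := @dominated_convergence _ _ _ mu setT measurableT
    (fun n x => F x * (atan_bump n.+1%:R^-1 a b x)%:E) (fun x => F x * (J x)%:E)
    (fun x => F x * pi%:E).
  case => //.
  - by move=> n; apply: emeasurable_funM => //; apply/measurable_EFinP; exact: measurable_atan_bump.
  - by apply: emeasurable_funM => //; apply/measurable_EFinP.
  - apply: aeS (integrable_ae measurableT iF) => x Fx _; have {}Fx := Fx I.
    apply: cvgeZl => //; apply: cvg_EFin; first exact: nearW.
    exact: cvgJ.
  - exact: integrableZr.
  - apply: aeW => x n _; rewrite abseM gee0_abs // lee_wpmul2l //.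
    by rewrite gee0_abs lee_fin ?atan_bump_le ?atan_bump_ge0 ?invr_gt0.
have F2y : \int[mu]_x F2 x < +oo by rewrite -mass.
have : \int[mu]_x (F1 x * (J x)%:E) = \int[mu]_x (F2 x * (J x)%:E).
  rewrite -(cvg_lim (@ereal_hausdorff R) (L _ nF1 F1y)).
  rewrite -(cvg_lim (@ereal_hausdorff R) (L _ nF2 F2y)).
  by congr (lim (_ @ \oo)); apply/funext => n; exact: HA.
have JE F : nnmeas F -> \int[mu]_x (F x * (J x)%:E) = pi%:E * \int[mu]_(x in `]a, b[) F x.
  move=> [mF F0].
  rewrite -ge0_integralZl ?lee_fin ?pi_ge0 //; last exact: measurable_funTS.
  rewrite [RHS]integral_mkcond; apply: ge0_ae_eq_integral => //.
  - by apply: emeasurable_funM => //; apply/measurable_EFinP.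
  - apply/measurable_restrict => //; rewrite setTI; apply: measurable_funTS.
    exact: emeasurable_funM.
  - by move=> x _; rewrite mule_ge0 // lee_fin J0.
  - by move=> x _; rewrite patchE; case: ifP => [_|//]; rewrite mule_ge0 // lee_fin pi_ge0.
  apply: aeS (aeI (ae_neq a) (ae_neq b)) => x /= [xa xb] _.
  rewrite patchE mem_setE in_itv /= /J.
  have [ax|xa'] := ltP a x.
    have [xb'|bx] := ltP x b.
      rewrite gtr0_sg ?subr_gt0 // ltr0_sg ?subr_lt0 // muleC; congr (_%:E * _).
      by field.
    rewrite (@ltr0_sg _ (b - x)) ?subr_lt0; last by rewrite lt_neqAle eq_sym xb.
    by rewrite ltr0_sg ?subr_lt0 // subrr mul0r mule0.
  have ax : (x < a)%R by rewrite lt_neqAle xa.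
  have xb' : (x < b)%R by exact: lt_trans ab.
  by rewrite !gtr0_sg ?subr_gt0 // subrr mul0r mule0.
rewrite !JE // => /(congr1 (fun z => pi^-1%R%:E * z)).
by rewrite !muleA -EFinM mulVf ?mul1e // gt_eqF // pi_gt0.
Qed.

End fourier_uniqueness.

(** * Fourier transforms of nonnegative functions in real form *)

Section trigonometric_transforms.
Context {R : realType}.
Notation mu := (@lebesgue_measure R).
Implicit Types (F G : R -> \bar R) (f : R -> R).

(* Testing against the nonnegative functions [1 + cos (s x - t)] instead of
   exp(isx) keeps every integral in the scope of Tonelli's theorem. *)
Definition ft F (s m c d : R) := forall t : R,
  (\int[mu]_x (F x * (1 + cos (s * x - t))%:E) = (m + c * cos t + d * sin t)%:E)%E.

Lemma measurable_cos_affine (s t : R) : measurable_fun [set: R] (fun x => cos (s * x - t)).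
Proof.
apply: (measurableT_comp (continuous_measurable_fun (@continuous_cos R))).
by apply: measurable_funB => //; apply: measurable_funM.
Qed.

Lemma measurable_sin_affine (s t : R) : measurable_fun [set: R] (fun x => sin (s * x - t)).
Proof.
apply: (measurableT_comp (continuous_measurable_fun (@continuous_sin R))).
by apply: measurable_funB => //; apply: measurable_funM.
Qed.

Lemma onePcos_ge0 (u : R) : 0 <= 1 + cos u.
Proof. by have := cos_geN1 u; lra. Qed.

Lemma nnmeas_onePcos (s t : R) : nnmeas (fun x => (1 + cos (s * x - t))%:E).
Proof.
split; last by move=> x; rewrite lee_fin onePcos_ge0.
by apply/measurable_EFinP; apply: measurable_funD => //; exact: measurable_cos_affine.
Qed.

Lemma integrable_mul_bounded f (k : R -> R) : mu.-integrable setT (EFin \o f) ->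
  measurable_fun [set: R] k -> (forall x, `|k x| <= 1) ->
  mu.-integrable setT (EFin \o (fun x => f x * k x)).
Proof.
move=> intf mk k1; have /integrableP[/measurable_EFinP mf _] := intf.
apply: (le_integrable _ _ _ intf) => //.
  by apply/measurable_EFinP; exact: measurable_funM.
by move=> x _ /=; rewrite lee_fin normrM ler_piMr.
Qed.

Lemma Rintegral_trig f (s a b c : R) : mu.-integrable setT (EFin \o f) ->
  \int[mu]_x (f x * (a + b * cos (s * x) + c * sin (s * x))) =
  a * (\int[mu]_x f x) + b * (\int[mu]_x (f x * cos (s * x))) +
  c * (\int[mu]_x (f x * sin (s * x))).
Proof.
move=> intf.
have ic : mu.-integrable setT (EFin \o (fun x => f x * cos (s * x))).
  apply: integrable_mul_bounded => //; last by move=> x; exact: cos_max.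
  by have := measurable_cos_affine s 0; under eq_fun do rewrite subr0.
have iS : mu.-integrable setT (EFin \o (fun x => f x * sin (s * x))).
  apply: integrable_mul_bounded => //; last by move=> x; exact: sin_max.
  by have := measurable_sin_affine s 0; under eq_fun do rewrite subr0.
have scale (r : R) (k : R -> R) : mu.-integrable setT (EFin \o k) ->
   mu.-integrable setT (EFin \o (fun x => r * k x)).
  by move=> /(integrableZl measurableT r).
have h1 := scale a _ intf; have h2 := scale b _ ic; have h3 := scale c _ iS.
have h12 := integrableD measurableT h1 h2.
rewrite -!RintegralZl // -(RintegralD measurableT h1 h2) -(RintegralD measurableT h12 h3).
by apply: eq_Rintegral => x _; ring.
Qed.

Lemma integral_trig f (s a b c : R) : mu.-integrable setT (EFin \o f) ->
  (\int[mu]_x ((f x)%:E * (a + b * cos (s * x) + c * sin (s * x))%:E) =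
  (a * (\int[mu]_x f x) + b * (\int[mu]_x (f x * cos (s * x))) +
  c * (\int[mu]_x (f x * sin (s * x))))%:E)%E.
Proof.
move=> intf; rewrite -Rintegral_trig // /Rintegral fineK //.
apply: integrable_fin_num => //.
have /integrableP[/measurable_EFinP mf _] := intf.
apply: (le_integrable measurableT _ _ (integrableZl measurableT (`|a| + `|b| + `|c|) intf)).
  apply/measurable_EFinP; apply: measurable_funM => //.
  apply: measurable_funD; first apply: measurable_funD => //; apply: measurable_funM => //.
    by have := measurable_cos_affine s 0; under eq_fun do rewrite subr0.
  by have := measurable_sin_affine s 0; under eq_fun do rewrite subr0.
move=> x _ /=; rewrite lee_fin !normrM mulrC ler_wpM2r //.
rewrite [leRHS]ger0_norm ?addr_ge0 //.
rewrite (le_trans (ler_normD _ _)) // lerD //.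
  rewrite (le_trans (ler_normD _ _)) // lerD // normrM.
  by apply: ler_piMr => //; exact: cos_max.
by rewrite normrM; apply: ler_piMr => //; exact: sin_max.
Qed.

Lemma ft_Rintegral f (s : R) : mu.-integrable setT (EFin \o f) ->
  ft (EFin \o f) s (\int[mu]_x f x) (\int[mu]_x (f x * cos (s * x)))
     (\int[mu]_x (f x * sin (s * x))).
Proof.
move=> intf t.
transitivity (\int[mu]_x ((f x)%:E * (1 + cos t * cos (s * x) + sin t * sin (s * x))%:E))%E.
  by apply: eq_integral => x _; rewrite /= cosB; congr (_ * _%:E)%E; ring.
by rewrite integral_trig // mul1r; congr EFin; ring.
Qed.

Lemma ft_eq F (s m c d m' c' d' : R) : ft F s m c d ->
  m = m' -> c = c' -> d = d' -> ft F s m' c' d'.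
Proof. by move=> h <- <- <-. Qed.

(** The values at t = 0, pi and pi/2 are m + c, m - c and m + d, which determine the three
    coefficients. *)
Lemma ft_coef_uniq F (s m c d m' c' d' : R) : ft F s m c d -> ft F s m' c' d' ->
  [/\ m = m', c = c' & d = d'].
Proof.
move=> h h'.
have E t : m + c * cos t + d * sin t = m' + c' * cos t + d' * sin t.
  by apply: EFin_inj; rewrite -h -h'.
have := E 0; have := E pi; have := E (pi / 2).
rewrite cos0 sin0 cospi sinpi cos_pihalf sin_pihalf => h1 h2 h3.
by split; lra.
Qed.

Lemma ftD F G (s m c d m' c' d' : R) : nnmeas F -> nnmeas G ->
  ft F s m c d -> ft G s m' c' d' ->
  ft (fun x => F x + G x)%E s (m + m') (c + c') (d + d').
Proof.
move=> nF nG hF hG t.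
under eq_integral => x _ do rewrite ge0_muleDl ?nF.2 ?nG.2 //.
rewrite ge0_integralD //.
- by rewrite hF hG -EFinD; congr EFin; ring.
- by case: (nnmeasM nF (nnmeas_onePcos s t)).
- by case: (nnmeasM nF (nnmeas_onePcos s t)).
- by case: (nnmeasM nG (nnmeas_onePcos s t)).
- by case: (nnmeasM nG (nnmeas_onePcos s t)).
Qed.

(** With c + id read as the Fourier transform at s, the new coefficients are those of (c + id)
    e^(isa). *)
Lemma ft_translate F (s m c d a : R) : nnmeas F -> ft F s m c d ->
  ft (fun x => F (x - a)) s m (c * cos (s * a) - d * sin (s * a))
     (c * sin (s * a) + d * cos (s * a)).
Proof.
move=> nF hF t.
have [mm m0] := nnmeasM nF (nnmeas_onePcos s (t - s * a)).
transitivity (\int[mu]_x (F (x - a)%R * (1 + cos (s * (x - a) - (t - s * a)))%:E))%E.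
  by apply: eq_integral => x _; congr (_ * (1 + cos _)%:E)%E; ring.
rewrite (ge0_integral_translate a mm m0) hF cosB sinB; congr EFin; ring.
Qed.

(** The coefficients are those of the complex product (c + id)(c' + id'). Once Tonelli has
    integrated out G, what remains is f against a trigonometric polynomial that may be split into
    signed terms; this is where integrability of f enters. *)
Lemma ft_econv f G (s m c d m' c' d' : R) : mu.-integrable setT (EFin \o f) ->
  nnmeas (EFin \o f) -> nnmeas G ->
  ft (EFin \o f) s m c d -> ft G s m' c' d' ->
  ft (econv (EFin \o f) G) s (m * m') (c * c' - d * d') (c * d' + d * c').
Proof.
move=> intf nF nG hF hG t.
have [-> -> ->] := ft_coef_uniq hF (ft_Rintegral s intf).
have nE := nnmeas_econv nF nG.
have mW := measurable_econv_integrand nF nG.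
transitivity (\int[mu]_x \int[mu]_y ((EFin \o f) y * G (x - y)%R * (1 + cos (s * x - t))%:E))%E.
  apply: eq_integral => x _; rewrite /econv -ge0_integralZr //.
  - by case: (nnmeasM nF (nnmeas_reflect x nG)).
  - by move=> y _; rewrite mule_ge0 ?nF.2 ?nG.2.
rewrite (@tonelliR R (fun z => (EFin \o f) z.2 * G (z.1 - z.2)%R * (1 + cos (s * z.1 - t))%:E)%E)
  /=; first last.
- by move=> z; rewrite !mule_ge0 ?nF.2 ?nG.2 ?lee_fin ?onePcos_ge0.
- apply: emeasurable_funM => //; apply: measurableT_comp (nnmeas_onePcos s t).1 _.
  exact: measurable_fst.
transitivity (\int[mu]_y ((f y)%:E * (m' + c' * cos (t - s * y) + d' * sin (t - s * y))%:E))%E.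
  apply: eq_integral => y _.
  have [mm m0] := nnmeasM nG (nnmeas_onePcos s (t - s * y)).
  have := hG (t - s * y) => <-.
  rewrite -(ge0_integral_translate y mm m0) -ge0_integralZl //.
  - by apply: eq_integral => x _; rewrite -muleA; congr (_ * (_ * (1 + cos _)%:E))%E; ring.
  - by case: (nnmeas_translate y (conj mm m0)).
  - exact: nF.2 y.
transitivity (\int[mu]_y ((f y)%:E * (m' + (c' * cos t + d' * sin t) * cos (s * y) +
    (c' * sin t - d' * cos t) * sin (s * y))%:E))%E.
  by apply: eq_integral => y _; rewrite cosB sinB; congr (_ * _%:E)%E; ring.
by rewrite integral_trig //; congr EFin; ring.
Qed.

End trigonometric_transforms.

(** * Integrals of powers up to the origin *)

Section power_integral.
Context {R : realType}.
Notation mu := (@lebesgue_measure R).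

Lemma continuous_powR (p x : R) : 0 < x -> {for x, continuous (@powR R ^~ p)}.
Proof. by move=> x0; exact: is_derive_continuous (is_derive1_powR p x0). Qed.

Lemma integral_powR_cc (p a b : R) : -1 < p -> 0 < a -> a < b ->
  (\int[mu]_(t in `[a, b]) (t `^ p)%:E =
   ((b `^ (p + 1) - a `^ (p + 1)) / (p + 1))%:E)%E.
Proof.
move=> p1 a0 ab; have p0 : p + 1 != 0 by rewrite gt_eqF //; lra.
pose F (t : R) := t `^ (p + 1) * (p + 1)^-1.
have dF (t : R) : 0 < t -> is_derive t 1 F (t `^ p).
  move=> t0; have h := is_derive1_powR (p + 1) t0.
  have h' : is_derive t 1 ((@powR R ^~ (p + 1)) * cst (p + 1)^-1 : R -> R) (t `^ p).
    by apply: is_derive_eq; rewrite /GRing.scale /= addrK; field.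
  exact: h'.
rewrite (@continuous_FTC2 R _ F a b ab).
- by rewrite -EFinB /F mulrBl.
- apply: continuous_in_subspaceT => t; rewrite mem_setE in_itv /= => /andP[at0 _].
  by apply: continuous_powR; exact: lt_le_trans at0.
- have cF (t : R) : 0 < t -> F x @[x --> t] --> F t.
    by move=> t0; exact: is_derive_continuous (dF t t0).
  split.
  + by move=> t; rewrite in_itv /= => /andP[at0 _]; case: (dF t (lt_trans a0 at0)).
  + exact: cvg_at_right_filter (cF a a0).
  + exact: cvg_at_left_filter (cF b (lt_trans a0 ab)).
- move=> t; rewrite in_itv /= => /andP[at0 _]; rewrite derive1E.
  by case: (dF t (lt_trans a0 at0)) => _ ->.
Qed.

(** For p < 0 the integrand is unbounded at 0, so ]0, x] is exhausted by compact intervals and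
    monotone convergence is applied. *)
Lemma integral_powR (p x : R) : -1 < p -> 0 < x ->
  (\int[mu]_(t in `]0%R, x]) (t `^ p)%:E = (x `^ (p + 1) / (p + 1))%:E)%E.
Proof.
move=> p1 x0.
(* The divisor starts at 2, so that no interval is degenerate. *)
pose I (n : nat) := `[x / n.+2%:R, x]%classic.
have xn (n : nat) : 0 < x / n.+2%:R by rewrite divr_gt0.
have xn1 (n : nat) : x / n.+2%:R < x by rewrite ltr_pdivrMr // ltr_pMr // ltr1n.
have -> : `]0, x]%classic = \bigcup_n I n.
  apply/seteqP; split => t /=.
    rewrite in_itv /= => /andP[t0 tx]; exists (Num.truncn (x / t)) => //=.
    rewrite /I /= in_itv /= tx andbT ler_pdivrMr //.
    rewrite -ler_pdivrMl // mulrC (le_trans (ltW (truncnS_gt _))) // ler_nat //.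
  move=> [n _]; rewrite /I /= !in_itv /= => /andP[h ->]; rewrite andbT.
  exact: lt_le_trans h.
have ndI : nondecreasing_seq I.
  apply/nondecreasing_seqP => n; rewrite subsetEset => t.
  rewrite /I /= !in_itv /= => /andP[h ->]; rewrite andbT (le_trans _ h) //.
  by rewrite ler_pM2l // lef_pV2 ?posrE // ler_nat.
have mI i : measurable_fun (I i) (fun t : R => (t `^ p)%:E).
  by apply/measurable_EFinP/measurable_funTS; exact: measurable_powR.
have I0 i t : I i t -> (0 <= (t `^ p)%:E)%E by rewrite lee_fin powR_ge0.
have cv := @ge0_nondecreasing_set_cvg_integral _ (measurableTypeR R) R I
  (fun t => (t `^ p)%:E) mu ndI (fun i => measurable_itv _) mI I0.
rewrite -(cvg_lim (@ereal_hausdorff R) cv).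
under eq_fun do rewrite integral_powR_cc //.
apply/cvg_lim; first exact: ereal_hausdorff.
apply: cvg_EFin; first exact: nearW.
have -> : x `^ (p + 1) / (p + 1) = (x `^ (p + 1) - 0) / (p + 1) by rewrite subr0.
apply: cvgMl; apply: cvgB; first exact: cvg_cst.
apply: (cvg_at_rightP (@powR R ^~ (p + 1)) 0 0).1; first by apply: powR_cvg0; lra.
split => //; rewrite (cvg_shiftS (fun n => x / n.+1%:R)).
have h : (x * @harmonic R n) @[n --> \oo] --> x * 0 by apply: cvgMr; exact: cvg_harmonic.
by rewrite mulr0 in h.
Qed.

End power_integral.

(** * Uniqueness for causal functions, and the exponential density *)

Section exponential_density.
Context {R : realType}.
Notation mu := (@lebesgue_measure R).
Implicit Types (F G : R -> \bar R).

Lemma econv_translate F G (a : R) :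
  econv F (fun x => G (x - a)) = (fun x => econv F G (x - a)).
Proof.
by apply/funext => x; apply: eq_integral => y _; congr (_ * G _)%E; ring.
Qed.

Lemma causal_integral F (a b : R) : causal F -> a < 0 -> 
  (\int[mu]_(x in `]a, b[) F x = \int[mu]_(x in `]-oo, b[) F x)%E.
Proof.
move=> cF a0; rewrite integral_mkcond [RHS]integral_mkcond.
apply: eq_integral => x _; rewrite !patchE !mem_setE !in_itv /=.
have [ax|xa] //= := ltP a x.
by rewrite cF ?if_same // ltW // (le_lt_trans xa).
Qed.

Lemma fourier_unique_causal F1 F2 : nnmeas F1 -> nnmeas F2 -> causal F1 -> causal F2 ->
  (forall s, exists m c d, ft F1 s m c d /\ ft F2 s m c d) -> ae_eq mu setT F1 F2.
Proof.
move=> n1 n2 c1 c2 h.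
have [mF1 F10] := n1.
have F1y : (\int[mu]_x F1 x < +oo)%E.
  have [m [c [d [h1 _]]]] := h 0.
  have := h1 0; under eq_integral do rewrite mul0r subr0 cos0.
  move=> e; apply: (@le_lt_trans _ _ (m + c * cos 0 + d * sin 0)%:E); last exact: ltry.
  rewrite -e; apply: ge0_le_integral => //.
  - by apply: emeasurable_funM.
  - by move=> x _; rewrite lee_pemulr // lee_fin lerDl.
(* The left endpoint lies below both 0 and x: a causal function loses nothing there, and the
   interval is not empty. *)
have I F (x : R) : nnmeas F -> causal F ->
    (\int[mu]_(y in `]-oo, x]) F y = \int[mu]_(y in `](Num.min x 0 - 1)%R, x[) F y)%E.
  move=> nF cF; rewrite causal_integral //.
    rewrite integral_itv_bndo_bndc //; exact: measurable_funTS nF.1.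
  by rewrite ltrBlDr add0r gt_min ltr01 orbT.
apply: ae_eq_of_primitives => // x.
  apply: le_lt_trans F1y; apply: ge0_subset_integral => //.
rewrite !I //; apply: fourier_unique => //.
- by move=> s t; have [m [c [d [h1 h2]]]] := h s; rewrite h1 h2.
- by rewrite ltrBlDr (@le_lt_trans _ _ x) ?ge_min ?lexx // ltrDl.
Qed.

Definition expo (x : R) : R := if 0 < x then expR (- x) else 0.
Definition expo_fun (x : R) : \bar R := (expo x)%:E.

Lemma nnmeas_if_in (f : R -> R) (D : set R) : measurable D -> measurable_fun [set: R] f ->
  (forall x, 0 <= f x) -> nnmeas (fun x => (if x \in D then f x else 0)%:E).
Proof.
move=> mD mf f0; split; last by move=> x; case: ifP; rewrite lee_fin.
apply/measurable_EFinP.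
have -> : (fun x => if x \in D then f x else 0) = f \_ D by apply/funext => x; rewrite patchE.
by apply/measurable_restrict => //; rewrite setTI; exact: measurable_funTS.
Qed.

Lemma nnmeas_expo : nnmeas expo_fun.
Proof.
have -> : expo_fun = (fun x => (if x \in `]0%R, +oo[%classic then expR (- x) else 0)%:E).
  by apply/funext => x; rewrite mem_setE in_itv /= andbT.
apply: (@nnmeas_if_in (fun x => expR (- x))) => //.
exact: measurableT_comp.
Qed.

Lemma causal_expo : causal expo_fun.
Proof. by move=> x x0; rewrite /expo_fun /expo ltNge x0. Qed.

(** The real and imaginary parts of 1 / (1 - is). *)
Lemma ft_expo (s : R) : ft expo_fun s 1 (1 + s ^+ 2)^-1 (s / (1 + s ^+ 2)).
Proof.
move=> t; have := @integral_damped_cos R 1 s t ltr01.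
rewrite invr1 expr1n mul1r => h.
transitivity (\int[mu]_(x in `[0%R, +oo[) (expR (- 1 * x) * (1 + cos (s * x - t)))%:E)%E; last first.
  by rewrite h; congr EFin; ring.
rewrite -integral_itv_obnd_cbnd.
  rewrite [RHS]integral_mkcond; apply: eq_integral => x _.
  rewrite patchE mem_setE in_itv /= andbT /expo_fun /expo mulN1r.
  by case: ifP => _; rewrite ?mul0e.
apply/measurable_EFinP/measurable_funTS/measurable_funM.
  by apply: measurableT_comp => //; exact: measurable_funM.
by apply: measurable_funD => //; exact: measurable_cos_affine.
Qed.

(** For x > 0 this is e^(-x) + (1 - e^(-x)) = 1. *)
Lemma expo_add_primitive (x : R) : (expo_fun x + econv heav expo_fun x = heav x)%E.
Proof.
have [x0|x0] := leP x 0.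
  by rewrite causal_expo // (causal_econv causal_heav causal_expo) // causal_heav // adde0.
rewrite (econv_heav x nnmeas_expo) /heav /expo_fun /expo x0.
have -> : (\int[mu]_(y in `]-oo, x]) (if 0 < y then expR (- y) else 0)%R%:E =
   \int[mu]_(y in `[0%R, x]) (expR (- y))%:E)%E.
  rewrite -integral_itv_obnd_cbnd; last by apply/measurable_EFinP/measurable_funTS/measurableT_comp.
  rewrite integral_mkcond [RHS]integral_mkcond; apply: eq_integral => y _.
  by rewrite !patchE !mem_setE !in_itv /=; case: (ltP 0 y) => //=; case: ifP.
have dF (y : R) : is_derive y 1 (fun y => - expR (- y)) (expR (- y)).
  have h := is_derive_expR_scale 1 y.
  have -> : (fun y : R => - expR (- y)) = - (fun x => expR (- 1 * x)) :> (R -> R).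
    by apply/funext => z; rewrite -(mulN1r z).
  by apply: is_derive_eq; rewrite !mulN1r opprK.
rewrite (@continuous_FTC2 R _ (fun y => - expR (- y)) 0 x x0).
- rewrite -EFinB -EFinD; congr EFin.
  by rewrite oppr0 expR0 /= opprK addrA subrr add0r.
- apply: continuous_subspaceT => y; apply: (@continuous_comp _ _ _ (fun y : R => - y)).
    by apply: cvgN.
  exact: continuous_expR.
- split.
  + by move=> y _; case: (dF y).
  + exact: cvg_at_right_filter (is_derive_continuous (dF 0)).
  + exact: cvg_at_left_filter (is_derive_continuous (dF x)).
- by move=> y _; rewrite derive1E; case: (dF y) => _ ->.
Qed.

End exponential_density.

(** * The renewal kernel and the renewal equation *)

Section renewal_kernel.
Context {R : realType} (alpha : R).
Hypothesis alpha01 : 0 < alpha < 1.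
Notation mu := (@lebesgue_measure R).
Local Open Scope ereal_scope.

(* As phi_alpha(s)^-1 = e^(is) - is * int_0^1 t^(-alpha) e^(ist) dt, the transform of
   [rker] is phi_alpha(s)^-1 / (-is). *)
Definition hker (t : R) : R := (if t \in `]0%R, 1%R]%classic then t `^ (- alpha) else 0)%R.
Definition hfun (t : R) : \bar R := (hker t)%:E.
Definition heav1 (x : R) : \bar R := heav (x - 1)%R.
Definition rker (x : R) : \bar R := hfun x + heav1 x.

Lemma nnmeas_hfun : nnmeas hfun.
Proof.
apply: (@nnmeas_if_in R (fun t : R => t `^ (- alpha))%R `]0%R, 1%R]%classic
  (measurable_itv _) (measurable_powR _)).
by move=> t; exact: powR_ge0.
Qed.

Lemma causal_hfun : causal hfun.
Proof. by move=> x x0; rewrite /hfun /hker mem_setE in_itv /= ltNge x0. Qed.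

Lemma nnmeas_heav1 : nnmeas heav1.
Proof. exact: nnmeas_translate nnmeas_heav. Qed.

Lemma causal_heav1 : causal heav1.
Proof. by move=> x x0; rewrite /heav1 causal_heav //; lra. Qed.

Lemma nnmeas_rker : nnmeas rker.
Proof. exact: nnmeasD nnmeas_hfun nnmeas_heav1. Qed.

Lemma causal_rker : causal rker.
Proof. by move=> x x0; rewrite /rker causal_hfun // causal_heav1 // adde0. Qed.

Lemma primitive_hfun (x : R) : (0 < x)%R ->
  econv heav hfun x = ((Num.min x 1) `^ (1 - alpha) / (1 - alpha))%R%:E.
Proof.
move=> x0; rewrite (econv_heav x nnmeas_hfun).
have m0 : (0 < Num.min x 1)%R by rewrite lt_min x0 ltr01.
have := @integral_powR R (- alpha)%R (Num.min x 1)%R _ m0.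
rewrite addrC => <-; last by case/andP: alpha01; lra.
rewrite integral_mkcond [RHS]integral_mkcond; apply: eq_integral => t _.
rewrite !patchE !mem_setE !in_itv /= /hfun /hker mem_setE in_itv /= le_min.
by case: (t <= x)%R; rewrite ?andbF ?andTb //=; case: ifP.
Qed.

Lemma integral_hfun : \int[mu]_x hfun x = ((1 - alpha)^-1)%R%:E.
Proof.
have := primitive_hfun ltr01; rewrite (econv_heav _ nnmeas_hfun).
rewrite minxx powR1 mul1r => <-; rewrite [RHS]integral_mkcond.
apply: eq_integral => t _; rewrite patchE mem_setE in_itv /=.
case: ifPn => // t1; rewrite /hfun /hker mem_setE in_itv /= (negbTE t1) andbF //.
Qed.

Lemma integrable_hker : mu.-integrable setT (EFin \o hker).
Proof.
apply/integrableP; split; first exact: nnmeas_hfun.1.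
under eq_integral => x _ do rewrite gee0_abs ?(nnmeas_hfun.2 x) //.
by rewrite integral_hfun ltry.
Qed.

Lemma primitive_heav1 (x : R) : econv heav heav1 x = (Num.max (x - 1) 0)%R%:E.
Proof.
rewrite (econv_heav x nnmeas_heav1).
transitivity (\int[mu]_(t in `]1%R, x]) (cst 1 t)).
  rewrite integral_mkcond [RHS]integral_mkcond; apply: eq_integral => t _.
  rewrite !patchE !mem_setE !in_itv /= /heav1 /heav subr_gt0.
  by case: (t <= x)%R; case: (1 < t)%R.
rewrite integral_cst // mul1e [LHS](@lebesgue_measure_itv R `]1%R, x]) /= lte_fin.
case: ltP => x1; first by rewrite -EFinD; congr EFin; rewrite max_l //; lra.
by rewrite max_r //; lra.
Qed.

(** In differential form: x r(x) equals x^(1 - alpha) on (0, 1], with derivative (1 - alpha) r, and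
    x beyond 1, with derivative 1 = (1 - alpha) + alpha. The two pieces match at 1, so no point mass
    appears there. *)
Lemma xmul_rker : xmul rker =
  econv heav (fun x => (1 - alpha)%R%:E * rker x + alpha%:E * heav1 x).
Proof.
have a0 : (0 <= alpha)%R by case/andP: alpha01; lra.
have a1 : (0 <= 1 - alpha)%R by case/andP: alpha01; lra.
rewrite econvDr ?econvZr //; first last.
- exact: nnmeas_heav.
- exact: nnmeasZ nnmeas_heav1.
- exact: nnmeasZ nnmeas_rker.
- exact: nnmeas_heav1.
- exact: nnmeas_heav.
- exact: nnmeas_rker.
- exact: nnmeas_heav.
rewrite /rker (econvDr nnmeas_hfun nnmeas_heav1 nnmeas_heav).
apply/funext => x; have [x0|x0] := leP x 0%R.
  rewrite causal_xmul //; last exact: causal_rker.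
  rewrite (causal_econv causal_heav causal_hfun) //.
  by rewrite (causal_econv causal_heav causal_heav1) // !(adde0, mule0).
rewrite primitive_hfun // primitive_heav1 /xmul /hfun /hker /heav1 /heav.
rewrite mem_setE in_itv /= x0 /= subr_gt0 (max_l (ltW x0)).
have [x1|x1] := leP x 1%R.
  have m0 : Num.max (x - 1)%R 0%R = 0%R by rewrite max_r // subr_le0.
  rewrite m0 mulr0n !adde0 mule0 adde0 -!EFinM; congr EFin.
  rewrite -[in RHS](mulr_powRB1 (ltW x0)); last by case/andP: alpha01; lra.
  have -> : (1 - alpha - 1 = - alpha)%R by ring.
  by field; case/andP: alpha01; lra.
have m0 : Num.max (x - 1)%R 0%R = (x - 1)%R by rewrite max_l // subr_ge0 ltW.
rewrite m0 powR1 mulr1n /= add0e mule1.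
have -> : ((1 / (1 - alpha))%:E + (x - 1)%:E = (1 / (1 - alpha) + (x - 1))%:E) by [].
rewrite -!EFinM; congr EFin.
by field; case/andP: alpha01; lra.
Qed.

(* Here [H] is the Heaviside function, which has no Fourier transform, and [q] is e^(-x)
   on x > 0. As (1 + H) * q = H, convolving the identity between integrable functions
   with 1 + H and cancelling F * H * h gives the renewal equation. *)
Lemma renewal_of_damped (F h q q1 H H1 : R -> \bar R) :
  nnmeas F -> nnmeas h -> nnmeas q -> nnmeas q1 -> nnmeas H -> nnmeas H1 ->
  (forall x, q x + econv H q x = H x) -> (forall x, q1 x + econv H q1 x = H1 x) ->
  ae_eq mu setT (econv F (fun x => q1 x + h x)) (fun x => q x + econv F (econv h q) x) ->
  (forall x, econv F (econv H h) x \is a fin_num) ->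
  ae_eq mu setT (econv F (fun x => h x + H1 x)) H.
Proof.
move=> nF nh nq nq1 nH nH1 qH q1H1 F12 fin.
have nhq := nnmeas_econv nh nq; have nHh := nnmeas_econv nH nh.
have nq1h := nnmeasD nq1 nh; have nFhq := nnmeas_econv nF nhq.
have nHq := nnmeas_econv nH nq; have nHq1 := nnmeas_econv nH nq1.
have nF1 := nnmeas_econv nF nq1h; have nF2 := nnmeasD nq nFhq.
have E1 x : econv F (fun x => q1 x + h x) x + econv H (econv F (fun x => q1 x + h x)) x =
    econv F (fun x => h x + H1 x) x + econv F (econv H h) x.
  rewrite (econvCA nH nF nq1h) (econvDr nq1 nh nH).
  rewrite -(congr1 (fun G => G x) (econvDr nq1h (nnmeasD nHq1 nHh) nF)).
  rewrite -(congr1 (fun G => G x) (econvDr (nnmeasD nh nH1) nHh nF)).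
  congr (econv F _ x); apply/funext => y.
  by rewrite addeACA q1H1 addeA; congr (_ + _); exact: addeC.
have E2 x : q x + econv F (econv h q) x + econv H (fun x => q x + econv F (econv h q) x) x =
    H x + econv F (econv H h) x.
  rewrite (econvDr nq nFhq nH) addeACA qH; congr (_ + _).
  rewrite (econvCA nH nF nhq) (econvCA nH nh nq).
  rewrite -(congr1 (fun G => G x) (econvDr nhq (nnmeas_econv nh nHq) nF)).
  rewrite -(econvDr nq nHq nh) (econvC nH nh); congr (econv F (econv _ _) x).
  by apply/funext => y; exact: qH.
have E3 := eq_econv_aer nF1 nF2 nH F12.
apply: aeS F12 => x F12x _; apply: (adde_cancel (fin x)).
rewrite addeC [RHS]addeC -E2 -E1 -E3 (F12x I) //.
Qed.

(** The last two conditions are the real and imaginary parts of (A + iB) D = 1 with D = e^(is) - is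
    (C + iS). The transforms of the two integrable sides [F1] and [F2] differ by ((A + iB) D - 1) /
    (1 - is), hence agree. *)
Lemma renewal_equation (f : R -> R) : nnmeas (EFin \o f) -> causal (EFin \o f) ->
  mu.-integrable setT (EFin \o f) -> 
  (forall s, exists A B C S, [/\ ft (EFin \o f) s 1 A B, ft hfun s (1 - alpha)^-1 C S,
     A * (cos s + s * S) - B * (sin s - s * C) = 1 &
     A * (sin s - s * C) + B * (cos s + s * S) = 0])%R ->
  ae_eq mu setT (econv (EFin \o f) rker) heav.
Proof.
move=> nf cf intf H.
set F := EFin \o f.
pose q1 (x : R) := expo_fun (x - 1)%R.
have nq : nnmeas (@expo_fun R) := nnmeas_expo.
have nq1 : nnmeas q1 by exact: nnmeas_translate nq.
have cq1 : causal q1 by move=> x x0; rewrite /q1 causal_expo //; lra.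
have nh := nnmeas_hfun; have nH := @nnmeas_heav R; have nH1 := nnmeas_heav1.
have nqh := nnmeasD nq1 nh.
have nhq := nnmeas_econv nh nq.
pose F1 := econv F (fun x => q1 x + hfun x).
pose F2 (x : R) := expo_fun x + econv F (econv hfun expo_fun) x.
have nF1 : nnmeas F1 by exact: nnmeas_econv.
have nF2 : nnmeas F2 by apply: nnmeasD => //; exact: nnmeas_econv.
have F12 : ae_eq mu setT F1 F2.
  apply: fourier_unique_causal => //.
  - by apply: causal_econv => // x x0; rewrite cq1 // causal_hfun // adde0.
  - move=> x x0; rewrite /F2 causal_expo // add0e.
    by apply: causal_econv => //; apply: causal_econv; [exact: causal_hfun|exact: causal_expo].
  - move=> s; have [A [B [C [S [fA hC e1 e2]]]]] := H s.
    have h1 := ft_econv intf nf nqh fA (ftD nq1 nh (ft_translate 1 nq (ft_expo s)) hC).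
    have h2 := ftD nq (nnmeas_econv nf nhq) (ft_expo s)
      (ft_econv intf nf nhq fA (ft_econv integrable_hker nh nq hC (ft_expo s))).
    do 3 eexists; split; first exact: h1.
    have D0 : (1 + s ^+ 2 != 0)%R by rewrite gt_eqF // ltr_pwDl // sqr_ge0.
    apply: (ft_eq h2); rewrite ?mulr1.
    + by field; case/andP: alpha01; lra.
    + apply/eqP; rewrite eq_sym -subr_eq0; apply/eqP.
      (* The real part of ((A + iB) D - 1)(1 + is) / (1 + s^2); the imaginary part comes next. *)
      transitivity (((A * (cos s + s * S) - B * (sin s - s * C) - 1) -
        s * (A * (sin s - s * C) + B * (cos s + s * S))) / (1 + s ^+ 2))%R; first by field.
      by rewrite e1 e2 subrr mulr0 subr0 mul0r.
    + apply/eqP; rewrite eq_sym -subr_eq0; apply/eqP.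
      transitivity ((s * (A * (cos s + s * S) - B * (sin s - s * C) - 1) +
        (A * (sin s - s * C) + B * (cos s + s * S))) / (1 + s ^+ 2))%R; first by field.
      by rewrite e1 e2 subrr mulr0 addr0 mul0r.
apply: (renewal_of_damped nf nh nq nq1 nH nH1 (@expo_add_primitive R) _ F12).
  by move=> x; rewrite /q1 econv_translate expo_add_primitive.
move=> x; have nHh := nnmeas_econv nH nh.
rewrite ge0_fin_numE; last exact: (nnmeas_econv nf nHh).2.
(* H * h is bounded by the mass of h, so F * H * h is finite everywhere and may be cancelled. *)
have le x0 : econv heav hfun x0 <= ((1 - alpha)^-1)%R%:E.
  rewrite -integral_hfun (econv_heav _ nh).
  apply: ge0_subset_integral => //; [exact: nh.1|by move=> z _; exact: nh.2].
apply: le_lt_trans (econv_le x nf nHh le) _.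
have /integrableP[_] := intf; under eq_integral => z _ do rewrite gee0_abs ?(nf.2 z) //.
move=> Fy; rewrite lte_mul_pinfty ?lee_fin ?fin_numE // invr_ge0.
by case/andP: alpha01; lra.
Qed.

End renewal_kernel.

(** * The size-bias identity *)

Section size_bias.
Context {R : realType} (alpha : R).
Hypothesis alpha01 : 0 < alpha < 1.
Notation mu := (@lebesgue_measure R).
Local Open Scope ereal_scope.
Notation rker := (rker alpha).

Variable F : R -> \bar R.
Hypotheses (nF : nnmeas F) (cF : causal F) (F1 : \int[mu]_x F x = 1).
Hypothesis Frker : ae_eq mu setT (econv F rker) heav.

Lemma econv_prob_le1 (u : R -> \bar R) (x : R) : nnmeas u -> (forall y, u y <= 1) -> econv F u x <= 1.
Proof. by move=> nu u1; have := econv_le x nF nu u1; rewrite F1 mule1. Qed.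

Lemma heav_le1 (x : R) : heav x <= 1.
Proof. by rewrite /heav lee_fin; case: (0 < x)%R. Qed.

Lemma econv_heav_le_heav (u : R -> \bar R) (x : R) : nnmeas u -> causal u -> (forall y, u y <= 1) -> u x <= heav x.
Proof.
move=> nu cu u1; have [x0|x0] := leP x 0%R; first by rewrite cu // (@nnmeas_heav R).2.
by rewrite /heav x0.
Qed.

Lemma xmul_heav : xmul (@heav R) = econv (@heav R) (@heav R).
Proof.
apply/funext => x; rewrite (econv_heav x nnmeas_heav) /xmul.
transitivity (\int[mu]_(t in `]0%R, x]) (cst 1 t)).
  rewrite integral_cst // mul1e [RHS](@lebesgue_measure_itv R `]0%R, x]) /= lte_fin /heav.
  case: ltP => x0; first by rewrite sube0 mule1.
  by rewrite mule0.
rewrite integral_mkcond [RHS]integral_mkcond; apply: eq_integral => t _.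
rewrite !patchE !mem_setE !in_itv /= /heav.
by case: (t <= x)%R; case: (0 < t)%R.
Qed.

Lemma econv_heav_ltpinfty (u : R -> \bar R) (x : R) : nnmeas u -> causal u -> (forall y, u y <= 1) ->
  econv heav u x < +oo.
Proof.
move=> nu cu u1; rewrite econv_heav //.
apply: (@le_lt_trans _ _ (xmul heav x)).
  rewrite xmul_heav (econv_heav _ nnmeas_heav); apply: ge0_le_integral => //.
  - by move=> y _; exact: nu.2.
  - exact: measurable_funTS nu.1.
  - exact: measurable_funTS (@nnmeas_heav R).1.
  - by move=> y _; exact: econv_heav_le_heav.
by rewrite /xmul /heav -EFinM ltry.
Qed.

(* The renewal equation multiplied by x, for which [xmul] is a derivation:
   x F(x) = alpha (F * H)(x) - alpha (F * F * H)(x - 1), stated without subtraction. *)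
Lemma size_bias_equation : ae_eq mu setT
  (fun x => xmul F x + ((1 - alpha)%R%:E * econv F heav x +
                        alpha%:E * econv F (econv F heav1) x))
  (econv F heav).
Proof.
have a0 : (0 <= alpha)%R by case/andP: alpha01; lra.
have a1 : (0 <= 1 - alpha)%R by case/andP: alpha01; lra.
have nH := @nnmeas_heav R; have nH1 := @nnmeas_heav1 R; have nr := nnmeas_rker alpha.
have nG := nnmeas_econv nF nH; have nG1 := nnmeas_econv nF nH1.
have nQ := nnmeas_econv nF nG1.
have nx := nnmeas_xmul nF.
have nK : nnmeas (fun x => (1 - alpha)%R%:E * rker x + alpha%:E * heav1 x).
  by apply: nnmeasD; exact: nnmeasZ.
have nFr := nnmeas_econv nF nr.
have nRHS : nnmeas (fun x => (1 - alpha)%R%:E * econv F heav x +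
                        alpha%:E * econv F (econv F heav1) x).
  by apply: nnmeasD; exact: nnmeasZ.
have G1 y : econv F heav y <= 1 by apply: econv_prob_le1 => //; exact: heav_le1.
have cG : causal (econv F heav) by apply: causal_econv => //; exact: causal_heav.
have key : econv heav (fun x => xmul F x + ((1 - alpha)%R%:E * econv F heav x +
                        alpha%:E * econv F (econv F heav1) x)) =
           econv heav (econv F heav).
  rewrite (econvCA nH nF nH) -xmul_heav econvDr //.
  (* The Leibniz rule splits x (F * r). In F * (xF * r) the product F * r becomes H; in F * (F * xr)
     the relation for x r extracts a factor H and leaves one more F * r to be replaced by H. *)
  transitivity (econv F (xmul (econv F rker))); last first.
    apply: eq_econv_aer => //; [exact: nnmeas_xmul|exact: nnmeas_xmul|].
    by apply: aeS Frker => x /= + _ => /(_ I) h; rewrite /xmul h.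
  rewrite (xmul_econv nF nr cF (causal_rker alpha)) econvDr //; first last.
  - by apply: nnmeas_econv => //; exact: nnmeas_xmul.
  - exact: nnmeas_econv.
  apply/funext => x; congr (_ + _).
    rewrite (econvCA nF nx nr) (econvC nH nx).
    by rewrite (eq_econv_aer nFr nH nx Frker).
  rewrite (xmul_rker alpha01) (econvCA nF nH nK) (econvCA nF nH (nnmeas_econv nF nK)).
  congr (econv heav _ x).
  transitivity (econv F (fun x => (1 - alpha)%R%:E * heav x + alpha%:E * econv F heav1 x)).
    by rewrite (econvDr (nnmeasZ a1 nH) (nnmeasZ a0 nG1) nF) (econvZr a1 nF nH)
      (econvZr a0 nF nG1).
  apply: eq_econv_aer => //; first by apply: nnmeasD; exact: nnmeasZ.
    exact: nnmeas_econv.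
  rewrite (econvDr (nnmeasZ a1 nr) (nnmeasZ a0 nH1) nF) (econvZr a1 nF nr)
    (econvZr a0 nF nH1).
  by apply: aeS Frker => y /= + _ => /(_ I) ->.
apply: econv_heav_inj => //; first exact: nnmeasD.
by move=> x; rewrite key; exact: econv_heav_ltpinfty.
Qed.

End size_bias.

(** * Monotonicity and continuity of convolutions *)

Section continuity_of_convolution.
Context {R : realType}.
Notation mu := (@lebesgue_measure R).

Lemma econv_mono (u v w : R -> \bar R) (x : R) : nnmeas u -> nnmeas v -> nnmeas w ->
  (forall y, v y <= w y)%E -> (econv u v x <= econv u w x)%E.
Proof.
move=> nu nv nw vw; apply: ge0_le_integral => //.
- by move=> y _; rewrite mule_ge0 ?nu.2 ?nv.2.
- by case: (nnmeasM nu (nnmeas_reflect x nv)).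
- by case: (nnmeasM nu (nnmeas_reflect x nw)).
- by move=> y _; rewrite lee_wpmul2l // nu.2.
Qed.

Lemma continuous_primitive (u : R -> \bar R) : nnmeas u -> causal u ->
  (\int[mu]_x u x < +oo)%E -> continuous (fun x => fine (econv heav u x)).
Proof.
move=> nu cu uy x.
have uy' z : (\int[mu]_(y in `]-oo, z]) u y < +oo)%E.
  by apply: le_lt_trans uy; apply: ge0_subset_integral => //; [exact: nu.1|move=> y _; exact: nu.2].
have [Iu Lu Eu] := locally_integrable_of_primitive nu uy'.
(* A negative base point leaves the primitive of a causal function unchanged. *)
pose a := Num.min x 0 - 1; pose b := x + 1.
have a0 : a < 0 by rewrite /a ltrBlDr add0r gt_min ltr01 orbT.
have ax : a < x by rewrite /a ltrBlDr (@le_lt_trans _ _ x) ?ge_min ?lexx // ltrDl.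
have xb : x < b by rewrite ltrDl.
have ab : a < b by exact: lt_trans xb.
have Iab : mu.-integrable `[a, b] (EFin \o (fine \o u)).
  by apply: (integrableS _ _ _ (Iu b)) => // z; rewrite /= !in_itv /= => /andP[].
have := parameterized_integral_continuous (ltW ab) Iab.
have -> : (fun z => parameterized_integral mu a z (fine \o u)) =
          (fun z => fine (econv heav u z)).
  apply/funext => z; rewrite /parameterized_integral /Rintegral (econv_heav z nu); congr fine.
  transitivity (\int[mu]_(t in `[a, z]) u t)%E.
    apply: ae_eq_integral => //.
    - apply/measurable_EFinP/measurable_funTS.
      exact: measurableT_comp (fine_measurable measurableT) nu.1.
    - exact: measurable_funTS nu.1.
    - by apply: aeS Eu => t h _; exact: h.
  rewrite integral_mkcond [RHS]integral_mkcond; apply: eq_integral => t _.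
  rewrite !patchE !mem_setE !in_itv /=.
  have [//|ta] /= := leP a t.
  by rewrite cu ?if_same // ltW // (lt_trans ta).
by move=> /(within_continuous_continuous ab); apply; rewrite in_itv /= ax xb.
Qed.

(** Continuity is inherited from w by dominated convergence: M |f| dominates the integrand for every
    x at once. *)
Lemma continuous_econv_bounded (f w : R -> R) (M : R) :
  mu.-integrable setT (EFin \o f) -> continuous w -> (forall x, `|w x| <= M) ->
  continuous (fun x => fine (econv (EFin \o f) (EFin \o w) x)).
Proof.
move=> intf cw wM x.
have /integrableP[/measurable_EFinP mf _] := intf.
have mw y : measurable_fun [set: R] (fun t => w (y - t)).
  by apply: measurableT_comp (continuous_measurable_fun cw) _; exact: measurable_funB.
have iM : mu.-integrable setT (EFin \o (fun t => M * `|f t|)).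
  by have := integrableZl measurableT M (integrable_norm intf).
have le_fM y t : `|f t * w (y - t)| <= M * `|f t|.
  by rewrite normrM mulrC ler_wpM2r.
have := @continuity_under_integral R _ (measurableTypeR R) mu
  (fun y t => f t * w (y - t)) setT measurableT (x - 1) (x + 1) _ _ _ iM _ x.
apply.
- move=> y _; apply: (le_integrable _ _ _ iM) => //.
    apply/measurable_EFinP. apply: measurable_funM => //. exact: mw.
  by move=> t _ /=; rewrite lee_fin (le_trans (le_fM y t)) // ler_norm.
- apply: aeW => t _ y _; apply: cvgM; first exact: cvg_cst.
  apply: (@continuous_comp _ _ _ (fun y : R => y - t)); last exact: cw.
  by apply: cvgB; [exact: cvg_id|exact: cvg_cst].
- by move=> y _; apply: aeW => t _; exact: le_fM.
- by rewrite mem_setE in_itv /=; apply/andP; split; lra.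
Qed.

End continuity_of_convolution.

(** * The continuous version of the density *)

Section regular_version.
Context {R : realType} (alpha : R).
Hypothesis alpha01 : 0 < alpha < 1.
Notation mu := (@lebesgue_measure R).

Variable f : R -> R.
Let F := EFin \o f.
Hypotheses (nF : nnmeas F) (cF : causal F) (F1 : (\int[mu]_x F x = 1)%E).
Hypothesis Frker : ae_eq mu setT (econv F (rker alpha)) heav.

Let nH := @nnmeas_heav R.
Let nG : nnmeas (econv F heav). Proof. exact: nnmeas_econv. Qed.
Let nFF : nnmeas (econv F F). Proof. exact: nnmeas_econv. Qed.

Let intf : mu.-integrable setT F.
Proof.
apply/integrableP; split; first exact: nF.1.
by under eq_integral => x _ do rewrite gee0_abs ?nF.2 //; rewrite F1 ltry.
Qed.

(* The right-hand side of [size_bias_equation] is continuous, so dividing it by x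
   gives the regular version of the density. *)
Definition dfun (x : R) : R := fine (econv (EFin \o f) heav x).
Definition dfun2 (x : R) : R := fine (econv (EFin \o f) (econv (EFin \o f) heav) x).
Definition bias (x : R) : R := alpha * (dfun x - dfun2 (x - 1)).
Definition regver (x : R) : R := if 0 < x then bias x / x else 0.

Lemma dfunE x : econv F heav x = (dfun x)%:E.
Proof.
rewrite /dfun fineK // ge0_fin_numE ?nG.2 // (@le_lt_trans _ _ 1%E) ?ltry //.
by apply: econv_prob_le1 => // y; exact: heav_le1.
Qed.

Lemma dfun2E x : econv F (econv F heav) x = (dfun2 x)%:E.
Proof.
rewrite /dfun2 fineK // ge0_fin_numE ?(nnmeas_econv nF nG).2 //.
rewrite (@le_lt_trans _ _ 1%E) ?ltry //; apply: econv_prob_le1 => // y.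
by apply: econv_prob_le1 => // z; exact: heav_le1.
Qed.

Lemma dfun2E1 x : econv F (econv F (@heav1 R)) x = (dfun2 (x - 1))%:E.
Proof. by rewrite -dfun2E /heav1 econv_translate econv_translate. Qed.

Lemma dfun_le1 x : dfun x <= 1.
Proof. by rewrite -lee_fin -dfunE; apply: econv_prob_le1 => // y; exact: heav_le1. Qed.

Lemma dfun_le0 x : x <= 0 -> dfun x = 0.
Proof. by move=> x0; rewrite /dfun (causal_econv cF (@causal_heav R)). Qed.

Lemma dfun2_ge0 x : 0 <= dfun2 x.
Proof. by rewrite -lee_fin -dfun2E (nnmeas_econv nF nG).2. Qed.

Lemma dfun2_le0 x : x <= 0 -> dfun2 x = 0.
Proof.
by move=> x0; rewrite /dfun2 (causal_econv cF) //; exact: causal_econv cF (@causal_heav R).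
Qed.

(** Makes [bias] nonnegative. F * H(x - 1) is causal and at most 1, hence lies below H, and
    convolution with F preserves the order. *)
Lemma dfun2_le_dfun x : dfun2 (x - 1) <= dfun x.
Proof.
rewrite -lee_fin -dfunE -dfun2E1; apply: econv_mono => //.
  exact: nnmeas_econv nF (@nnmeas_heav1 R).
move=> y; apply: econv_heav_le_heav.
- exact: nnmeas_econv nF (@nnmeas_heav1 R).
- exact: causal_econv cF (@causal_heav1 R).
- move=> z; apply: econv_prob_le1 => //; first exact: nnmeas_heav1.
  by move=> t; exact: heav_le1.
Qed.

Let alpha0 : 0 < alpha. Proof. by case/andP: alpha01. Qed.

Lemma bias_ge0 x : 0 <= bias x.
Proof. by rewrite mulr_ge0 ?subr_ge0 ?dfun2_le_dfun // ltW. Qed.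

Lemma bias_le1 x : `|bias x| <= 1.
Proof.
rewrite ger0_norm ?bias_ge0 // /bias.
apply: mulr_ile1; rewrite ?subr_ge0 ?dfun2_le_dfun //.
- exact: ltW.
- by apply: ltW; case/andP: alpha01.
- by have := dfun_le1 x; have := dfun2_ge0 (x - 1); lra.
Qed.

Lemma bias_le0 x : x <= 0 -> bias x = 0.
Proof. by move=> x0; rewrite /bias dfun_le0 // dfun2_le0 ?subr0 ?mulr0 //; lra. Qed.

Lemma econv_self_heav : econv F (econv F heav) = econv heav (econv F F).
Proof. by rewrite (econvC nF nH) (econvCA nF nH nF). Qed.

Lemma continuous_dfun : continuous dfun.
Proof.
rewrite /dfun (econvC nF nH); apply: continuous_primitive => //.
by rewrite F1 ltry.
Qed.

Lemma continuous_dfun2 : continuous dfun2.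
Proof.
rewrite /dfun2 econv_self_heav; apply: continuous_primitive => //.
  exact: causal_econv.
by rewrite integral_econv // F1 mule1 ltry.
Qed.

Lemma continuous_bias : continuous bias.
Proof.
move=> x; apply: cvgMr; apply: cvgB; first exact: continuous_dfun.
apply: (@continuous_comp _ _ _ (fun x : R => x - 1)); last exact: continuous_dfun2.
by apply: cvgB; [exact: cvg_id|exact: cvg_cst].
Qed.

Lemma xmul_regver x : (xmul (EFin \o regver) x = (bias x)%:E)%E.
Proof.
rewrite /xmul /regver /=; case: (ltP 0 x) => x0; last by rewrite mule0 bias_le0.
by rewrite -EFinM; congr EFin; field; rewrite gt_eqF.
Qed.

Lemma regver_ge0 x : 0 <= regver x.
Proof. by rewrite /regver; case: ifP => // x0; rewrite divr_ge0 ?bias_ge0 // ltW. Qed.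

Lemma ae_regver : ae_eq mu setT (EFin \o regver) F.
Proof.
apply: aeS (size_bias_equation alpha01 nF cF F1 Frker) => x + _ => /(_ I).
rewrite dfunE dfun2E1 /F /xmul /= /regver /bias.
case: (ltP 0 x) => x0; last by move=> _; have := cF x0; rewrite /F /= => ->.
rewrite -!EFinM -!EFinD => -[h]; congr EFin.
have xn0 : x != 0 by rewrite gt_eqF.
by apply: (mulIf xn0); rewrite divfK // mulrC; lra.
Qed.

Lemma continuous_regver x : 0 < x -> {for x, continuous regver}.
Proof.
move=> x0.
have e : regver x = bias x / x by rewrite /regver x0.
have h : (bias y / y) @[y --> x] --> regver x.
  by rewrite e; apply: cvgM; [exact: continuous_bias|apply: cvgV => //; rewrite gt_eqF].
apply: cvg_trans h; apply: near_eq_cvg.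
by near=> y; rewrite /regver ifT //; near: y; exact: lt_nbhsr.
Unshelve. all: by end_near. Qed.

Lemma nnmeas_regver : nnmeas (EFin \o regver).
Proof.
have -> : EFin \o regver = (fun x => (if x \in `]0%R, +oo[%classic
    then bias x * x `^ (-1) else 0)%:E).
  apply/funext => x; rewrite mem_setE in_itv /= andbT /regver; congr EFin.
  by case: ifP => // x0; rewrite powR_inv1 // ltW.
apply: (@nnmeas_if_in R (fun x => bias x * x `^ (-1)) `]0%R, +oo[%classic) => //.
  apply: measurable_funM; last exact: measurable_powR.
  exact: continuous_measurable_fun continuous_bias.
by move=> x; rewrite mulr_ge0 ?bias_ge0 ?powR_ge0.
Qed.

End regular_version.

(** * The differential equation for the continuous version *)

Section regular_version_ode.
Context {R : realType} (alpha : R).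
Hypothesis alpha01 : 0 < alpha < 1.
Notation mu := (@lebesgue_measure R).

Variable f : R -> R.
Let F := EFin \o f.
Hypotheses (nF : nnmeas F) (cF : causal F) (F1 : (\int[mu]_x F x = 1)%E).
Hypothesis Frker : ae_eq mu setT (econv F (rker alpha)) heav.

Let phi := regver alpha f.
Let nH := @nnmeas_heav R.
Let nFF : nnmeas (econv F F). Proof. exact: nnmeas_econv. Qed.
Let nphi : nnmeas (EFin \o phi). Proof. exact: nnmeas_regver. Qed.
Let Fphi : ae_eq mu setT (EFin \o phi) F. Proof. exact: ae_regver. Qed.

Let intf : mu.-integrable setT F.
Proof.
apply/integrableP; split; first exact: nF.1.
by under eq_integral => x _ do rewrite gee0_abs ?nF.2 //; rewrite F1 ltry.
Qed.

Let nbias : nnmeas (EFin \o bias alpha f).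
Proof.
split; last by move=> x; rewrite lee_fin; exact: bias_ge0.
apply/measurable_EFinP; apply: continuous_measurable_fun.
exact: continuous_bias.
Qed.

Lemma econv_regver_regver : econv (EFin \o phi) (EFin \o phi) = econv F F.
Proof. by rewrite (eq_econv_ael nphi nF nphi Fphi) (eq_econv_aer nphi nF nF Fphi). Qed.

Let biasconv (x : R) := fine (econv F (EFin \o bias alpha f) x).

(** The Leibniz rule gives x (F * F) = 2 F * (xF). Altering a factor on a null set does not change a
    convolution at any point, so xF may be replaced by the bounded continuous [bias]; hence F * F is
    finite at every x > 0, and continuous there. *)
Lemma xmul_econv_self x : (xmul (econv F F) x = (2 * biasconv x)%:E)%E.
Proof.
rewrite xmul_econv // (econvC (nnmeas_xmul nF) nF).
have -> : econv F (xmul F) = econv F (EFin \o bias alpha f).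
  apply: eq_econv_aer => //; first exact: nnmeas_xmul.
  apply: aeS Fphi => x' /= + _ => /(_ I) e.
  by rewrite -(xmul_regver alpha cF) /xmul -e.
have fin : econv F (EFin \o bias alpha f) x \is a fin_num.
  rewrite ge0_fin_numE ?(nnmeas_econv nF nbias).2 //.
  rewrite (@le_lt_trans _ _ 1%E) ?ltry //; apply: econv_prob_le1 => // y.
  by rewrite lee_fin (le_trans (ler_norm _)) //; exact: bias_le1.
by rewrite -(fineK fin) -EFinD; congr EFin; rewrite mulrDl mul1r.
Qed.

Definition selfconv (x : R) := fine (econv (EFin \o f) (EFin \o f) x).

Lemma selfconv_gt0E x : 0 < x -> econv F F x = (2 * biasconv x / x)%:E.
Proof.
move=> x0; have := xmul_econv_self x; rewrite /xmul max_l ?ltW //.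
move=> /(congr1 (fun z => x^-1%:E * z)%E).
by rewrite muleA -EFinM mulVf ?gt_eqF // mul1e => ->; rewrite -EFinM mulrC.
Qed.

Lemma selfconv_le0 x : x <= 0 -> econv F F x = 0%E.
Proof. exact: causal_econv. Qed.

Lemma selfconvE x : econv F F x = (selfconv x)%:E.
Proof.
rewrite /selfconv; have [x0|x0] := leP x 0; first by rewrite selfconv_le0.
by rewrite selfconv_gt0E.
Qed.

Lemma continuous_selfconv (x : R) : x != 0 -> {for x, continuous selfconv}.
Proof.
have [x0 _|x0 _|//] := ltgtP x 0.
  have e : selfconv x = 0 by rewrite /selfconv selfconv_le0 // ltW.
  have : (0 : R) @[y --> x] --> selfconv x by rewrite e; exact: cvg_cst.
  move=> h; apply: cvg_trans h; apply: near_eq_cvg.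
  near=> y; rewrite /selfconv selfconv_le0 // ltW //; near: y; exact: lt_nbhsl.
have e : selfconv x = 2 * biasconv x / x by rewrite /selfconv selfconv_gt0E.
have h : (2 * biasconv y / y) @[y --> x] --> selfconv x.
  rewrite e; apply: cvgM; last by apply: cvgV => //; rewrite gt_eqF.
  apply: cvgMr; apply: (@continuous_econv_bounded R f (bias alpha f) 1) => //.
    exact: continuous_bias.
  by move=> y; exact: bias_le1.
apply: cvg_trans h; apply: near_eq_cvg.
near=> y; rewrite /selfconv selfconv_gt0E //; near: y; exact: lt_nbhsr.
Unshelve. all: by end_near. Qed.

Lemma convolution_regver x : convolution phi phi x = selfconv x.
Proof.
rewrite /convolution /selfconv; case: (ltP 0 x) => x0; last by rewrite selfconv_le0.
rewrite -econv_regver_regver /Rintegral /econv; congr fine.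
rewrite integral_mkcond; apply: eq_integral => u _.
rewrite patchE mem_setE in_itv /= /phi /regver.
have [u0|u0] := ltP 0 u; last by rewrite mul0e.
have [ux|ux] := ltP u x; first by rewrite subr_gt0 ux.
by rewrite subr_gt0 ltNge ux /= mule0.
Qed.

(** The primitive does not distinguish U from u, so the fundamental theorem of calculus applies at
    any continuity point of u. *)
Lemma is_derive_primitive (u : R -> R) (U : R -> \bar R) (x : R) : nnmeas U ->
  nnmeas (EFin \o u) -> ae_eq mu setT (EFin \o u) U -> (\int[mu]_x U x < +oo)%E ->
  {for x, continuous u} -> is_derive x 1 (fun z => fine (econv heav U z)) (u x).
Proof.
move=> nU nu uU Uy cu.
have uy : (\int[mu]_y (EFin \o u) y < +oo)%E.
  rewrite (_ : \int[mu]_y (EFin \o u) y = \int[mu]_x U x)%E //.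
  apply: ge0_ae_eq_integral => //.
  - exact: nu.1.
  - exact: nU.1.
  - by move=> y _; exact: nu.2.
  - by move=> y _; exact: nU.2.
have iu z : mu.-integrable `]-oo, z] (EFin \o u).
  apply/integrableP; split; first exact: measurable_funTS nu.1.
  under eq_integral => y _ do rewrite gee0_abs ?(nu.2 y) //.
  apply: le_lt_trans uy; apply: ge0_subset_integral => //; first exact: nu.1.
  by move=> y _; exact: nu.2.
have -> : (fun z => fine (econv heav U z)) = (fun z => \int[mu]_(t in `]-oo, z]) u t).
  apply/funext => z; rewrite econv_heav // /Rintegral; congr fine.
  apply: ae_eq_integral => //; [exact: measurable_funTS nU.1|exact: measurable_funTS nu.1|].
  by apply: aeS uU => t h _; apply/esym/h.
have x1 : x < x + 1 by rewrite ltrDl.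
have [d e] := @continuous_FTC1 R u -oo%O x (x + 1) x1 (iu _) (ltNyr _) cu.
by split; [exact: d|rewrite -derive1E; exact: e].
Qed.

Lemma is_derive_dfun (x : R) : 0 < x -> is_derive x 1 (dfun f) (phi x).
Proof.
move=> x0; rewrite /dfun (econvC nF nH); apply: is_derive_primitive => //.
  by rewrite F1 ltry.
exact: continuous_regver.
Qed.

Lemma is_derive_dfun2 (x : R) : x != 0 -> is_derive x 1 (dfun2 f) (selfconv x).
Proof.
move=> x0; rewrite /dfun2 (@econv_self_heav R f) //.
have e : EFin \o selfconv = econv F F by apply/funext => y; rewrite /= selfconvE.
apply: is_derive_primitive => //.
- by rewrite e.
- by rewrite e; exact: ae_eq_refl.
- by rewrite integral_econv // F1 mule1 ltry.
- exact: continuous_selfconv.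
Qed.

(** Differentiates x phi(x) = alpha (G(x) - G2(x - 1)), where G' = phi and G2' = F * F. The point x
    = 1 is set apart because there G2 would be differentiated at 0, where continuity of F * F is not
    established. *)
Lemma regver_ode (x : R) : 0 < x -> x != 1 -> derivable phi x 1 /\
  x * phi^`()%classic x + (1 - alpha) * phi x = - alpha * convolution phi phi (x - 1).
Proof.
move=> x0 x1; rewrite convolution_regver.
have dG := is_derive_dfun x0.
have dQ : is_derive x 1 (fun y => dfun2 f (y - 1)) (selfconv (x - 1)).
  rewrite -[selfconv _]mulr1; apply: (@is_derive1_comp _ (dfun2 f) (fun y => y - 1)).
    by apply: is_derive_dfun2; rewrite subr_eq0.
  have := @is_derive_affine R 1 1 x.
  by rewrite (_ : (fun x => 1 * x - 1) = (fun y => y - 1)) //; apply/funext => y; rewrite mul1r.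
have xn0 : x != 0 by rewrite gt_eqF.
have dI : is_derive x 1 (fun y : R => y^-1) (- x ^- 2).
  have h := @is_deriveV R id x 1 1 xn0 (is_derive_id x 1).
  by apply: is_derive_eq; rewrite /GRing.scale /= mulr1.
(* For y <= 0 the numerator vanishes, so the quotient formula holds on the whole line and can be
   differentiated as a function. *)
have phiE : phi = (cst alpha * (dfun f - (fun y => dfun2 f (y - 1)))) * (fun y : R => y^-1) :> (R -> R).
  apply/funext => y; rewrite /phi /regver; case: (ltP 0 y) => y0; first by [].
  transitivity (bias alpha f y / y); last by [].
  by rewrite bias_le0 // mul0r.
have dphi : is_derive x 1 phi ((alpha * (phi x - selfconv (x - 1)) - phi x) / x).
  have e : phi x = alpha * (dfun f x - dfun2 f (x - 1)) / x by rewrite phiE.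
  rewrite phiE; apply: is_derive_eq; rewrite /GRing.scale /= -phiE e.
  have -> : (cst alpha * (dfun f - (fun y : R => dfun2 f (y - 1)))) x =
    alpha * (dfun f x - dfun2 f (x - 1)) by [].
  by field.
case: dphi => d e; split => //; rewrite derive1E e; field.
by [].
Qed.

End regular_version_ode.

(** * The homogeneous equation and uniqueness of the solution *)

Section uniqueness.
Context {R : realType} (alpha : R).
Hypothesis alpha01 : 0 < alpha < 1.

(** x^(1 - alpha) is an integrating factor: its product with h has derivative 0 and is constant by
    the mean value theorem. Besides uniqueness, this also gives the form of the solution on (0,
    1). *)
Lemma homogeneous_ode (h : R -> R) (a b : R) : 0 <= a -> a < b ->
  (forall x, a < x < b -> derivable h x 1 /\ x * h^`()%classic x + (1 - alpha) * h x = 0) ->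
  exists C, forall x, a < x < b -> h x = C * x `^ (alpha - 1).
Proof.
move=> a0 ab H.
pose k (x : R) := h x * x `^ (1 - alpha).
have dk (x : R) : a < x < b -> is_derive x 1 k 0.
  move=> xab; have [dh eh] := H x xab.
  have x0 : 0 < x by case/andP: xab => ax _; exact: le_lt_trans ax.
  have dh' : is_derive x 1 h (h^`()%classic x) by split => //; rewrite derive1E.
  have dp := is_derive1_powR (1 - alpha) x0.
  have h' : is_derive x 1 (h * (@powR R ^~ (1 - alpha)) : R -> R) 0.
    apply: is_derive_eq; rewrite /GRing.scale /=.
    rewrite -[x `^ (1 - alpha) in X in _ + X](mulr_powRB1 (ltW x0)); last by case/andP: alpha01; lra.
    transitivity (x `^ (1 - alpha - 1) * (x * h^`()%classic x + (1 - alpha) * h x)); first by ring.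
    by rewrite eh mulr0.
  exact: h'.
have kcst (x y : R) : a < x -> x < y -> y < b -> k x = k y.
  move=> ax xy yb.
  have [||c _ e] := @MVT R k (cst 0) x y xy.
  - move=> z; rewrite in_itv /= => /andP[xz zy]; apply: dk.
    by rewrite (lt_trans ax xz) (lt_trans zy yb).
  - apply: continuous_in_subspaceT => z; rewrite mem_setE in_itv /= => /andP[xz zy].
    apply: (@is_derive_continuous R k z 0); apply: dk.
    by rewrite (lt_le_trans ax xz) (le_lt_trans zy yb).
  - by move: e; rewrite mul0r => /eqP; rewrite subr_eq0 => /eqP.
pose m := (a + b) / 2.
have am : a < m by rewrite /m; lra.
have mb : m < b by rewrite /m; lra.
exists (k m) => x /andP[ax xb].
have x0 : 0 < x by exact: le_lt_trans ax.
have -> : k m = k x.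
  by have [xm|xm|->//] := ltgtP x m; [exact/esym/kcst|exact: kcst].
rewrite /k -mulrA -powRD; last by rewrite (gt_eqF x0) implybT.
by rewrite (_ : 1 - alpha + (alpha - 1) = 0) ?powRr0 ?mulr1 //; ring.
Qed.

(* alpha - 1 < 0 makes x ^ (alpha - 1) unbounded at 0 *)
Lemma powR_bounded_coef0 (C M : R) :
  (\forall x \near 0^'+, `|C * x `^ (alpha - 1)| <= M) -> C = 0.
Proof.
move=> HM; apply/eqP; rewrite -normr_le0 leNgt; apply/negP => C0.
have c0 : (M * x `^ (1 - alpha)) @[x --> 0^'+] --> 0.
  rewrite -[X in _ --> X](mulr0 M); apply: cvgMr; apply: powR_cvg0.
  by case/andP: alpha01; lra.
have H : \forall x \near 0^'+, M * x `^ (1 - alpha) < `|C| by apply: (cvgr_lt _ c0).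
suff : False by [].
near (0 : R)^'+ => x.
have x0 : 0 < x by [].
have h1 : `|C * x `^ (alpha - 1)| <= M by near: x.
have : M * x `^ (1 - alpha) < `|C| by near: x.
rewrite ltNge => /negP; apply.
have p0 : 0 < x `^ (1 - alpha) by exact: powR_gt0.
have -> : `|C| = `|C * x `^ (alpha - 1)| * x `^ (1 - alpha).
  rewrite normrM -mulrA (ger0_norm (powR_ge0 _ _)) -powRD; last by rewrite (gt_eqF x0) implybT.
  by rewrite (_ : alpha - 1 + (1 - alpha) = 0) ?powRr0 ?mulr1 //; ring.
by rewrite ler_wpM2r // ltW.
Unshelve. all: by end_near. Qed.

Lemma between_nat_not_int (n : nat) (y : R) : n%:R < y < n.+1%:R -> y \isn't a Num.int.
Proof.
move=> /andP[ny yn]; apply/negP => /intrP[z ez].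
move: ny yn; rewrite ez !pmulrn !ltr_int; lia.
Qed.

Lemma dm_solution_unique (f1 f2 : R -> R) :
  dm_solution alpha f1 -> dm_solution alpha f2 -> f1 = f2.
Proof.
move=> [z1 c1 d1 O1] [z2 c2 d2 O2].
have step (n : nat) : forall x, x <= n%:R -> f1 x = f2 x.
  elim: n => [|n IH] x xn; first by rewrite z1 // z2.
  have [x0|x0] := leP x n%:R; first exact: IH.
  pose h y := f1 y - f2 y.
  have ode y : n%:R < y < n.+1%:R -> derivable h y 1 /\
      y * h^`()%classic y + (1 - alpha) * h y = 0.
    move=> /andP[ny yn].
    have y0 : 0 < y by exact: le_lt_trans ny.
    have yint : y \isn't a Num.int by apply: (@between_nat_not_int n); rewrite ny.
    have [dy1 e1] := d1 y y0 yint; have [dy2 e2] := d2 y y0 yint.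
    have dh : derivable h y 1 by exact: derivableB.
    split => //.
    have -> : h^`()%classic y = f1^`()%classic y - f2^`()%classic y.
      by rewrite !derive1E; exact: (deriveB dy1 dy2).
    (* As y - 1 < n, both arguments in the delayed integral stay in the range of the induction
       hypothesis. *)
    have ec : convolution f1 f1 (y - 1) = convolution f2 f2 (y - 1).
      rewrite /convolution; case: ifP => // y1; apply: eq_Rintegral => u.
      rewrite mem_setE in_itv /= => /andP[u0 uy].
      have yn1 : y - 1 < n%:R by rewrite ltrBlDr natr1.
      by rewrite (IH u) ?(IH (y - 1 - u)) //; lra.
    rewrite ec in e1; rewrite /h; lra.
  have n1 : n%:R < n.+1%:R :> R by rewrite ltr_nat.
  have [C hC] := homogeneous_ode (ler0n R n) n1 ode.
  have ch (y : R) : 0 < y -> h z @[z --> y] --> h y by move=> y0; apply: cvgB; [exact: c1|exact: c2].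
  have C0 : C = 0.
    case: n IH x0 xn ode n1 hC => [|n] IH x0 xn ode n1 hC.
      move: O1 O2 => /eqO_exP[M1 M10 H1] /eqO_exP[M2 M20 H2].
      apply: (@powR_bounded_coef0 C (M1 + M2)).
      near=> y.
      have y0 : 0 < y by [].
      have y1 : y < 1 by near: y; exact: nbhs_right_lt.
      rewrite -hC ?y0 // /h.
      have -> : f1 y - f2 y = (f1 y - sin (alpha * pi) / pi * y `^ (alpha - 1)) -
         (f2 y - sin (alpha * pi) / pi * y `^ (alpha - 1)) by ring.
      have b1 : `|f1 y - sin (alpha * pi) / pi * y `^ (alpha - 1)| <= M1 * `|1 : R|.
        by near: y; exact: H1.
      have b2 : `|f2 y - sin (alpha * pi) / pi * y `^ (alpha - 1)| <= M2 * `|1 : R|.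
        by near: y; exact: H2.
      rewrite normr1 mulr1 in b1; rewrite normr1 mulr1 in b2.
      by rewrite (le_trans (ler_normB _ _)) // lerD.
    have n0 : 0 < n.+1%:R :> R by [].
    have h0 : h n.+1%:R = 0 by rewrite /h IH // subrr.
    have l1 : h z @[z --> n.+1%:R^'+] --> (0 : R).
      by rewrite -h0; apply: cvg_at_right_filter; exact: ch.
    have l2 : h z @[z --> n.+1%:R^'+] --> C * n.+1%:R `^ (alpha - 1).
      have : (C * z `^ (alpha - 1)) @[z --> n.+1%:R^'+] --> C * n.+1%:R `^ (alpha - 1).
        by apply: cvgMr; apply: cvg_at_right_filter; exact: continuous_powR.
      apply: cvg_trans; apply: near_eq_cvg; near=> z; rewrite hC //.
      by apply/andP; split; [by []|near: z; apply: nbhs_right_lt; rewrite ltr_nat].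
    have e0 : C * n.+1%:R `^ (alpha - 1) = 0.
      by rewrite -(cvg_lim (@Rhausdorff R) l2); apply/cvg_lim.
    by move/eqP: e0; rewrite mulf_eq0 powR_eq0 (gt_eqF n0) /= orbF => /eqP.
  have [xn1|xn1] := ltP x n.+1%:R.
    by apply/eqP; rewrite -subr_eq0 -/(h x) hC ?x0 // C0 mul0r.
  (* At the right end of the step the two solutions agree by continuity from the left. *)
  have xE : x = n.+1%:R by apply/eqP; rewrite eq_le xn.
  have xp : 0 < x by rewrite xE.
  have l1 : h z @[z --> x^'-] --> h x by apply: cvg_at_left_filter; exact: ch.
  have l2 : h z @[z --> x^'-] --> (0 : R).
    have : (0 : R) @[z --> x^'-] --> (0 : R) by exact: cvg_cst.
    apply: cvg_trans; apply: near_eq_cvg; near=> z; rewrite hC ?C0 ?mul0r //.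
    apply/andP; split; last by rewrite -xE.
    by near: z; exact: nbhs_left_gt.
  apply/eqP; rewrite -subr_eq0; apply/eqP; rewrite -/(h x).
  by rewrite -(cvg_lim (@Rhausdorff R) l1); apply/cvg_lim.
apply/funext => x; apply: (step (Num.truncn `|x|).+1).
by rewrite (le_trans (ler_norm x)) // ltW // truncnS_gt.
Unshelve. all: by end_near. Qed.

End uniqueness.

(** * Partial fractions of the cosecant by means of the Fejer kernel *)

Section cosecant_series.
Context {R : realType} (alpha : R).
Hypothesis alpha01 : 0 < alpha < 1.

Definition dirichlet (N : nat) (x : R) : R := 1 + 2 * \sum_(i < N) cos (i.+1%:R * x).

(** A difference in N, so that summing over N < M telescopes. *)
Lemma dirichletE N (x : R) :
  dirichlet N x * (1 - cos x) = cos (N%:R * x) - cos (N.+1%:R * x).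
Proof.
elim: N => [|N IH]; first by rewrite /dirichlet big_ord0 mulr0 addr0 !mul1r mul0r cos0.
have -> : dirichlet N.+1 x = dirichlet N x + 2 * cos (N.+1%:R * x).
  by rewrite /dirichlet big_ord_recr /=; ring.
rewrite mulrDl IH.
have -> : N.+2%:R * x = N.+1%:R * x + x by rewrite -natr1; ring.
have -> : N%:R * x = N.+1%:R * x - x by rewrite -natr1; ring.
by rewrite cosB cosD; ring.
Qed.

(** M times the usual Fejer kernel. *)
Definition fejer (M : nat) (x : R) : R := \sum_(N < M) dirichlet N x.

Lemma fejerE M (x : R) : fejer M x * (1 - cos x) = 1 - cos (M%:R * x).
Proof.
elim: M => [|M IH]; first by rewrite /fejer big_ord0 !mul0r cos0 subrr.
rewrite /fejer big_ord_recr /= mulrDl -/(fejer M x) IH dirichletE; ring.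
Qed.

(** As 0 < alpha x <= x < pi, the factor 1 - cos(alpha x) is at most 1 - cos x, the denominator of
    the kernel; what is left is 1 - cos(Mx) <= 2, uniformly in M. *)
Lemma fejer_cos_bounds M (x : R) : 0 < x < pi ->
  0 <= (1 - cos (alpha * x)) * fejer M x <= 2.
Proof.
move=> /andP[x0 xpi]; case/andP: alpha01 => a0 a1.
have c1 : 0 < 1 - cos x.
  rewrite subr_gt0 -cos0 ltr_cos // ?in_itv /= ?lexx ?pi_ge0 // ltW //=; exact: ltW.
have axx : alpha * x <= x by rewrite ler_piMl // ltW.
have ax0 : 0 <= alpha * x by rewrite mulr_ge0 // ltW.
have le1 : 1 - cos (alpha * x) <= 1 - cos x.
  rewrite lerD2l lerN2 leNgt ltr_cos -?leNgt // in_itv /= ?ax0 ?(ltW x0) ?(ltW xpi) //.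
  by rewrite (le_trans axx) // ltW.
have ge0 : 0 <= 1 - cos (alpha * x) by rewrite subr_ge0 cos_le1.
have fE : fejer M x = (1 - cos (M%:R * x)) / (1 - cos x) by rewrite -fejerE mulfK // gt_eqF.
have f0 : 0 <= fejer M x by rewrite fE divr_ge0 ?subr_ge0 ?cos_le1.
rewrite mulr_ge0 //= (@le_trans _ _ ((1 - cos x) * fejer M x)) ?ler_wpM2r //.
by rewrite mulrC fejerE; have := cos_geN1 (M%:R * x); lra.
Qed.

(* Partial sums of the partial fraction expansion of pi / sin (alpha pi). The Fejer
   kernel bounds their Cesaro means, which suffices once convergence is known. *)
Definition csc_partial (N : nat) : R :=
  alpha^-1 + \sum_(i < N) (-1) ^+ i.+1 * ((alpha + i.+1%:R)^-1 + (alpha - i.+1%:R)^-1).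

(** The primitive of (1 - cos(alpha x)) [dirichlet N x] vanishing at 0, with products of cosines
    expanded into sums. Its value at pi brings in [csc_partial]. *)
Definition dirichlet_prim (N : nat) (x : R) : R :=
  x - alpha^-1 * sin (alpha * x) + \sum_(i < N) (2 * i.+1%:R^-1 * sin (i.+1%:R * x)
    - (alpha + i.+1%:R)^-1 * sin ((alpha + i.+1%:R) * x)
    - (alpha - i.+1%:R)^-1 * sin ((alpha - i.+1%:R) * x)).

Lemma is_derive_sin_scale (s x : R) :
  is_derive x 1 (fun x : R => sin (s * x)) (s * cos (s * x)).
Proof.
have := is_derive_sin_affine s 0 x.
by rewrite subr0; under [X in is_derive _ _ X _]eq_fun do rewrite subr0.
Qed.

Lemma alpha_nat_neq0 (i : nat) : (alpha + i.+1%:R != 0) /\ (alpha - i.+1%:R != 0).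
Proof.
case/andP: alpha01 => a0 a1; split; first by rewrite gt_eqF // addr_gt0.
by rewrite lt_eqF // subr_lt0 (lt_le_trans a1) // ler1n.
Qed.

Lemma is_derive_dirichlet_prim N (x : R) :
  is_derive x 1 (dirichlet_prim N) ((1 - cos (alpha * x)) * dirichlet N x).
Proof.
case/andP: alpha01 => a0 a1.
elim: N => [|N IH].
  have -> : dirichlet_prim 0 = id - cst alpha^-1 * (fun x => sin (alpha * x)) :> (R -> R).
    by apply/funext => y; rewrite /dirichlet_prim big_ord0 addr0.
  have h := is_derive_sin_scale alpha x.
  apply: is_derive_eq; rewrite /dirichlet big_ord0 /GRing.scale /=; field.
  by rewrite gt_eqF.
pose k : R := N.+1%:R.
have [k1 k2] := alpha_nat_neq0 N.
have k0 : k != 0 by rewrite pnatr_eq0.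
have -> : dirichlet_prim N.+1 = dirichlet_prim N + (cst (2 * k^-1) * (fun x => sin (k * x))
    - cst (alpha + k)^-1 * (fun x => sin ((alpha + k) * x))
    - cst (alpha - k)^-1 * (fun x => sin ((alpha - k) * x))) :> (R -> R).
  by apply/funext => y; rewrite /dirichlet_prim big_ord_recr /= addrA.
have h1 := is_derive_sin_scale k x.
have h2 := is_derive_sin_scale (alpha + k) x.
have h3 := is_derive_sin_scale (alpha - k) x.
have cZ c (f : R -> R) df (hf : is_derive x 1 f df) : is_derive x 1 (cst c * f) (c * df).
  by apply: is_derive_eq; rewrite /GRing.scale /= mulr0 addr0.
apply: is_derive_eq (is_deriveD IH (is_deriveB (is_deriveB (cZ _ _ _ h1) (cZ _ _ _ h2))
  (cZ _ _ _ h3))) _.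
have -> : dirichlet N.+1 x = dirichlet N x + 2 * cos (k * x).
  by rewrite /dirichlet big_ord_recr /=; ring.
have -> : (alpha + k) * x = alpha * x + k * x by ring.
have -> : (alpha - k) * x = alpha * x - k * x by ring.
rewrite cosD cosB.
rewrite -/k in k1 k2; clear IH h1 h2 h3; clearbody k; field.
by rewrite k0 k1 k2.
Qed.

Lemma dirichlet_prim0 N : dirichlet_prim N 0 = 0.
Proof.
rewrite /dirichlet_prim mulr0 sin0 mulr0 subr0 add0r big1 // => i _.
by rewrite !mulr0 sin0 !mulr0 !subr0.
Qed.

Lemma sin_cos_natpi n : sin (n%:R * pi) = 0 :> R /\ cos (n%:R * pi) = (-1) ^+ n :> R.
Proof.
elim: n => [|n [IH1 IH2]]; first by rewrite mul0r sin0 cos0.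
rewrite -natr1 mulrDl mul1r (sinD (n%:R * pi) pi) (cosD (n%:R * pi) pi) sinpi cospi IH1 IH2 exprS.
by split; ring.
Qed.

Lemma dirichlet_prim_pi N : dirichlet_prim N pi = pi - sin (alpha * pi) * csc_partial N.
Proof.
rewrite /dirichlet_prim /csc_partial (mulrDr (sin (alpha * pi))) mulr_sumr opprD addrA.
congr (_ + _); first by ring.
rewrite -sumrN; apply: eq_bigr => i _.
have -> : (alpha + i.+1%:R) * pi = alpha * pi + i.+1%:R * pi by ring.
have -> : (alpha - i.+1%:R) * pi = alpha * pi - i.+1%:R * pi by ring.
rewrite (sinD _ (i.+1%:R * pi)) (sinB _ (i.+1%:R * pi)).
have [-> ->] := sin_cos_natpi i.+1.
by ring.
Qed.

(** The middle term is the integral of (1 - cos(alpha x)) [fejer M x] over [0, pi], estimated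
    through the mean value theorem. The bound does not depend on M, so it disappears in the Cesaro
    means. *)
Lemma cesaro_csc M : 0 <= M%:R * pi - sin (alpha * pi) * \sum_(N < M) csc_partial N <= 2 * pi.
Proof.
have dG m (x : R) : is_derive x 1 (fun x => \sum_(N < m) dirichlet_prim N x)
    ((1 - cos (alpha * x)) * fejer m x).
  rewrite /fejer; elim: m => [|m IH].
    under [X in is_derive _ _ X _]eq_fun do rewrite big_ord0.
    by rewrite big_ord0 mulr0; exact: is_derive_cst.
  rewrite big_ord_recr /= mulrDr.
  have h := is_derive_dirichlet_prim m x.
  have -> : (fun x => \sum_(N < m.+1) dirichlet_prim N x) =
     (fun x => \sum_(N < m) dirichlet_prim N x) + dirichlet_prim m.
    by apply/funext => y; rewrite big_ord_recr.
  exact: is_deriveD.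
pose G (x : R) := \sum_(N < M) dirichlet_prim N x.
have [|c cpi e] := @MVT R G (fun x => (1 - cos (alpha * x)) * fejer M x) 0 pi (pi_gt0 R).
  by apply: continuous_subspaceT => x; exact: is_derive_continuous (dG M x).
have Gpi : G pi = M%:R * pi - sin (alpha * pi) * \sum_(N < M) csc_partial N.
  rewrite /G mulr_sumr; under eq_bigr do rewrite dirichlet_prim_pi.
  by rewrite sumrB sumr_const card_ord mulr_natl.
have G0 : G 0 = 0 by rewrite /G big1 // => i _; exact: dirichlet_prim0.
have -> : M%:R * pi - sin (alpha * pi) * \sum_(N < M) csc_partial N =
    (1 - cos (alpha * c)) * fejer M c * pi by rewrite -Gpi -[G pi]subr0 -{1}G0 e subr0.
have /andP[h1 h2] := @fejer_cos_bounds M c cpi.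
apply/andP; split; first exact: mulr_ge0 h1 (pi_ge0 R).
exact: ler_wpM2r (pi_ge0 R) _ _ h2.
Qed.

Lemma csc_series (c : R) : csc_partial @ \oo --> c -> sin (alpha * pi) * c = pi.
Proof.
move=> cc; have am := cesaro cc.
have sm : (sin (alpha * pi) * arithmetic_mean csc_partial n) @[n --> \oo] -->
    sin (alpha * pi) * c by exact: cvgMr.
have lim_pi : (pi - sin (alpha * pi) * arithmetic_mean csc_partial n) @[n --> \oo] --> (0 : R).
  have hh : (2 * pi * @harmonic R n) @[n --> \oo] --> (0 : R).
    by rewrite -[X in _ --> X](mulr0 (2 * pi)); apply: cvgMr; exact: cvg_harmonic.
  apply: (squeeze_cvgr _ (cvg_cst 0) hh); apply: nearW => n.
  have /andP[h1 h2] := cesaro_csc n.+1.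
  have -> : pi - sin (alpha * pi) * arithmetic_mean csc_partial n =
     n.+1%:R^-1 * (n.+1%:R * pi - sin (alpha * pi) * \sum_(N < n.+1) csc_partial N).
    by rewrite /arithmetic_mean /= /series /= big_mkord; field.
  by rewrite mulr_ge0 //= mulrC /harmonic /= ler_wpM2r.
rewrite -(cvg_lim (@Rhausdorff R) sm); apply/cvg_lim; first exact: Rhausdorff.
have -> : (fun n => sin (alpha * pi) * arithmetic_mean csc_partial n) =
    (fun n => pi - (pi - sin (alpha * pi) * arithmetic_mean csc_partial n)).
  by apply/funext => n; rewrite opprB addrC subrK.
by rewrite -[X in _ --> X]subr0; apply: cvgB => //; exact: cvg_cst.
Qed.

End cosecant_series.

(** * The cosecant as an integral over the unit interval *)

Section cosecant_integral.
Context {R : realType} (alpha : R).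
Hypothesis alpha01 : 0 < alpha < 1.
Notation mu := (@lebesgue_measure R).

Let mI : measurable (`]0%R, 1%R]%classic : set (measurableTypeR R)).
Proof. exact: measurable_itv. Qed.

Let wgt (t : R) : R := t `^ (alpha - 1) + t `^ (- alpha).
Let psum (N : nat) (t : R) : R := wgt t * \sum_(n < N) (- t) ^+ n.
Let ssum (N : nat) : R := \sum_(n < N) (-1) ^+ n * ((alpha + n%:R)^-1 + (n.+1%:R - alpha)^-1).

Lemma integrable_powR01 (p : R) : -1 < p -> mu.-integrable `]0%R, 1%R] (fun t => (t `^ p)%:E).
Proof.
move=> p1; apply/integrableP; split.
  by apply/measurable_EFinP/measurable_funTS; exact: measurable_powR.
under eq_integral => x _ do rewrite gee0_abs ?lee_fin ?powR_ge0 //.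
by rewrite integral_powR // ltry.
Qed.

Lemma Rintegral_powR01 (p : R) : -1 < p -> \int[mu]_(t in `]0%R, 1%R]) (t `^ p) = (p + 1)^-1.
Proof. by move=> p1; rewrite /Rintegral integral_powR //= powR1 mul1r. Qed.

Let psum_term (N : nat) (t : R) : 0 < t ->
  wgt t * (- t) ^+ N = (-1) ^+ N * (t `^ (alpha - 1 + N%:R) + t `^ (- alpha + N%:R)).
Proof.
move=> t0; rewrite (exprNn t) /wgt !powRD ?(gt_eqF t0) ?implybT // powR_mulrn ?ltW //; ring.
Qed.

Let Rintegral_psum N : mu.-integrable `]0%R, 1%R] (EFin \o psum N) /\
  \int[mu]_(t in `]0%R, 1%R]) psum N t = ssum N.
Proof.
case/andP: alpha01 => a0 a1.
elim: N => [|N [IH1 IH2]].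
  have -> : psum 0 = cst 0 by apply/funext => t; rewrite /psum big_ord0 mulr0.
  by split; [exact: integrable0|rewrite /ssum big_ord0 Rintegral_cst // mul0r].
have i1 : mu.-integrable `]0%R, 1%R] (fun t => (t `^ (alpha - 1 + N%:R))%:E).
  by apply: integrable_powR01; have := ler0n R N; lra.
have i2 : mu.-integrable `]0%R, 1%R] (fun t => (t `^ (- alpha + N%:R))%:E).
  by apply: integrable_powR01; have := ler0n R N; lra.
pose k (t : R) : R := (-1) ^+ N * (t `^ (alpha - 1 + N%:R) + t `^ (- alpha + N%:R)).
have ik : mu.-integrable `]0%R, 1%R] (EFin \o k).
  have h := integrableZl mI ((-1) ^+ N : R) (integrableD mI i1 i2).
  by apply: eq_integrable h.
have e t : `]0, 1]%classic t -> psum N.+1 t = psum N t + k t.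
  rewrite /= in_itv /= => /andP[t0 _].
  by rewrite /psum big_ord_recr /= mulrDr psum_term.
split.
  have h := integrableD mI IH1 ik.
  by apply: eq_integrable h => // t /set_mem t01; rewrite /= e.
rewrite (@eq_Rintegral _ _ _ mu _ (fun t => psum N t + k t)); last by move=> t /set_mem; exact: e.
rewrite RintegralD // IH2 /ssum big_ord_recr /=; congr (_ + _).
have i12 : mu.-integrable `]0%R, 1%R] (EFin \o
    (fun t => t `^ (alpha - 1 + N%:R) + t `^ (- alpha + N%:R))).
  by have h := integrableD mI i1 i2; apply: eq_integrable h.
have N0 := ler0n R N.
rewrite /k (RintegralZl _ mI i12) (RintegralD mI i1 i2) !Rintegral_powR01; [|lra..].
congr (_ * _).
by rewrite -natr1; congr (_^-1 + _^-1); ring.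
Qed.

(** The two sums contain the same fractions grouped differently: [ssum] pairs alpha + n with n + 1 -
    alpha, which leaves one unpaired term at the end. *)
Lemma csc_partialE N : csc_partial alpha N = ssum N + (-1) ^+ N / (alpha + N%:R).
Proof.
elim: N => [|N IH].
  by rewrite /csc_partial /ssum !big_ord0 expr0 mul1r !addr0 add0r.
rewrite /csc_partial /ssum !big_ord_recr /= in IH *.
have [k1 k2] := alpha_nat_neq0 alpha01 N.
rewrite addrA IH exprS -opprB invrN; ring.
Qed.

Let denom_cvg0 : ((-1) ^+ N / (alpha + N%:R)) @[N --> \oo] --> (0 : R).
Proof.
case/andP: alpha01 => a0 a1.
have hh : (alpha^-1 * @harmonic R n) @[n --> \oo] --> (0 : R).
  by rewrite -[X in _ --> X](mulr0 alpha^-1); apply: cvgMr; exact: cvg_harmonic.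
have hN : (- (alpha^-1 * @harmonic R n)) @[n --> \oo] --> (0 : R).
  by rewrite -[X in _ --> X]oppr0; apply: cvgN.
apply: (squeeze_cvgr _ hN hh); apply: nearW => n; rewrite -ler_norml.
rewrite normrM normrX normrN1 expr1n mul1r gtr0_norm ?invr_gt0 ?ltr_wpDr //.
rewrite /harmonic /= -invfM lef_pV2 ?posrE ?mulr_gt0 ?ltr_wpDr //.
by rewrite -natr1 mulrDr mulr1 addrC lerD2l ler_piMl // ltW.
Qed.

(** Expanding 1 / (1 + t) in a geometric series and integrating term by term yields the partial
    fractions. The partial sums are dominated by twice the weight; convergence of the integrals
    supplies the convergence assumed in [csc_series]. *)
Lemma integral_csc :
  (\int[mu]_(t in `]0%R, 1%R]) ((t `^ (alpha - 1) + t `^ (- alpha)) / (1 + t))%:E =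
   (pi / sin (alpha * pi))%:E)%E.
Proof.
case/andP: alpha01 => a0 a1.
have iw : mu.-integrable `]0%R, 1%R] (fun t => (wgt t)%:E).
  apply: (integrableD mI (integrable_powR01 _) (integrable_powR01 _)); lra.
have mw : measurable_fun [set: R] wgt by apply: measurable_funD; exact: measurable_powR.
have geom (N : nat) (t : R) : 0 < t -> psum N t = wgt t * (1 - (- t) ^+ N) / (1 + t).
  move=> t0; rewrite /psum; have t1 : 1 + t != 0 by rewrite gt_eqF // addr_gt0.
  have -> : 1 - (- t) ^+ N = (1 + t) * \sum_(n < N) (- t) ^+ n.
    by rewrite -opprB (subrX1 (- t) N) -mulNr; congr (_ * _); ring.
  by field.
have w0 t : 0 <= wgt t by rewrite addr_ge0 // powR_ge0.
have := @dominated_convergence _ (measurableTypeR R) R mu `]0%R, 1%R]%classic mI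
  (fun N t => (psum N t)%:E) (fun t => (wgt t / (1 + t))%:E) (fun t => 2%:E * (wgt t)%:E)%E.
case.
- by move=> N; apply: measurable_int (Rintegral_psum N).1.
- apply/measurable_EFinP.
  apply: (@eq_measurable_fun _ _ _ _ _ (fun t => wgt t * (1 + t) `^ (-1))).
    move=> t /set_mem; rewrite /= in_itv /= => /andP[t0 _].
    by rewrite powR_inv1 // addr_ge0 // ltW.
  apply/measurable_funTS/measurable_funM => //.
  apply: (measurableT_comp (measurable_powR _)); exact: measurable_funD.
(* At t = 1 the partial sums oscillate, so this point is discarded. *)
- apply: aeS (ae_neq 1) => t t1; rewrite /= in_itv /= => /andP[t0 tle1].
  have tlt1 : t < 1 by rewrite lt_neqAle t1.
  under eq_fun do rewrite geom //.
  apply: cvg_EFin; first exact: nearW.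
  have cz : ((- t) ^+ N) @[N --> \oo] --> (0 : R).
    by apply: cvg_expr; rewrite normrN gtr0_norm.
  have h : (wgt t * (1 - (- t) ^+ N) / (1 + t)) @[N --> \oo] --> wgt t * (1 - 0) / (1 + t).
    by apply: cvgMl; apply: cvgMr; apply: cvgB => //; exact: cvg_cst.
  rewrite subr0 mulr1 in h; exact: h.
- by have h := integrableZl mI (2 : R) iw; apply: eq_integrable h.
- apply: aeW => t N; rewrite /= in_itv /= => /andP[t0 tle1].
  rewrite -EFinM lee_fin geom // -mulrA normrM (ger0_norm (w0 t)) mulrC ler_wpM2r //.
  rewrite normrM normfV (gtr0_norm (_ : 0 < 1 + t)) ?addr_gt0 // ler_pdivrMr ?addr_gt0 //.
  rewrite (le_trans (ler_normB _ _)) // normr1 normrX normrN (gtr0_norm t0).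
  have := exprn_ile1 N (ltW t0) tle1; lra.
move=> iJ _ cv.
have finJ := integrable_fin_num mI iJ.
have cs : ssum @ \oo --> \int[mu]_(t in `]0%R, 1%R]) (wgt t / (1 + t)).
  have -> : ssum = (fun N => \int[mu]_(t in `]0%R, 1%R]) psum N t).
    by apply/funext => N; rewrite (Rintegral_psum N).2.
  by apply: fine_cvg; rewrite fineK.
have cc : csc_partial alpha @ \oo --> \int[mu]_(t in `]0%R, 1%R]) (wgt t / (1 + t)).
  have -> : csc_partial alpha = (fun N => ssum N + (-1) ^+ N / (alpha + N%:R)).
    by apply/funext => N; exact: csc_partialE.
  by rewrite -[X in _ --> X]addr0; apply: cvgD.
have := csc_series alpha01 cc.
have s0 : 0 < sin (alpha * pi).
  by apply: sin_gt0_pi; rewrite mulr_gt0 ?pi_gt0 //= gtr_pMl ?pi_gt0.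
move=> e; rewrite -(fineK finJ); congr EFin.
by apply: (mulfI (lt0r_neq0 s0)); rewrite mulrC in e; rewrite mulrC e mulrC divfK // gt_eqF.
Qed.

End cosecant_integral.

(** * Products of powers integrated over a triangle *)

Section triangle.
Context {R : realType}.
Notation mu := (@lebesgue_measure R).

Definition pw (a : R) (t : R) : \bar R := (if t \in `]0%R, +oo[%classic then t `^ a else 0)%:E.

Lemma nnmeas_pw a : nnmeas (pw a).
Proof.
apply: (@nnmeas_if_in R (@powR R ^~ a) `]0%R, +oo[%classic (measurable_itv _) (measurable_powR _)).
by move=> t; exact: powR_ge0.
Qed.

Lemma pw_gt0 a t : 0 < t -> pw a t = (t `^ a)%:E.
Proof. by move=> t0; rewrite /pw mem_setE in_itv /= t0. Qed.

Lemma pw_le0 a t : t <= 0 -> pw a t = 0%E.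
Proof. by move=> t0; rewrite /pw mem_setE in_itv /= ltNge t0. Qed.

(* The triangle u + t < 1, cut along its diagonal. *)
Definition tri (u t : R) : \bar R := (((u <= t) && (u + t < 1))%:R)%:E.

Lemma tri_ge0 u t : (0 <= tri u t)%E.
Proof. by rewrite lee_fin. Qed.

Lemma measurable_natr_bool (b : R * R -> bool) : measurable_fun [set: R * R] b ->
  measurable_fun [set: R * R] (fun z => (b z)%:R : R).
Proof.
move=> mb; have -> : (fun z => (b z)%:R : R) = (fun z => if b z then 1 else 0).
  by apply/funext => z; case: (b z).
exact: measurable_fun_ifT.
Qed.

Lemma measurable_tri : measurable_fun [set: R * R] (fun z => tri z.1 z.2).
Proof.
apply/measurable_EFinP.
apply: measurable_natr_bool; apply: measurable_and.
  exact: measurable_fun_ler.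
by apply: measurable_fun_ltr => //; exact: measurable_funD.
Qed.

Lemma nnmeas_tri1 t : nnmeas (fun u => tri u t).
Proof.
split; last by move=> u; exact: tri_ge0.
by apply: (measurableT_comp measurable_tri (measurable_pair2 t)).
Qed.

(* The scaling u = t w makes the inner integral independent of the exponents. *)
Lemma integral_tri (a b : R) : a + b = - 1 ->
  (\int[mu]_t (pw a t * \int[mu]_u (pw b u * tri u t)) =
   \int[mu]_(w in `]0%R, 1%R]) (w `^ b / (1 + w))%:E)%E.
Proof.
move=> ab.
pose K (z : R * R) : \bar R := (pw b z.1 * ((0 < z.2) && (z.1 <= 1) && (z.2 * z.1 + z.2 < 1))%:R%:E)%E.
have mK : measurable_fun [set: R * R] K.
  apply: emeasurable_funM.
    by apply: measurableT_comp (nnmeas_pw b).1 _.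
  apply/measurable_EFinP.
  apply: measurable_natr_bool; apply: measurable_and; first apply: measurable_and.
  - exact: measurable_fun_ltr.
  - exact: measurable_fun_ler.
  - by apply: measurable_fun_ltr => //; apply: measurable_funD => //; exact: measurable_funM.
have K0 z : (0 <= K z)%E by rewrite mule_ge0 ?(nnmeas_pw b).2 ?lee_fin.
transitivity (\int[mu]_t \int[mu]_w K (w, t))%E.
  apply: eq_integral => t _; have [t0|t0] := leP t 0.
    rewrite pw_le0 // mul0e; apply/esym/integral0_eq => w _.
    by rewrite /K /= ltNge t0 /= mule0.
  have [mm m0] := nnmeasM (nnmeas_pw b) (nnmeas_tri1 t).
  rewrite (ge0_integral_affine 0 t0 mm m0) pw_gt0 // muleA -EFinM.
  have [mm' m0'] : nnmeas (fun w => pw b (0 + t * w) * tri (0 + t * w) t)%E.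
    split; last by move=> w; exact: m0.
    exact: (measurableT_comp mm (measurable_affine 0 t)).
  rewrite -ge0_integralZl // ?lee_fin ?mulr_ge0 ?powR_ge0 ?ltW //.
  apply: eq_integral => w _; rewrite add0r /K /=.
  have [w0|w0] := leP w 0.
    by rewrite !pw_le0 ?mul0e ?mule0 // mulr_ge0_le0 // ltW.
  rewrite !pw_gt0 ?mulr_gt0 // /tri t0 /= ger_pMr // -!EFinM mulrA; congr (_ * _)%:E.
  (* The Jacobian t compensates for the total exponent a + b = -1. *)
  have tt : t `^ a * t * t `^ b = 1.
    transitivity (t `^ a * t `^ 1 * t `^ b); first by rewrite powRr1 // ltW.
    rewrite -!powRD ?(gt_eqF t0) ?implybT //.
    by rewrite addrAC ab addNr powRr0.
  by rewrite powRM ?ltW // mulrA tt mul1r.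
rewrite -(tonelliR mK K0) [RHS]integral_mkcond; apply: eq_integral => w _.
rewrite patchE mem_setE in_itv /= /K /=.
have [w0|w0] := leP w 0.
  by apply: integral0_eq => t _; rewrite pw_le0 // mul0e.
have [w1|w1] := leP w 1; last first.
  by apply: integral0_eq => t _; rewrite andbF /= mule0.
have w10 : 0 < 1 + w by rewrite addr_gt0.
(* For fixed w the condition u + t < 1 reads t < 1 / (1 + w); the length of this interval is the
   source of the denominator. *)
transitivity (\int[mu]_(t in `]0%R, ((1 + w)^-1)%R[) (cst (w `^ b)%:E t))%E.
  rewrite [RHS]integral_mkcond; apply: eq_integral => t _.
  rewrite patchE mem_setE in_itv /= andbT pw_gt0 //.
  have -> : (t * w + t < 1) = (t < (1 + w)^-1).
    by rewrite -[(1 + w)^-1]mul1r ltr_pdivlMr // mulrDr mulr1 addrC.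
  by case: ifP => _; rewrite ?mule1 ?mule0.
rewrite integral_cst // [X in (_ * X)%E](@lebesgue_measure_itv R `]0, (1 + w)^-1[) /= lte_fin invr_gt0 w10.
by rewrite sube0.
Qed.

Lemma measurable_swapR : measurable_fun [set: R * R] (fun z : R * R => (z.2, z.1)).
Proof. exact: measurable_fun_pair. Qed.

(** The other half of the triangle; with the strict inequality the two indicators add up exactly to
    that of u + t < 1. *)
Definition tri' (u t : R) : \bar R := (((t < u) && (u + t < 1))%:R)%:E.

Lemma tri'_ge0 u t : (0 <= tri' u t)%E.
Proof. by rewrite lee_fin. Qed.

Lemma measurable_tri' : measurable_fun [set: R * R] (fun z => tri' z.1 z.2).
Proof.
apply/measurable_EFinP; apply: measurable_natr_bool; apply: measurable_and.
  exact: measurable_fun_ltr.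
by apply: measurable_fun_ltr => //; exact: measurable_funD.
Qed.

Lemma nnmeas_tri'1 t : nnmeas (fun u => tri' u t).
Proof.
split; last by move=> u; exact: tri'_ge0.
by apply: (measurableT_comp measurable_tri' (measurable_pair2 t)).
Qed.

Lemma nnmeas_tri'2 u : nnmeas (tri' u).
Proof.
split; last by move=> t; exact: tri'_ge0.
by apply: (measurableT_comp measurable_tri' (measurable_pair1 u)).
Qed.

(** Exchanging u and t reduces to the first half with the exponents interchanged; the halves then
    differ only on the diagonal, a null set for each fixed u. *)
Lemma integral_tri' (a b : R) : a + b = - 1 ->
  (\int[mu]_t (pw a t * \int[mu]_u (pw b u * tri' u t)) =
   \int[mu]_(w in `]0%R, 1%R]) (w `^ a / (1 + w))%:E)%E.
Proof.
move=> ab; rewrite -(@integral_tri b a); last by rewrite addrC.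
pose K (z : R * R) : \bar R := (pw a z.1 * (pw b z.2 * tri' z.2 z.1))%E.
have mK : measurable_fun [set: R * R] K.
  apply: emeasurable_funM; first by apply: measurableT_comp (nnmeas_pw a).1 _.
  apply: emeasurable_funM; first by apply: measurableT_comp (nnmeas_pw b).1 _.
  apply: (measurableT_comp measurable_tri' measurable_swapR).
have K0 z : (0 <= K z)%E by rewrite !mule_ge0 ?(nnmeas_pw _).2 ?tri'_ge0.
transitivity (\int[mu]_t \int[mu]_u K (t, u))%E.
  apply: eq_integral => t _; rewrite /K /= ge0_integralZl //.
  - by case: (nnmeasM (nnmeas_pw b) (nnmeas_tri'1 t)).
  - by move=> u _; rewrite mule_ge0 ?(nnmeas_pw b).2 ?tri'_ge0.
  - exact: (nnmeas_pw a).2.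
rewrite (tonelliR mK K0); apply: eq_integral => u _; rewrite /K /=.
rewrite -ge0_integralZl //; first last.
- exact: (nnmeas_pw b).2.
- by move=> t _; rewrite mule_ge0 ?(nnmeas_pw a).2 ?tri_ge0.
- by case: (nnmeasM (nnmeas_pw a) (nnmeas_tri1 u)).
have n1 : nnmeas (fun t => pw a t * (pw b u * tri' u t))%E.
  apply: nnmeasM (nnmeas_pw a) _; apply: nnmeasM (nnmeas_tri'2 u).
  by split => // t; exact: (nnmeas_pw b).2.
have n2 : nnmeas (fun t => pw b u * (pw a t * tri t u))%E.
  apply: nnmeasM; first by split => // t; exact: (nnmeas_pw b).2.
  exact: nnmeasM (nnmeas_pw a) (nnmeas_tri1 u).
apply: ge0_ae_eq_integral => //; [exact: n1.1|exact: n2.1|by move=> t _; exact: n1.2|by move=> t _; exact: n2.2|].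
apply: aeS (ae_neq u) => t tu _.
by rewrite muleCA /tri /tri' le_eqVlt (negbTE tu) /= (addrC t).
Qed.

End triangle.

(** * The constant in the initial condition *)

Section leading_coefficient.
Context {R : realType} (alpha : R).
Hypothesis alpha01 : 0 < alpha < 1.
Notation mu := (@lebesgue_measure R).

(** r * (F * H) at the point 1 is computed in two ways. By the renewal equation it is (H * H)(1) =
    1; directly it is C times the integral of u^(alpha - 1) t^(-alpha) over the triangle u + t < 1.
    The extra convolution with H makes evaluation at a point legitimate. *)
Lemma leading_coefficient (F : R -> \bar R) (C : R) : nnmeas F -> causal F ->
  ae_eq mu setT (econv F (rker alpha)) heav -> 0 <= C ->
  (forall x, 0 < x < 1 -> F x = (C * x `^ (alpha - 1))%:E) ->
  C = sin (alpha * pi) / pi.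
Proof.
move=> nF cF Fr C0 FC.
have nH := @nnmeas_heav R; have nr := nnmeas_rker alpha.
have nFr := nnmeas_econv nF nr.
have one : (econv (rker alpha) (econv F heav) 1 = 1)%E.
  rewrite (econvC nF nH) (econvCA nr nH nF) (econvC nr nF) (eq_econv_aer nFr nH nH Fr).
  by rewrite -xmul_heav /xmul /heav ltr01 max_l ?ler01 // mule1.
pose p := pw (alpha - 1); pose r := pw (- alpha).
have np : nnmeas p := nnmeas_pw _; have nr' : nnmeas r := nnmeas_pw _.
pose T1 t := (\int[mu]_u (p u * tri u t))%E.
pose T2 t := (\int[mu]_u (p u * tri' u t))%E.
have nT1 : nnmeas T1.
  split; last by move=> t; apply: integral_ge0 => u _; rewrite mule_ge0 ?np.2 ?tri_ge0.
  have mk : measurable_fun [set: R * R] (fun z => p z.2 * tri z.2 z.1)%E.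
    apply: emeasurable_funM; first by apply: measurableT_comp np.1 _.
    exact: (measurableT_comp (@measurable_tri R) (@measurable_swapR R)).
  apply: (measurable_fubiniR mk) => z; rewrite mule_ge0 ?np.2 //.
  exact: tri_ge0.
have nT2 : nnmeas T2.
  split; last by move=> t; apply: integral_ge0 => u _; rewrite mule_ge0 ?np.2 ?tri'_ge0.
  have mk : measurable_fun [set: R * R] (fun z => p z.2 * tri' z.2 z.1)%E.
    apply: emeasurable_funM; first by apply: measurableT_comp np.1 _.
    exact: (measurableT_comp (@measurable_tri' R) (@measurable_swapR R)).
  apply: (measurable_fubiniR mk) => z; rewrite mule_ge0 ?np.2 //.
  exact: tri'_ge0.
(* Only 0 < u < 1 - t contributes, and there F is the explicit power. *)
have inner t : 0 < t -> (econv F heav (1 - t) = C%:E * (T1 t + T2 t))%E.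
  move=> t0.
  have [m1 g1] := nnmeasM np (nnmeas_tri1 t); have [m2 g2] := nnmeasM np (nnmeas_tri'1 t).
  rewrite /T1 /T2 -(ge0_integralD mu measurableT (fun u _ => g1 u) m1 (fun u _ => g2 u) m2).
  rewrite -ge0_integralZl //; first last.
  - by move=> u _; rewrite adde_ge0 ?g1 ?g2.
  - exact: emeasurable_funD.
  apply: eq_integral => u _; have [u0|u0] := leP u 0.
    by rewrite cF // /p pw_le0 // !mul0e adde0 mule0.
  rewrite /heav subr_gt0 /tri /tri'.
  have -> : (u < 1 - t) = (u + t < 1) by rewrite ltrBrDr.
  have [ut|ut] := ltP (u + t) 1; last by rewrite !andbF !mule0 adde0 mule0.
  have u1 : u < 1 by apply: le_lt_trans ut; rewrite lerDl ltW.
  rewrite FC ?u0 // /p pw_gt0 // !andbT.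
  by case: (leP u t) => _; rewrite ?mule1 ?mule0 ?adde0 ?add0e -?EFinM.
have : (econv (rker alpha) (econv F heav) 1 = C%:E * (pi / sin (alpha * pi))%:E)%E.
  transitivity (\int[mu]_t (C%:E * (r t * T1 t + r t * T2 t)))%E.
    apply: eq_integral => t _; have [t0|t0] := leP t 0.
      by rewrite causal_rker // /r pw_le0 // !mul0e adde0 mule0.
    have [t1|t1] := ltP t 1.
      rewrite inner // /r pw_gt0 // /rker /hfun /hker mem_setE in_itv /= t0 (ltW t1) /=.
      rewrite /heav1 causal_heav ?subr_le0 ?(ltW t1) // adde0 muleCA.
      by rewrite ge0_muleDr ?nT1.2 ?nT2.2.
    have e0 : (econv F heav (1 - t) = 0)%E.
      by apply: (causal_econv cF (@causal_heav R)); rewrite subr_le0.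
    have T10 : T1 t = 0%E.
      apply: integral0_eq => u _; have [u0|u0] := leP u 0; first by rewrite /p pw_le0 // mul0e.
      rewrite /tri; have -> : (u + t < 1) = false by apply/negbTE; rewrite -leNgt (le_trans t1) // lerDr ltW.
      by rewrite andbF mule0.
    have T20 : T2 t = 0%E.
      apply: integral0_eq => u _; have [u0|u0] := leP u 0; first by rewrite /p pw_le0 // mul0e.
      rewrite /tri'; have -> : (u + t < 1) = false by apply/negbTE; rewrite -leNgt (le_trans t1) // lerDr ltW.
      by rewrite andbF mule0.
    by rewrite e0 T10 T20 !mule0 adde0 mule0.
  have [m1 g1] := nnmeasM nr' nT1; have [m2 g2] := nnmeasM nr' nT2.
  rewrite ge0_integralZl //; last first.
  - by move=> t _; rewrite adde_ge0 ?g1 ?g2.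
  - exact: emeasurable_funD.
  rewrite (ge0_integralD mu measurableT (fun t _ => g1 t) m1 (fun t _ => g2 t) m2).
  have ab : - alpha + (alpha - 1) = -1 by ring.
  rewrite (integral_tri ab) (integral_tri' ab) -(integral_csc alpha01); congr (_ * _)%E.
  have md (q : R) : measurable_fun (`](0 : R), (1 : R)]%classic : set R) (fun w : R => (w `^ q / (1 + w))%:E).
    apply/measurable_EFinP.
    apply: (@eq_measurable_fun _ _ _ _ _ (fun t => t `^ q * (1 + t) `^ (-1))).
      move=> t /set_mem; rewrite /= in_itv /= => /andP[t0 _].
      by rewrite powR_inv1 // addr_ge0 // ltW.
    apply/measurable_funTS/measurable_funM; first exact: measurable_powR.
    by apply: (measurableT_comp (measurable_powR _)); exact: measurable_funD.
  have pos (q w : R) : (`](0 : R), (1 : R)]%classic : set R) w -> (0 <= (w `^ q / (1 + w))%:E)%E.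
    rewrite /= in_itv /= => /andP[w0 _].
    by rewrite lee_fin divr_ge0 ?powR_ge0 // addr_ge0 // ltW.
  rewrite -(ge0_integralD mu (measurable_itv _) (pos _) (md _) (pos _) (md _)).
  by apply: eq_integral => w _; rewrite -EFinD mulrDl.
rewrite one -EFinM => -[e].
have s0 : 0 < sin (alpha * pi).
  case/andP: alpha01 => a0 a1.
  by apply: sin_gt0_pi; rewrite mulr_gt0 ?pi_gt0 //= gtr_pMl ?pi_gt0.
have alg (s q : R) : 0 < s -> 0 < q -> 1 = C * (q / s) -> C = s / q.
  move=> sp qp h; transitivity (C * (q / s) * (s / q)); last by rewrite -h mul1r.
  by field; rewrite (gt_eqF sp) (gt_eqF qp).
by apply: alg => //; exact: pi_gt0.
Qed.

End leading_coefficient.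

(** * The complex series split into real series *)

Section complex_limits.
Local Open Scope complex_scope.
Context {R : realType}.

Lemma hausdorffC : hausdorff_space (R[i])^o.
Proof. exact: norm_hausdorff. Qed.

Lemma cvg_complex (u v : nat -> R) (a b : R) : u @ \oo --> a -> v @ \oo --> b ->
  (fun n => (u n +i* v n : (R[i])^o)) @ \oo --> (a +i* b : (R[i])^o).
Proof.
move=> ua vb; apply/cvgrPdist_lt => e e0.
(* In the order of the complex numbers, 0 < e forces e to be real. *)
have [e1 ee] : 0 < complex.Re e /\ e = (complex.Re e)%:C.
  by case: e e0 => x y /=; rewrite ltcE /= => /andP[/eqP -> ->].
have h0 : 0 < complex.Re e / 2 by rewrite divr_gt0.
move/cvgrPdist_lt : ua => /(_ _ h0) ua; move/cvgrPdist_lt : vb => /(_ _ h0) vb.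
near=> n.
rewrite ee (_ : a +i* b - (u n +i* v n) = (a - u n) +i* (b - v n)) //.
rewrite normc_def /= ltcR.
have h1 : `|a - u n| < complex.Re e / 2 by near: n.
have h2 : `|b - v n| < complex.Re e / 2 by near: n.
rewrite (@le_lt_trans _ _ (`|a - u n| + `|b - v n|)) //; last by lra.
rewrite -[leRHS]ger0_norm ?addr_ge0 // -sqrtr_sqr ler_wsqrtr //.
have sq (x : R) : x ^+ 2 = `|x| ^+ 2 by rewrite real_normK ?num_real.
rewrite (sq (a - u n)) (sq (b - v n)) sqrrD addrAC lerDl.
by rewrite mulrn_wge0 // mulr_ge0.
Unshelve. all: by end_near. Qed.

(** Identifies the terms with the Taylor coefficients of cosine and sine, so that all questions of
    convergence become real ones. *)
Lemma i_pow_fact (s : R) n :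
  (('i%C * s%:C) ^+ n / n`!%:R : R[i]) = cos_coeff s n +i* sin_coeff s n.
Proof.
have ip : ('i%C : R[i]) ^+ n = ((~~ odd n)%:R * (-1) ^+ n./2) +i* ((odd n)%:R * (-1) ^+ n.-1./2).
  rewrite -{1}(odd_double_half n) exprD -mul2n exprM sqr_i.
  have -> : (-1 : R[i]) ^+ n./2 = ((-1) ^+ n./2)%:C by rewrite rmorphXn rmorphN rmorph1.
  case on : (odd n); last by rewrite expr0 mul1r !mul0r !mul1r.
  rewrite expr1 !mul1r !mul0r.
  have -> : n.-1./2 = n./2 by rewrite -{1}(odd_double_half n) on /= doubleK.
  by apply/eqP; rewrite eq_complex /= !(mul0r, mulr0, mul1r, add0r, addr0) oppr0 !eqxx.
have nf : (n`!%:R : R[i]) = (n`!%:R)%:C by rewrite rmorph_nat.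
rewrite exprMn ip -rmorphXn nf -fmorphV -mulrA -rmorphM.
by apply/eqP; rewrite eq_complex /cos_coeff /sin_coeff /= !mulr0 subr0 add0r !mulrA !eqxx.
Qed.

Lemma dm_term (alpha s : R) n :
  alpha%:C / (n%:R - alpha%:C) * (('i%C * s%:C) ^+ n / n`!%:R) =
  (alpha / (n%:R - alpha) * cos_coeff s n) +i* (alpha / (n%:R - alpha) * sin_coeff s n) :> R[i].
Proof.
rewrite i_pow_fact.
have -> : alpha%:C / (n%:R - alpha%:C) = (alpha / (n%:R - alpha))%:C :> R[i].
  by rewrite rmorphM fmorphV rmorphB rmorph_nat.
by apply/eqP; rewrite eq_complex /= !mul0r subr0 addr0 !eqxx.
Qed.

Lemma dm_charfun_of_cvg (alpha s a b : R) :
  (\sum_(1 <= n < N) alpha / (n%:R - alpha) * cos_coeff s n) @[N --> \oo] --> a ->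
  (\sum_(1 <= n < N) alpha / (n%:R - alpha) * sin_coeff s n) @[N --> \oo] --> b ->
  dm_charfun alpha s = ((1 - a) +i* (- b))^-1.
Proof.
move=> ca cb; rewrite /dm_charfun.
have -> : (fun N => \sum_(1 <= n < N)
     (alpha%:C / (n%:R - alpha%:C) * (('i%C * s%:C) ^+ n / n`!%:R) : (R[i])^o)) =
  (fun N => ((\sum_(1 <= n < N) alpha / (n%:R - alpha) * cos_coeff s n) +i*
             (\sum_(1 <= n < N) alpha / (n%:R - alpha) * sin_coeff s n) : (R[i])^o)).
  apply/funext => N; under eq_bigr do rewrite dm_term.
  elim/big_rec3 : _ => [//|n x y z _ ->].
  by apply/eqP; rewrite eq_complex /= !eqxx.
rewrite (cvg_lim hausdorffC (cvg_complex ca cb)); congr (_^-1).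
by apply/eqP; rewrite eq_complex /= sub0r !eqxx.
Qed.

End complex_limits.

(** * Summation of the series for the characteristic function *)

Section termwise_integration.
Context {R : realType} (alpha : R).
Hypothesis alpha01 : 0 < alpha < 1.
Notation mu := (@lebesgue_measure R).

Let mI : measurable (`]0%R, 1%R]%classic : set (measurableTypeR R)).
Proof. exact: measurable_itv. Qed.

(** The denominators arise as integrals of t^(n - alpha) over ]0, 1]. On that interval the partial
    sums of the power series are bounded by M, so M t^(-alpha) dominates. *)
Lemma cvg_termwise (c : nat -> R) (p : R -> R) (M : R) :
  (forall N, \sum_(n < N) `|c n| <= M) ->
  (forall t, 0 < t -> (\sum_(n < N) c n * t ^+ n) @[N --> \oo] --> p t) ->
  (\sum_(n < N) c n / (n.+1%:R - alpha)) @[N --> \oo] -->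
    \int[mu]_(t in `]0%R, 1%R]) (t `^ (- alpha) * p t).
Proof.
case/andP: alpha01 => a0 a1 cM cp.
pose ps (N : nat) (t : R) := t `^ (- alpha) * \sum_(n < N) c n * t ^+ n.
have M0 : 0 <= M by have := cM 0%N; rewrite big_ord0.
have ips N : mu.-integrable `]0%R, 1%R] (EFin \o ps N) /\
    \int[mu]_(t in `]0%R, 1%R]) ps N t = \sum_(n < N) c n / (n.+1%:R - alpha).
  elim: N => [|N [IH1 IH2]].
    have -> : ps 0%N = cst 0 by apply/funext => t; rewrite /ps big_ord0 mulr0.
    by split; [exact: integrable0|rewrite big_ord0 Rintegral_cst // mul0r].
  pose k (t : R) : R := c N * t `^ (N%:R - alpha).
  have N0 := ler0n R N.
  have i1 : mu.-integrable `]0%R, 1%R] (fun t => (t `^ (N%:R - alpha))%:E).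
    by apply: integrable_powR01; lra.
  have ik : mu.-integrable `]0%R, 1%R] (EFin \o k).
    have h := integrableZl mI (c N) i1.
    by apply: eq_integrable h.
  have e t : `]0, 1]%classic t -> ps N.+1 t = ps N t + k t.
    rewrite /= in_itv /= => /andP[t0 _].
    rewrite /ps big_ord_recr /= mulrDr /k addrC [N%:R - _]addrC addrC; congr (_ + _).
    by rewrite powRD ?(gt_eqF t0) ?implybT // powR_mulrn ?ltW //; ring.
  split.
    have h := integrableD mI IH1 ik.
    by apply: eq_integrable h => // t /set_mem t01; rewrite /= e.
  rewrite (@eq_Rintegral _ _ _ mu _ (fun t => ps N t + k t)); last by move=> t /set_mem; exact: e.
  rewrite RintegralD // IH2 big_ord_recr /=; congr (_ + _).
  rewrite /k (RintegralZl _ mI i1) Rintegral_powR01; last by lra.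
  by congr (_ / _); rewrite -natr1; ring.
have i0 : mu.-integrable `]0%R, 1%R] (fun t => (t `^ (- alpha))%:E).
  by apply: integrable_powR01; lra.
have psp t : 0 < t -> ps N t @[N --> \oo] --> t `^ (- alpha) * p t.
  by move=> t0; apply: cvgMr; exact: cp.
have := @dominated_convergence _ (measurableTypeR R) R mu `]0%R, 1%R]%classic mI
  (fun N t => (ps N t)%:E) (fun t => (t `^ (- alpha) * p t)%:E)
  (fun t => M%:E * (t `^ (- alpha))%:E)%E.
case.
- by move=> N; apply: measurable_int (ips N).1.
- apply/measurable_EFinP.
  apply: (@measurable_fun_cvg _ _ R _ ps).
    by move=> N; apply/measurable_EFinP; apply: measurable_int (ips N).1.
  by move=> t; rewrite /= in_itv /= => /andP[t0 _]; exact: psp.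
- apply: aeW => t; rewrite /= in_itv /= => /andP[t0 _].
  apply: cvg_EFin; first exact: nearW.
  exact: psp.
- by have h := integrableZl mI M i0; apply: eq_integrable h.
- apply: aeW => t N; rewrite /= in_itv /= => /andP[t0 tle1].
  rewrite -EFinM lee_fin normrM ger0_norm ?powR_ge0 // mulrC ler_wpM2r ?powR_ge0 //.
  rewrite (le_trans _ (cM N)) // (le_trans (ler_norm_sum _ _ _)) //.
  apply: ler_sum => n _; rewrite normrM ler_piMr // normrX (gtr0_norm t0).
  by rewrite exprn_ile1 // ltW.
move=> iJ _ cv.
have finJ := integrable_fin_num mI iJ.
have -> : (fun N => \sum_(n < N) c n / (n.+1%:R - alpha)) =
    (fun N => \int[mu]_(t in `]0%R, 1%R]) ps N t).
  by apply/funext => N; rewrite (ips N).2.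
by apply: fine_cvg; rewrite fineK.
Qed.

Let shiftS (u : nat -> R) (l : R) : u N.+1 @[N --> \oo] --> l <-> u @ \oo --> l.
Proof. by rewrite -[X in _ <-> X]cvg_shiftS. Qed.

Lemma cos_coeffS (s : R) n : n.+1%:R * cos_coeff s n.+1 = - s * sin_coeff s n.
Proof.
rewrite /cos_coeff /sin_coeff /= negbK factS natrM exprS.
case on : (odd n); last by rewrite !mul0r !mulr0.
have f0 : n`!%:R != 0 :> R by rewrite pnatr_eq0 -lt0n fact_gt0.
have -> : uphalf n = n.-1./2.+1.
  by rewrite uphalf_half -[in n.-1](odd_double_half n) on /= doubleK.
have n0 : n.+1%:R != 0 :> R by rewrite pnatr_eq0.
by rewrite -!exprnP exprS; field; rewrite f0 addrC natr1 n0.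
Qed.

Lemma sin_coeffS (s : R) n : n.+1%:R * sin_coeff s n.+1 = s * cos_coeff s n.
Proof.
rewrite /cos_coeff /sin_coeff /= factS natrM exprS.
have f0 : n`!%:R != 0 :> R by rewrite pnatr_eq0 -lt0n fact_gt0.
have n0 : n.+1%:R != 0 :> R by rewrite pnatr_eq0.
rewrite -?exprnP; move: ((-1) ^+ n./2) (n.+1%:R : R) (n`!%:R : R) n0 f0 => z m f m0 f0; field; exact/andP.
Qed.

Lemma norm_cos_coeff (s : R) n : `|cos_coeff s n| <= exp_coeff `|s| n.
Proof.
rewrite /cos_coeff /exp_coeff /= !normrM normrX normrN1 expr1n mulr1 normrX normfV normr_nat.
rewrite (ger0_norm (ler0n _ n`!)) -mulrA ler_piMl ?divr_ge0 ?exprn_ge0 //.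
by case: (odd n).
Qed.

Lemma norm_sin_coeff (s : R) n : `|sin_coeff s n| <= exp_coeff `|s| n.
Proof.
rewrite /sin_coeff /exp_coeff /= !normrM normrX normrN1 expr1n mulr1 normrX normfV normr_nat.
rewrite (ger0_norm (ler0n _ n`!)) -mulrA ler_piMl ?divr_ge0 ?exprn_ge0 //.
by case: (odd n).
Qed.

Lemma exp_coeff_sum (s : R) N : 0 <= s -> \sum_(n < N) exp_coeff s n <= expR s.
Proof.
move=> s0; rewrite -(big_mkord xpredT (exp_coeff s)).
apply: (@nondecreasing_cvgn_le _ (series (exp_coeff s))); last exact: is_cvg_series_exp_coeff.
by apply: nondecreasing_series => n _ _; exact: exp_coeff_ge0.
Qed.

Lemma cvg_cos_series (s : R) : (\sum_(n < N) cos_coeff s n) @[N --> \oo] --> cos s.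
Proof.
have -> : (fun N => \sum_(n < N) cos_coeff s n) = series (cos_coeff s).
  by apply/funext => N; rewrite /series /= big_mkord.
by rewrite cos.unlock; exact: is_cvg_series_cos_coeff.
Qed.

Lemma cvg_sin_series (s : R) : (\sum_(n < N) sin_coeff s n) @[N --> \oo] --> sin s.
Proof.
have -> : (fun N => \sum_(n < N) sin_coeff s n) = series (sin_coeff s).
  by apply/funext => N; rewrite /series /= big_mkord.
by rewrite sin.unlock; exact: is_cvg_series_sin_coeff.
Qed.

Lemma cos_coeff0 (s : R) : cos_coeff s 0 = 1.
Proof. by rewrite /cos_coeff /= -exprnP !expr0 fact0 !mulr1 divr1. Qed.

Lemma sin_coeff0 (s : R) : sin_coeff s 0 = 0.
Proof. by rewrite /sin_coeff /= !mul0r. Qed.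

Lemma cos_coeffM (s t : R) n : cos_coeff (s * t) n = cos_coeff s n * t ^+ n.
Proof. by rewrite /cos_coeff /= -?exprnP exprMn; ring. Qed.

Lemma sin_coeffM (s t : R) n : sin_coeff (s * t) n = sin_coeff s n * t ^+ n.
Proof. by rewrite /sin_coeff /= -?exprnP exprMn; ring. Qed.

(** [Cs] and [Ss] are the parts of the Fourier integral of t^(-alpha) over ]0, 1]; [Ks], with its
    nonnegative integrand, serves to bound the denominator from below. *)
Let Cs (s : R) := \int[mu]_(t in `]0%R, 1%R]) (t `^ (- alpha) * cos (s * t)).
Let Ss (s : R) := \int[mu]_(t in `]0%R, 1%R]) (t `^ (- alpha) * sin (s * t)).
Let Ks (s : R) := \int[mu]_(t in `]0%R, 1%R]) (t `^ (- alpha) * ((1 - cos (s * t)) / t)).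

Let cvgC s : (\sum_(n < N) cos_coeff s n / (n.+1%:R - alpha)) @[N --> \oo] --> Cs s.
Proof.
apply: (@cvg_termwise _ _ (expR `|s|)).
  move=> N; apply: le_trans (exp_coeff_sum N (normr_ge0 s)).
  by apply: ler_sum => n _; exact: norm_cos_coeff.
move=> t t0; under eq_fun do under eq_bigr do rewrite -cos_coeffM.
exact: cvg_cos_series.
Qed.

Let cvgS s : (\sum_(n < N) sin_coeff s n / (n.+1%:R - alpha)) @[N --> \oo] --> Ss s.
Proof.
apply: (@cvg_termwise _ _ (expR `|s|)).
  move=> N; apply: le_trans (exp_coeff_sum N (normr_ge0 s)).
  by apply: ler_sum => n _; exact: norm_sin_coeff.
move=> t t0; under eq_fun do under eq_bigr do rewrite -sin_coeffM.
exact: cvg_sin_series.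
Qed.

Let cvgK s : (\sum_(n < N) - cos_coeff s n.+1 / (n.+1%:R - alpha)) @[N --> \oo] --> Ks s.
Proof.
apply: (@cvg_termwise (fun n => - cos_coeff s n.+1)
  (fun t => (1 - cos (s * t)) / t) (expR `|s|)).
  move=> N; apply: le_trans (exp_coeff_sum N.+1 (normr_ge0 s)).
  rewrite big_ord_recl -[leLHS]add0r lerD ?exp_coeff_ge0 //.
  by apply: ler_sum => n _; rewrite normrN; exact: norm_cos_coeff.
move=> t t0.
have -> : (fun N => \sum_(n < N) - cos_coeff s n.+1 * t ^+ n) =
  (fun N => (1 - \sum_(n < N.+1) cos_coeff (s * t) n) / t).
  apply/funext => N; rewrite big_ord_recl cos_coeff0 opprD addNKr.
  rewrite -sumrN mulr_suml; apply: eq_bigr => n _.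
  by rewrite cos_coeffM /= /bump /= add1n exprS; field; rewrite gt_eqF.
apply: cvgMl; apply: cvgB; first exact: cvg_cst.
by apply/(shiftS (fun N => \sum_(n < N) cos_coeff (s * t) n)); exact: cvg_cos_series.
Qed.

(** Write alpha / (n - alpha) = n / (n - alpha) - 1. The -1 contributes 1 - cos s, and n times the
    n-th cosine coefficient is -s times the preceding sine coefficient, which leaves -s [Ss s]. *)
Lemma cvg_dm_cos s :
  (\sum_(1 <= n < N) alpha / (n%:R - alpha) * cos_coeff s n) @[N --> \oo] --> 1 - cos s - s * Ss s.
Proof.
apply/shiftS.
have -> : (fun N => \sum_(1 <= n < N.+1) alpha / (n%:R - alpha) * cos_coeff s n) =
  (fun N => 1 - \sum_(n < N.+1) cos_coeff s n - s * \sum_(n < N) sin_coeff s n / (n.+1%:R - alpha)).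
  apply/funext => N; rewrite big_add1 /= big_mkord big_ord_recl cos_coeff0.
  rewrite opprD addrA subrr sub0r mulr_sumr -opprD -big_split -sumrN /=.
  apply: eq_bigr => n _; have n0 : n.+1%:R - alpha != 0.
    by rewrite gt_eqF // subr_gt0 -natr1; have := ler0n R n; case/andP: alpha01; lra.
  have := cos_coeffS s n; rewrite /bump /= add1n; move: (n.+1%:R : R) n0 => m n0 e.
  have -> : s * (sin_coeff s n / (m - alpha)) = - (m * cos_coeff s n.+1) / (m - alpha).
    by rewrite e; field.
  by field.
by apply: cvgB; [apply: cvgB; [exact: cvg_cst|apply/(shiftS (fun N => \sum_(n < N) cos_coeff s n)); exact: cvg_cos_series]|apply: cvgMr].
Qed.

Lemma cvg_dm_sin s :
  (\sum_(1 <= n < N) alpha / (n%:R - alpha) * sin_coeff s n) @[N --> \oo] --> s * Cs s - sin s.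
Proof.
apply/shiftS.
have -> : (fun N => \sum_(1 <= n < N.+1) alpha / (n%:R - alpha) * sin_coeff s n) =
  (fun N => s * \sum_(n < N) cos_coeff s n / (n.+1%:R - alpha) - \sum_(n < N.+1) sin_coeff s n).
  apply/funext => N; rewrite big_add1 /= big_mkord big_ord_recl sin_coeff0 add0r.
  rewrite mulr_sumr -sumrN -big_split /=.
  apply: eq_bigr => n _; have n0 : n.+1%:R - alpha != 0.
    by rewrite gt_eqF // subr_gt0 -natr1; have := ler0n R n; case/andP: alpha01; lra.
  have := sin_coeffS s n; rewrite /bump /= add1n; move: (n.+1%:R : R) n0 => m n0 e.
  have -> : s * (cos_coeff s n / (m - alpha)) = m * sin_coeff s n.+1 / (m - alpha).
    by rewrite e; field.
  by field.
by apply: cvgB; [apply: cvgMr|apply/(shiftS (fun N => \sum_(n < N) sin_coeff s n)); exact: cvg_sin_series].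
Qed.

(** Summed without that splitting, the same series is -alpha [Ks s]; hence the real part of the
    denominator is 1 + alpha [Ks s], and the denominator never vanishes. *)
Lemma dm_denominator_ge1 s : 1 <= cos s + s * Ss s.
Proof.
have h : 1 - cos s - s * Ss s = - alpha * Ks s.
  apply: (cvg_unique (@Rhausdorff R) (@cvg_dm_cos s)).
  apply/shiftS.
  have -> : (fun N => \sum_(1 <= n < N.+1) alpha / (n%:R - alpha) * cos_coeff s n) =
    (fun N => - alpha * \sum_(n < N) - cos_coeff s n.+1 / (n.+1%:R - alpha)).
    by apply/funext => N; rewrite big_add1 /= big_mkord mulr_sumr; apply: eq_bigr => n _; ring.
  by apply: cvgMr.
have k0 : 0 <= Ks s.
  apply: Rintegral_ge0 => t; rewrite /= in_itv /= => /andP[t0 _].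
  by rewrite mulr_ge0 ?powR_ge0 // divr_ge0 ?(ltW t0) // subr_ge0 cos_le1.
by case/andP: alpha01 => a0 _; have := mulr_ge0 (ltW a0) k0; lra.
Qed.

End termwise_integration.

(** * The reciprocal of the characteristic function in real terms *)

Section characteristic_function_equations.
Local Open Scope complex_scope.
Context {R : realType} (alpha : R).
Hypothesis alpha01 : 0 < alpha < 1.
Notation mu := (@lebesgue_measure R).

Let Rintegral_hker (k : R -> R) :
  \int[mu]_x (hker alpha x * k x) = \int[mu]_(t in `]0%R, 1%R]) (t `^ (- alpha) * k t).
Proof.
rewrite /Rintegral [in RHS]integral_mkcond; congr fine; apply: eq_integral => t _.
by rewrite patchE /hker; case: ifP => // _; rewrite mul0r.
Qed.

(** The denominator has real part at least 1, so the inverse can be cleared; the product equal to 1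
    is then separated into real and imaginary parts. *)
Lemma dm_charfun_equations (s A B : R) : A +i* B = dm_charfun alpha s ->
  exists C S, [/\ ft (hfun alpha) s (1 - alpha)^-1 C S,
    A * (cos s + s * S) - B * (sin s - s * C) = 1 &
    A * (sin s - s * C) + B * (cos s + s * S) = 0].
Proof.
rewrite (dm_charfun_of_cvg (cvg_dm_cos alpha01 (s := s)) (cvg_dm_sin alpha01 (s := s))) => e.
exists (\int[mu]_x (hker alpha x * cos (s * x))), (\int[mu]_x (hker alpha x * sin (s * x))).
have fth := ft_Rintegral s (integrable_hker alpha01).
have eh : \int[mu]_x hker alpha x = (1 - alpha)^-1 by rewrite /Rintegral integral_hfun.
rewrite eh in fth; split; first exact: fth.
all: rewrite (Rintegral_hker (fun x => cos (s * x))) (Rintegral_hker (fun x => sin (s * x))).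
all: have := dm_denominator_ge1 alpha01 s; move: e.
all: set C := \int[mu]_(t in _) (_ * cos _); set S := \int[mu]_(t in _) (_ * sin _) => e d1.
all: have D0 : (1 - (1 - cos s - s * S)) +i* - (s * C - sin s) != 0 by
  rewrite eq_complex /= negb_and; apply/orP; left; rewrite gt_eqF //; lra.
all: have : (A +i* B) * ((1 - (1 - cos s - s * S)) +i* - (s * C - sin s)) = 1 by
  rewrite e mulVf.
all: move/eqP; rewrite eq_complex /= => /andP[/eqP e1 /eqP e2].
- by rewrite -e1; ring.
- by rewrite -e2; ring.
Qed.

End characteristic_function_equations.

(** * Probability densities with respect to Lebesgue measure *)

Section densities.
Context {R : realType} (P : probability (measurableTypeR R) R).
Notation mu := (@lebesgue_measure R).
Local Open Scope ereal_scope.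

Section is_density.
Variable (f : R -> R).
Hypothesis Pf : is_density P f.

Lemma integral_density : \int[mu]_x (f x)%:E = 1.
Proof. by case: Pf => _ _ h; rewrite -(h setT measurableT) probability_setT. Qed.

Lemma integrable_density : mu.-integrable setT (EFin \o f).
Proof.
case: Pf => mf f0 h; apply/integrableP; split; first exact/measurable_EFinP.
under eq_integral => x _ do rewrite gee0_abs ?lee_fin //.
by rewrite integral_density ltry.
Qed.

(** The change of variables is that of the Radon-Nikodym derivative, which equals f almost
    everywhere since both have the same integral over every measurable set. *)
Lemma Rintegral_density (k : R -> R) : measurable_fun setT k ->
  (forall x, `|k x| <= 1)%R ->
  (\int[P]_x k x = \int[mu]_x (f x * k x))%R.
Proof.
case: Pf => mf f0 hf mk k1.
have Pmu : P `<< mu.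
  move=> N Nnull A mA AN; rewrite hf //.
  apply: null_set_integral => //; last exact: Nnull.
  exact/measurable_EFinP/measurable_funTS.
have ik : P.-integrable setT (EFin \o k).
  apply: (@le_integrable _ (measurableTypeR R) R P setT measurableT _ (cst 1)).
  - exact/measurable_EFinP.
  - by move=> x _; rewrite /= normr1 lee_fin.
  - exact: finite_measure_integrable_cst.
rewrite /Rintegral; congr fine.
rewrite -(Radon_Nikodym_change_of_variables Pmu measurableT ik).
apply: ae_eq_integral => //.
- apply: emeasurable_funM; first exact/measurable_EFinP.
  exact: measurable_int (Radon_Nikodym_integrable _).
- by apply/measurable_EFinP; exact: measurable_funM.
have e : ae_eq mu setT (Radon_Nikodym (charge_of_finite_measure P) mu) (EFin \o f).
  apply: integral_ae_eq => //.
  - exact: Radon_Nikodym_integrable.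
  - exact/measurable_EFinP.
  - by move=> E _ mE; rewrite -Radon_Nikodym_integral // -hf.
apply: aeS e => x h _; rewrite h // -EFinM mulrC //.
Qed.

End is_density.

(** As P gives no mass to the negative half-line, g vanishes almost everywhere there. The truncated
    density is [causal], which the convolution calculus requires at every point. *)
Lemma density_positive_part (g : R -> R) : is_density P g ->
  P [set x : R | 0 <= x]%R = 1 ->
  let f x := (if 0 < x then g x else 0)%R in
  is_density P f /\ {ae mu, forall x, f x = g x}.
Proof.
move=> [mg g0 hg] P0 f.
have mneg : measurable ([set x : R | x < 0]%R : set (measurableTypeR R)).
  by have := @measurable_itv R `]-oo, 0%R[; rewrite set_itvE.
have neg0 : P [set x : R | x < 0]%R = 0.
  have -> : [set x : R | x < 0]%R = ~` [set x : R | 0 <= x]%R.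
    by apply/seteqP; split => x /=; rewrite ltNge => /negP.
  rewrite probability_setC ?P0 ?subee //.
  have -> : [set x : R | 0 <= x]%R = `[0%R, +oo[%classic by rewrite set_itvE.
  exact: measurable_itv.
have aeneg : ae_eq mu [set x : R | x < 0]%R (EFin \o g) (cst 0).
  apply/ae_eq_integral_abs => //; first exact/measurable_EFinP/measurable_funTS.
  under eq_integral => x _ do rewrite /= ger0_norm //.
  by rewrite -hg.
have fg : {ae mu, forall x, f x = g x}.
  apply: aeS (aeI aeneg (ae_neq 0%R)) => x [h x0]; rewrite /f.
  by case: (ltgtP x 0%R) => [xn|//|xe]; [case: (h xn)|rewrite xe eqxx in x0].
have mf : measurable_fun setT f.
  have := (@nnmeas_if_in R g `]0%R, +oo[%classic (measurable_itv _) mg g0).1.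
  move/measurable_EFinP; congr measurable_fun; apply/funext => x.
  by rewrite /f mem_setE in_itv /= andbT.
split => //; split => //; first by move=> x; rewrite /f; case: ifP.
move=> A mA; rewrite hg //; apply: ae_eq_integral => //.
- exact/measurable_EFinP/measurable_funTS.
- exact/measurable_EFinP/measurable_funTS.
- by apply: aeS fg => x e _; rewrite e.
Qed.

End densities.

(** * Existence, and the theorem *)

Section existence.
Context {R : realType} (alpha : R).
Hypothesis alpha01 : 0 < alpha < 1.
Notation mu := (@lebesgue_measure R).

Lemma dm_solution_regver (f : R -> R) : nnmeas (EFin \o f) -> causal (EFin \o f) ->
  (\int[mu]_x (EFin \o f) x = 1)%E ->
  ae_eq mu setT (econv (EFin \o f) (rker alpha)) heav ->
  dm_solution alpha (regver alpha f).
Proof.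
move=> nF cF F1 Fr.
have nphi := nnmeas_regver alpha01 nF cF F1.
have phi_ge0 := regver_ge0 alpha01 nF cF F1.
have ode := regver_ode alpha01 nF cF F1 Fr.
have phi_le0 (x : R) : x <= 0 -> regver alpha f x = 0 by move=> x0; rewrite /regver ltNge x0.
split => //.
- by move=> x; exact: continuous_regver.
- move=> x x0 xint; apply: ode => //.
  by apply: contra xint => /eqP ->; exact: rpred1.
have [C HC] : exists C, forall x, 0 < x < 1 -> regver alpha f x = C * x `^ (alpha - 1).
  apply: (homogeneous_ode alpha01) => // x /andP[x0 x1].
  have [dphi ephi] := ode x x0 (negbT (lt_eqF x1)).
  by split => //; rewrite ephi /convolution ifF ?mulr0 // ltNge subr_le0 (ltW x1).
have C0 : 0 <= C.
  (* Any point of (0, 1) shows the sign of C. *)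
  have h2 : 0 < (2^-1 : R) < 1 by apply/andP; split; lra.
  by have := phi_ge0 2^-1; rewrite HC // pmulr_lge0 // powR_gt0 //; lra.
have Fr' : ae_eq mu setT (econv (EFin \o regver alpha f) (rker alpha)) heav.
  rewrite (eq_econv_ael nphi nF (nnmeas_rker alpha)) //; exact: ae_regver.
have eC : C = sin (alpha * pi) / pi.
  apply: (leading_coefficient alpha01 nphi _ Fr' C0).
  - by move=> x x0; rewrite /= phi_le0.
  - by move=> x x01; rewrite /= HC.
(* On (0, 1) the difference vanishes identically, so any positive bound serves. *)
apply/eqO_exP; exists 1 => //; near=> x.
rewrite HC ?eC ?subrr ?normr0 ?mul1r //.
by apply/andP; split; near: x; [exact: nbhs_right_gt|exact: nbhs_right_lt].
Unshelve. all: by end_near. Qed.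

End existence.

Theorem theorem3 (R : realType) (alpha : R) (halpha : 0 < alpha < 1)
    (P : probability (measurableTypeR R) R)
    (hP : darling_mandelbrot alpha P)
    (g : R -> R) (hg : is_density P g) :
  exists f : R -> R,
    {ae lebesgue_measure, forall x, f x = g x} /\
    unique (dm_solution alpha) f.
Proof.
case: hP => P0 Pcf; have [hf fg] := density_positive_part hg P0.
set f := fun x : R => _ in hf fg.
have f1 := integral_density hf; have intf := integrable_density hf.
have nf : nnmeas (EFin \o f).
  by case: hf => mf f0 _; split; [exact/measurable_EFinP|move=> x; rewrite lee_fin].
have cf : causal (EFin \o f) by move=> x x0; rewrite /= /f ltNge x0.
have Fr : ae_eq (@lebesgue_measure R) setT (econv (EFin \o f) (rker alpha)) heav.
  apply: (renewal_equation halpha nf cf intf) => s.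
  have [C [S [h1 h2 h3]]] := dm_charfun_equations halpha (Pcf s).
  (* A + iB is the characteristic function at s; what remains is to read these integrals against P
     as Lebesgue integrals with weight f. *)
  exists (\int[P]_x cos (s * x)), (\int[P]_x sin (s * x)), C, S; split => //.
  have := ft_Rintegral s intf; rewrite {1}/Rintegral f1.
  rewrite -(Rintegral_density hf) //; last 2 first.
  - by have := measurable_cos_affine s 0; under eq_fun do rewrite subr0.
  - by move=> x; rewrite ler_norml cos_geN1 cos_le1.
  rewrite -(Rintegral_density hf) //.
  - by have := measurable_sin_affine s 0; under eq_fun do rewrite subr0.
  - by move=> x; rewrite ler_norml sin_geN1 sin_le1.
have sol := dm_solution_regver halpha nf cf f1 Fr.
exists (regver alpha f); split; last by split=> // f2 sol2; exact: dm_solution_unique sol sol2.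
have := ae_regver halpha nf cf f1 Fr; move/aeI/(_ fg).
by apply: aeS => x [/(_ I) e <-]; case: e.
Qed.
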